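(* Let $p\in(1,\infty)$, let $X$ be a Banach space, let $A:D(A)\subseteq X\to X$ be a closed, densely defined linear operator having the property of maximal $L^p$-regularity, let $X_p=(X,D(A))_{1-1/p,p}$, and let $t_0\ge 0$. For every integer $n\ge 0$ let $f_n:[0,\infty)\times X_p\to X$ be a function such that (I.a) $f_n(\cdot,0)\in L^p_{\mathrm{loc}}([0,\infty);X)$; (I.b) for all $R>0$ there exists a function $\Psi^n_R\in L^p_{\mathrm{loc}}([0,\infty))$ such that for any $u_1,u_2\in X_p$ with $\|u_1\|_{X_p},\|u_2\|_{X_p}\le R$, $$\|f_n(t,u_1)-f_n(t,u_2)\|_X\le \Psi^n_R(t)\,\|u_1-u_2\|_{X_p}.$$ Suppose that $(f_n)_{n\ge1}$ converges to $f_0$ in $X$ uniformly on bounded subsets of $[0,\infty)\times X_p$, that is: (II.a) for every $\varepsilon>0$, every compact sub-interval $K\subset[0,\infty)$ and every $\eta>0$ there exists $N\ge1$ such that $$\sup_{t\in K}\ \sup_{\|u\|_{X_p}\le\eta}\|f_n(t,u)-f_0(t,u)\|_X<\varepsilon\qquad\text{for every } n\ge N.$$ Let $(u^n_0)_{n\ge0}\subset X_p$ be such that (III.a) $\|u_0^n-u_0^0\|_{X_p}\to0$ as $n\to\infty$, and for each $n\ge0$ let $\phi_n$ be the solution of $$\frac{d\phi_n(t)}{dt}+A\phi_n(t)=f_n(t,\phi_n(t)),\quad t>t_0,\qquad \phi_n(t_0)=u_0^n,$$ defined on its maximal interval of existence $[t_0,t_0+T_n)$. Then $T_n\in(0,\infty]$,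 $$T_0\le\limsup_{n\to\infty}T_n,$$ and the sequence $(\phi_n)_{n\ge1}$ converges to $\phi_0$ in the following sense: for every compact sub-interval $K\subset[t_0,t_0+T_0)$, (a) $\displaystyle\sup_{t\in K}\|\phi_n(t)-\phi_0(t)\|_{X_p}\to0$ as $n\to\infty$, and (b) $\displaystyle\|\phi_n-\phi_0\|_{W^{1,p}(K;X)\cap L^p(K;D(A))}\to0$ as $n\to\infty$.
   Context: Function spaces: for an interval $I\subset\mathbb{R}$ and a Banach space $Y$, $L^p(I;Y)$ is the Bochner space of strongly measurable $f:I\to Y$ with $\int_I\|f(t)\|_Y^p\,dt<\infty$, and $W^{1,p}(I;Y)$ is the space of $f\in L^p(I;Y)$ with weak derivative $\partial_tf\in L^p(I;Y)$, normed by $\sum_{\ell=0}^1\big(\int_I\|\partial_t^\ell f\|_Y^p\,dt\big)^{1/p}$. $L^p_{\mathrm{loc}}(I;Y)$ consists of all $f:I\to Y$ belonging to $L^p(K;Y)$ for every compact sub-interval $K\subset I$ (no $Y$ is written for scalar functions). The norm on an intersection is $\|f\|_{W^{1,p}(I;X)\cap L^p(I;Y)}=\|f\|_{L^p(I;Y)}+\|f\|_{W^{1,p}(I;X)}$. $D(A)$ carries the graph norm. Space of initial data: $X_p:=(X,D(A))_{1-1/p,p}$ is the real interpolation space; its norm can be expressed (up to equivalence) as $\|f\|_{X_p}=\inf\{\|F\|_{W^{1,p}(0,\infty;X)\cap L^p(0,\infty;D(A))}: f=F(0)\}$. Maximal regularity: for $0<T\le\infty$ and $I=[t_0,t_0+T)$,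 $A$ has the property of maximal $L^p$-regularity on $[t_0,t_0+T)$ if there is a constant $C=C(T)>0$ such that for every $f\in L^p(I;X)$ and $u_0\in X_p$ there is a unique $u\in L^p(I;D(A))\cap W^{1,p}(I;X)$ satisfying $\frac{du}{dt}+Au=f(t)$ for almost every $t\in I$ and $u(t_0)=u_0$, and moreover $\|u\|_{W^{1,p}(I;X)\cap L^p(I;D(A))}\le C(T)(\|u_0\|_{X_p}+\|f\|_{L^p(I;X)})$. The constant $C$ can be chosen to be a non-decreasing function of $T$. When no interval is mentioned, the property is meant on $[t_0,t_0+T)$ for every finite $T>0$. Solutions are strong solutions: a solution on $[t_0,t_0+T_n)$ is a function lying in $W^{1,p}(J;X)\cap L^p(J;D(A))$ for every compact interval $J=[t_0,t_0+T']$ with $0<T'<T_n$ (hence continuous with values in $X_p$), satisfying the equation for almost every $t$ and the initial condition. $[t_0,t_0+T_n)$ is maximal if the solution cannot be extended to a solution on a larger interval. The convergence statements on $K$ are understood for all $n$ large enough; in particular they include that $\phi_n$ is defined on $K$ (i.e. $K\subset[t_0,t_0+T_n)$) for all sufficiently large $n$.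
   Formalization: The formal theorem additionally assumes that for every n and every u in X_p the map t -> f_n(t,u) is strongly measurable on [0,oo); (I.a) gives this only for u = 0, and without it T_0 <= limsup T_n and T_n > 0 can fail. *)

(* Defs.v *)
From HB Require Import structures.
From mathcomp Require Import all_boot all_order all_algebra.
From mathcomp Require Import all_classical all_reals all_analysis.

Set Implicit Arguments.
Unset Strict Implicit.
Unset Printing Implicit Defensive.

Import Order.TTheory GRing.Theory Num.Theory.
Import numFieldNormedType.Exports.

Local Open Scope classical_set_scope.
Local Open Scope ring_scope.

(** MathComp-Analysis, over an arbitrary [R : realType].  A Banach space is a
    [completeNormedModType R]; a complex Banach space is covered by viewing it
    as a real one, which changes neither the norms nor the function spaces. *)

(** A linear subspace of [V] with its own norm, e.g. [D(A)] with the graph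
    norm inside [X].  [snorm] is only meaningful on the carrier. *)
Record normed_sub (R : realType) (V : normedModType R) := NormedSub {
  scarrier : set V;
  snorm : V -> R }.

Definition whole (R : realType) (V : normedModType R) : normed_sub V :=
  NormedSub setT (fun x => `|x|).

(** ** Bochner spaces *)

Section Bochner.
Context (R : realType) (V : normedModType R).
Implicit Types (Y : normed_sub V) (I : set R) (f g : R -> V).

Local Notation mu := (@lebesgue_measure R).

(** A simple function [\sum_e 1_(e.1) e.2], given by the list of its terms. *)
Definition simple_data := seq (set R * V).

Definition is_simple Y (s : simple_data) : Prop :=
  forall i, (i < size s)%N ->
    let e := nth (set0, 0) s i in
    [/\ measurable e.1, (mu e.1 < +oo)%E & scarrier Y e.2].

Definition simple_fun (s : simple_data) (t : R) : V :=
  \sum_(e <- s) (\1_(e.1) t : R) *: e.2.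

Definition simple_integral I (s : simple_data) : V :=
  \sum_(e <- s) fine (mu (e.1 `&` I)) *: e.2.

(** [Y]-valued almost everywhere on [I], and a.e. the limit in the norm of [Y]
    of [Y]-valued simple functions. *)
Definition strongly_measurable Y I f : Prop :=
  exists s : nat -> simple_data,
    (forall k, is_simple Y (s k)) /\
    {ae mu, forall t, I t ->
      scarrier Y (f t) /\
      (fun k => snorm Y (simple_fun (s k) t - f t)) @ \oo --> (0 : R)}.

(** [v] is the Bochner integral of [f] over [I]. *)
Definition is_bochner I f (v : V) : Prop :=
  strongly_measurable (whole V) I f /\
  exists s : nat -> simple_data,
    [/\ forall k, is_simple (whole V) (s k),
        (fun k => \int[mu]_(t in I) (`|f t - simple_fun (s k) t|)%:E)%E
          @ \oo --> (0 : \bar R)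
      & (fun k => simple_integral I (s k)) @ \oo --> v].

Definition Lp_norm Y (p : R) I f : \bar R :=
  ((\int[mu]_(t in I) ((snorm Y (f t) `^ p)%R)%:E) `^ p^-1)%E.

Definition in_Lp Y (p : R) I f : Prop :=
  strongly_measurable Y I f /\ (Lp_norm Y p I f < +oo)%E.

Definition in_Lp_loc Y (p : R) I f : Prop :=
  forall a b : R, `[a, b] `<=` I -> in_Lp Y p `[a, b] f.

(** ** Weak derivatives and W^{1,p} *)

(** Smooth functions compactly supported in the interior of [I]. *)
Definition test_function I (phi : R -> R) : Prop :=
  (forall (k : nat) (x : R), derivable (derive1n k phi) x 1) /\
  exists a b : R, `[a, b] `<=` interior I /\
    forall x, ~ `[a, b]%classic x -> phi x = 0.

Definition is_weak_derivative I f g : Prop :=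
  forall phi, test_function I phi ->
    exists v, is_bochner I (fun t => derive1 phi t *: f t) v /\
              is_bochner I (fun t => phi t *: g t) (- v).

(** Weak derivatives are unique up to a null set; this picks one when there is
    one, and is [0] otherwise. *)
Definition weak_derivative I f : R -> V :=
  xget (cst 0) [set g | is_weak_derivative I f g].

Definition in_W1p (p : R) I f : Prop :=
  [/\ in_Lp (whole V) p I f,
      is_weak_derivative I f (weak_derivative I f)
    & in_Lp (whole V) p I (weak_derivative I f)].

Definition W1p_norm (p : R) I f : \bar R :=
  (Lp_norm (whole V) p I f + Lp_norm (whole V) p I (weak_derivative I f))%E.

End Bochner.

(** ** Unbounded operators *)

(** [app] is a total function whose values outside [dom] are irrelevant. *)
Record linear_operator (R : realType) (X : normedModType R) := LinearOperator {
  dom : set X;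
  app :> X -> X;
  dom0 : dom 0;
  dom_linear : forall (a : R) x y, dom x -> dom y -> dom (a *: x + y);
  app_linear : forall (a : R) x y, dom x -> dom y ->
    app (a *: x + y) = a *: app x + app y }.

Section Operator.
Context (R : realType) (X : completeNormedModType R).
Implicit Types (A : linear_operator X) (p : R) (I : set R) (u : R -> X).

Local Notation mu := (@lebesgue_measure R).

Definition closed_operator A : Prop :=
  closed [set z : X * X | dom A z.1 /\ z.2 = A z.1].

Definition densely_defined A : Prop := dense (dom A).

(** D(A) with the graph norm. *)
Definition graph_space A : normed_sub X :=
  NormedSub (dom A) (fun x => `|x| + `|A x|).

(** ** The real interpolation space (X, D(A))_{1-1/p,p}, by the K-method *)

Definition K_functional A (s : R) (x : X) : R :=
  inf [set r | exists a b : X,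
    [/\ dom A b, x = a + b & r = `|a| + s * snorm (graph_space A) b]].

Definition interp_norm A (theta p : R) (x : X) : \bar R :=
  ((\int[mu]_(s in `]0%R, +oo[)
      (((s `^ (- theta) * K_functional A s x) `^ p / s)%R)%:E) `^ p^-1)%E.

(** Extended norm of [X_p]: it is [+oo] exactly outside [X_p]. *)
Definition Xp_norm A p (x : X) : \bar R := interp_norm A (1 - p^-1) p x.

Definition Xp A p : set X := [set x | (Xp_norm A p x < +oo)%E].

(** ** Maximal regularity *)

(** W^{1,p}(I;X) \cap L^p(I;D(A)).  Elements of W^{1,p} are identified with
    their continuous representatives, so that pointwise values make sense. *)
Definition in_MR A p I u : Prop :=
  [/\ in_W1p p I u, in_Lp (graph_space A) p I u & {within I, continuous u}].

Definition MR_norm A p I u : \bar R :=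
  (Lp_norm (graph_space A) p I u + W1p_norm p I u)%E.

(** The interval [t0, t0 + T), with [T] possibly infinite. *)
Definition ico (t0 : R) (T : \bar R) : set R :=
  [set t : R | t0 <= t /\ (t%:E < t0%:E + T)%E].

Definition linear_solution A p I (t0 : R) (u0 : X) (h u : R -> X) : Prop :=
  [/\ in_MR A p I u,
      {ae mu, forall t, I t -> weak_derivative I u t + A (u t) = h t}
    & u t0 = u0].

Definition maximal_regularity_on A p (t0 : R) (T : \bar R) : Prop :=
  let I := ico t0 T in
  exists C : R, 0 < C /\
    forall (h : R -> X) (u0 : X), in_Lp (whole X) p I h -> Xp A p u0 ->
      exists u : R -> X,
        [/\ linear_solution A p I t0 u0 h u,
            forall v, linear_solution A p I t0 u0 h v ->
              forall t, I t -> v t = u t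
          & (MR_norm A p I u <=
               C%:E * (Xp_norm A p u0 + Lp_norm (whole X) p I h))%E].

Definition maximal_regularity A p (t0 : R) : Prop :=
  forall T : R, 0 < T -> maximal_regularity_on A p t0 T%:E.

(** ** The semilinear problem *)

(** [f t] is only evaluated on [X_p]: an element of [in_MR] takes its values
    in [X_p]. *)
Definition is_solution A p (t0 : R) (f : R -> X -> X) (u0 : X)
    (T : \bar R) (phi : R -> X) : Prop :=
  phi t0 = u0 /\
  forall T' : R, 0 < T' -> (T'%:E < T)%E ->
    let J := `[t0, t0 + T']%classic in
    in_MR A p J phi /\
    {ae mu, forall t, J t ->
      weak_derivative J phi t + A (phi t) = f t (phi t)}.

(** [T = 0] is allowed, and means that there is no solution on any
    nondegenerate interval: [0 < T] is the local existence statement. *)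
Definition is_maximal_solution A p (t0 : R) (f : R -> X -> X) (u0 : X)
    (T : \bar R) (phi : R -> X) : Prop :=
  [/\ (0 <= T)%E,
      is_solution A p t0 f u0 T phi
    & forall (T' : \bar R) (psi : R -> X), (T < T')%E ->
        is_solution A p t0 f u0 T' psi ->
        ~ (forall t, ico t0 T t -> psi t = phi t)].

End Operator.

(* Main.v *)
Require Import Defs.
From HB Require Import structures.
From mathcomp Require Import all_boot all_order all_algebra.
From mathcomp Require Import all_classical all_reals all_analysis.
From mathcomp Require Import measurable_realfun ring lra.

(** Everything rests on an estimate for the linear problem that is local in
    time: if [u] solves [u' + A u = h] on [[t0, t0 + S)], then for all [t]

      [|u t|_Xp <= C (|u t0|_Xp + |h|_Lp(t0, t))],   [C] independent of [t],

    together with the maximal regularity bound of [u] itself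
    ([mr_solution_trace], [mr_solution_norm]).

    It is a trace estimate. Decomposing [u t = (u t - u tau) + u tau], where
    [tau] in [[t, t + s]] is a time at which the graph norm of [u] is at most
    its mean, bounds [K (s, u t)] by the integral over [[t, t + s]] of
    [|u'| + |u| + |A u|] ([K_functional_le]). Hardy's inequality ([hardy]) turns
    this into a bound of the part of the interpolation norm near [s = 0] by the
    maximal regularity norm of [u] to the right of [t], and the rest is
    controlled by [|u t|] ([trace_le]); the same argument gives the continuity
    of [u] in [Xp] ([trace_continuous]). It needs some room to the right of [t]:
    the problem is solved on [[t0, t0 + 2 S)] with right-hand side [h] cut off
    at [t], and by uniqueness this solution is [u] up to [t], whence the norm of
    [h] over [(t0, t)] only. The analysis of weak derivatives that this takes is
    their almost everywhere uniqueness ([is_weak_derivative_unique]) and the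
    bound of increments by the integral of the derivative
    ([weak_derivative_increment]).

    Let now the right-hand side be [F (t, u t)] with [F] Lipschitz in [Xp], with
    a constant [L t] that is only [p]-integrable. For [l] large, the norm of
    [L s * exp (l (s - t0))] in [Lp(t0, t)] is a small multiple of
    [exp (l (t - t0))] ([Lp_of_weight]). In the sup norm of [Xp] with this
    weight the local estimate is therefore a contraction: successive
    approximations converge on the whole interval ([so_semilinear]), and the
    distance of two solutions is bounded by the distances of the initial values
    and of the right-hand sides ([so_stability]).

    The fields [f n] are only locally Lipschitz. Composed with the radial
    retraction of [Xp] onto a ball they become Lipschitz. Fix [S < T 0] and a
    ball whose radius exceeds the supremum of [|phi 0 t|_Xp] on [[t0, t0 + S)]
    by [1]. The truncated problems for [f n] have solutions on [[t0, t0 + S)],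
    and by stability these converge to [phi 0], uniformly in [Xp] and in the
    maximal regularity norm. For [n] large they stay in the ball, so that they
    solve the original problems; by uniqueness and maximality [S <= T n] and
    they coincide with [phi n] ([solutions_converge]). As [S < T 0] is
    arbitrary, this gives all the assertions; [0 < T n] is the same truncation
    argument on a short interval ([maximal_pos]). *)

Set Implicit Arguments.
Unset Strict Implicit.
Unset Printing Implicit Defensive.
Import Order.TTheory GRing.Theory Num.Theory.
Import numFieldNormedType.Exports.
Local Open Scope classical_set_scope.
Local Open Scope ring_scope.

(** * Integrals and L^p norms of nonnegative functions *)

Section LowerIntegrals.
Context (R : realType).
Local Notation mu := (@lebesgue_measure R).
Implicit Types (D E : set R) (phi psi chi : R -> R) (p : R).

Lemma aeS (P Q : R -> Prop) : {ae mu, forall t, P t} ->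
  (forall t, P t -> Q t) -> {ae mu, forall t, Q t}.
Proof. by move=> h PQ; apply: (@filterS _ _ (ae_filter_ringOfSetsType mu)) h. Qed.

Lemma aeS2 (P1 P2 Q : R -> Prop) : {ae mu, forall t, P1 t} ->
  {ae mu, forall t, P2 t} ->
  (forall t, P1 t -> P2 t -> Q t) -> {ae mu, forall t, Q t}.
Proof.
by move=> h1 h2 PQ; apply: (@filterS2 _ _ (ae_filter_ringOfSetsType mu)) h1 h2.
Qed.

Lemma aeS3 (P1 P2 P3 Q : R -> Prop) : {ae mu, forall t, P1 t} ->
  {ae mu, forall t, P2 t} -> {ae mu, forall t, P3 t} ->
  (forall t, P1 t -> P2 t -> P3 t -> Q t) -> {ae mu, forall t, Q t}.
Proof.
by move=> h1 h2 h3 PQ; apply: (@filterS3 _ _ (ae_filter_ringOfSetsType mu)) h1 h2 h3.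
Qed.

Import HBNNSimple.

(** The integral of a nonnegative function is a supremum over the simple
    functions below it, which is monotone whether or not the functions are
    measurable; setting a simple function to [0] on a null set does not change
    its integral. *)
Lemma ge0_ae_le_integralW D (f g : R -> \bar R) :
  (forall t, D t -> 0 <= f t)%E -> (forall t, D t -> 0 <= g t)%E ->
  {ae mu, forall t, D t -> (f t <= g t)%E} ->
  (\int[mu]_(t in D) f t <= \int[mu]_(t in D) g t)%E.
Proof.
move=> f0 g0 [N [mN N0 fgN]]; rewrite integral_mkcond [leRHS]integral_mkcond.
rewrite !ge0_integralTE; try by move=> x; exact: erestrict_ge0.
apply: ge_ereal_sup => _ [h hf <-].
have mNc : measurable (~` N) by exact: measurableC.
pose h' := mul_nnsfun h (indic_nnsfun R mNc).
have -> : sintegral mu h = sintegral mu h'.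
  rewrite -!integralT_nnsfun; apply: ge0_ae_eq_integral => //.
  - by apply/measurable_EFinP.
  - exact/measurable_EFinP.
  - by move=> x _; rewrite lee_fin.
  - by move=> x _; rewrite lee_fin.
  exists N; split => // x /= hx; apply: contrapT => Nx; apply: hx => _.
  by rewrite /= /mindic indicE mem_set// mulr1.
apply: ereal_sup_ubound; exists h' => //= x.
rewrite /= /mindic indicE; have [Nx|Nx] := boolP (x \in ~` N); last first.
  by rewrite mulr0 erestrict_ge0.
rewrite mulr1 (le_trans (hf x))//; rewrite /patch; case: ifPn => // xD.
apply: contrapT => fg; move: Nx; rewrite inE; apply; apply: fgN => /= H.
by apply: fg; apply: H; rewrite inE in xD.
Qed.

Lemma le_integral_set D E (f : R -> \bar R) : D `<=` E ->
  (forall t, E t -> 0 <= f t)%E ->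
  (\int[mu]_(t in D) f t <= \int[mu]_(t in E) f t)%E.
Proof.
move=> DE f0; rewrite integral_mkcond [leRHS]integral_mkcond.
apply: ge0_ae_le_integralW.
- by move=> x _; apply: erestrict_ge0 => t /DE /f0.
- by move=> x _; apply: erestrict_ge0 => t /f0.
apply: nearW => x _; rewrite /patch; case: ifPn => xD.
  by rewrite mem_set//; apply: DE; rewrite inE in xD.
by case: ifPn => //; rewrite inE => /f0.
Qed.

(** Measurability for the completed measure. Norms of strongly measurable
    functions are only known to have this property. *)
Definition ae_measurable D phi :=
  exists psi, measurable_fun setT psi /\ {ae mu, forall t, D t -> phi t = psi t}.

Lemma ae_measurable_fun_eq D phi : measurable_fun setT phi -> ae_measurable D phi.
Proof. by move=> mphi; exists phi; split => //; exact: nearW. Qed.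

Lemma ae_measurable_sub D E phi : E `<=` D -> ae_measurable D phi -> ae_measurable E phi.
Proof.
move=> ED [chi [mchi echi]]; exists chi; split => //.
by apply: (aeS echi) => t h /ED /h.
Qed.

Lemma ae_measurable_comp D phi (g : R -> R) : measurable_fun setT g ->
  ae_measurable D phi -> ae_measurable D (g \o phi).
Proof.
move=> mg [chi [mchi echi]]; exists (g \o chi); split; first exact: measurableT_comp.
by apply: (aeS echi) => t h /h /= ->.
Qed.

Lemma ae_measurableD D phi psi : ae_measurable D phi -> ae_measurable D psi ->
  ae_measurable D (fun t => phi t + psi t).
Proof.
move=> [a [ma ea]] [b [mb eb]]; exists (fun t => a t + b t); split.
  exact: measurable_funD.
by apply: (aeS2 ea eb) => t h1 h2 Dt; rewrite h1// h2.
Qed.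

Lemma ae_measurableM D phi psi : ae_measurable D phi -> ae_measurable D psi ->
  ae_measurable D (fun t => phi t * psi t).
Proof.
move=> [a [ma ea]] [b [mb eb]]; exists (fun t => a t * b t); split.
  exact: measurable_funM.
by apply: (aeS2 ea eb) => t h1 h2 Dt; rewrite h1// h2.
Qed.

Lemma ae_measurable_rep D phi : measurable D -> ae_measurable D phi ->
  (forall t, 0 <= phi t) ->
  exists psi, [/\ measurable_fun setT psi,
    {ae mu, forall t, D t -> phi t = psi t},
    forall t, ~ D t -> psi t = 0 & forall t, 0 <= psi t].
Proof.
move=> mD [a [ma ea]] phi0.
exists ((fun t => `|a t|) \_ D); split.
- apply/(measurable_restrictT _ mD).
  apply: (@measurable_funS _ _ _ _ setT) => //.
  exact: measurableT_comp.
- apply: (aeS ea) => t h Dt; rewrite /patch mem_set// -h//.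
  by rewrite ger0_norm.
- by move=> t Dt; rewrite /patch memNset.
- by move=> t; rewrite /patch; case: ifP.
Qed.

Lemma ae_eq_integralW D (f g : R -> \bar R) :
  (forall t, D t -> 0 <= f t)%E -> (forall t, D t -> 0 <= g t)%E ->
  {ae mu, forall t, D t -> f t = g t} ->
  (\int[mu]_(t in D) f t = \int[mu]_(t in D) g t)%E.
Proof.
move=> f0 g0 h; apply/eqP; rewrite eq_le; apply/andP; split;
  by apply: ge0_ae_le_integralW => //; apply: (aeS h) => t e /e ->.
Qed.

Lemma ae_ge0_integralD D phi psi : measurable D ->
  ae_measurable D phi -> ae_measurable D psi ->
  (forall t, 0 <= phi t) -> (forall t, 0 <= psi t) ->
  (\int[mu]_(t in D) (phi t + psi t)%:E =
   \int[mu]_(t in D) (phi t)%:E + \int[mu]_(t in D) (psi t)%:E)%E.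
Proof.
move=> mD aphi apsi phi0 psi0.
have [a [ma ea _ a0]] := ae_measurable_rep mD aphi phi0.
have [b [mb eb _ b0]] := ae_measurable_rep mD apsi psi0.
rewrite (@ae_eq_integralW D (EFin \o phi) (EFin \o a))//=; last 3 first.
- by move=> t _; rewrite lee_fin.
- by move=> t _; rewrite lee_fin.
- by apply: (aeS ea) => t h /h ->.
rewrite (@ae_eq_integralW D (EFin \o psi) (EFin \o b))//=; last 3 first.
- by move=> t _; rewrite lee_fin.
- by move=> t _; rewrite lee_fin.
- by apply: (aeS eb) => t h /h ->.
rewrite -ge0_integralD//; last 4 first.
- by move=> t _; rewrite lee_fin.
- by apply/measurable_EFinP; exact: measurable_funTS.
- by move=> t _; rewrite lee_fin.
- by apply/measurable_EFinP; exact: measurable_funTS.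
apply: ae_eq_integralW.
- by move=> t _; rewrite lee_fin addr_ge0.
- by move=> t _; rewrite adde_ge0// lee_fin.
by apply: (aeS2 ea eb) => t h1 h2 Dt; rewrite h1// h2.
Qed.

Lemma le_integralD D phi psi chi : measurable D ->
  ae_measurable D phi -> ae_measurable D psi ->
  (forall t, 0 <= phi t) -> (forall t, 0 <= psi t) -> (forall t, 0 <= chi t) ->
  {ae mu, forall t, D t -> chi t <= phi t + psi t} ->
  (\int[mu]_(t in D) (chi t)%:E <=
   \int[mu]_(t in D) (phi t)%:E + \int[mu]_(t in D) (psi t)%:E)%E.
Proof.
move=> mD aphi apsi phi0 psi0 chi0 le; rewrite -ae_ge0_integralD//.
apply: ge0_ae_le_integralW.
- by move=> t _; rewrite lee_fin.
- by move=> t _; rewrite lee_fin addr_ge0.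
by apply: (aeS le) => t h Dt; rewrite lee_fin h.
Qed.

(** The scalar part of [Lp_norm]: [Lp_norm Y p I f] is [Lp_of p I] applied to
    the norm of [f]. *)
Definition Lp_of (p : R) D phi : \bar R :=
  ((\int[mu]_(t in D) ((phi t `^ p)%R)%:E) `^ p^-1)%E.

Lemma Lp_of_ge0 p D phi : (0 <= Lp_of p D phi)%E.
Proof. exact: poweR_ge0. Qed.

Lemma le_Lp_of p D phi psi : 0 < p ->
  {ae mu, forall t, D t -> 0 <= phi t <= psi t} ->
  (Lp_of p D phi <= Lp_of p D psi)%E.
Proof.
move=> p0 h; rewrite /Lp_of; apply: gt0_ler_poweR.
- by rewrite invr_ge0 ltW.
- by rewrite in_itv/= leey andbT integral_ge0// => t _; rewrite lee_fin powR_ge0.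
- by rewrite in_itv/= leey andbT integral_ge0// => t _; rewrite lee_fin powR_ge0.
apply: ge0_ae_le_integralW.
- by move=> t _; rewrite lee_fin powR_ge0.
- by move=> t _; rewrite lee_fin powR_ge0.
apply: (aeS h) => t h' Dt; have /andP[h1 h2] := h' Dt.
rewrite lee_fin; apply: ge0_ler_powR; rewrite ?nnegrE//; first exact: ltW.
exact: le_trans h2.
Qed.

Lemma Lp_of_le_powR p D phi (c : R) : 0 < p -> 0 <= c ->
  (\int[mu]_(t in D) (phi t `^ p)%:E <= (c `^ p)%:E)%E -> (Lp_of p D phi <= c%:E)%E.
Proof.
move=> p0 c0 h; apply: (@le_trans _ _ ((c `^ p)%:E `^ p^-1)%E).
  apply: gt0_ler_poweR => //.
  - by rewrite invr_ge0 ltW.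
  - by rewrite in_itv/= leey andbT integral_ge0// => t _; rewrite lee_fin powR_ge0.
  - by rewrite in_itv/= leey andbT lee_fin powR_ge0.
by rewrite poweR_EFin -powRrM divff ?gt_eqF// powRr1.
Qed.

Lemma eq_Lp_of p D phi psi : 0 < p ->
  {ae mu, forall t, D t -> phi t = psi t} -> Lp_of p D phi = Lp_of p D psi.
Proof.
move=> p0 h; rewrite /Lp_of.
suff -> : (\int[mu]_(t in D) ((phi t `^ p)%R)%:E =
           \int[mu]_(t in D) ((psi t `^ p)%R)%:E)%E by [].
apply: ae_eq_integralW.
- by move=> t _; rewrite lee_fin powR_ge0.
- by move=> t _; rewrite lee_fin powR_ge0.
by apply: (aeS h) => t e /e ->.
Qed.

Lemma le_Lp_of_set p D E phi : 0 < p -> D `<=` E ->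
  (Lp_of p D phi <= Lp_of p E phi)%E.
Proof.
move=> p0 DE; rewrite /Lp_of; apply: gt0_ler_poweR.
- by rewrite invr_ge0 ltW.
- by rewrite in_itv/= leey andbT integral_ge0// => t _; rewrite lee_fin powR_ge0.
- by rewrite in_itv/= leey andbT integral_ge0// => t _; rewrite lee_fin powR_ge0.
by apply: le_integral_set => // t _; rewrite lee_fin powR_ge0.
Qed.

Lemma Lp_of_Lnorm p D phi : 0 < p -> measurable D -> (forall t, 0 <= phi t) ->
  (forall t, ~ D t -> phi t = 0) ->
  Lp_of p D phi = Lnorm mu p%:E (EFin \o phi).
Proof.
move=> p0 mD phi0 phiD; rewrite unlock /Lp_of.
suff -> : (\int[mu]_(t in D) ((phi t `^ p)%R)%:E =
           \int[mu]_t `|(EFin \o phi) t| `^ p)%E by [].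
rewrite integral_mkcond; apply: eq_integral => t _ /=.
rewrite /patch; case: ifPn => tD; first by rewrite ger0_norm.
by rewrite phiD ?normr0 ?powR0 ?gt_eqF//; move: tD; rewrite notin_setE.
Qed.

Lemma Lp_of_D p D phi psi chi : 1 <= p -> measurable D ->
  ae_measurable D phi -> ae_measurable D psi ->
  (forall t, 0 <= phi t) -> (forall t, 0 <= psi t) ->
  {ae mu, forall t, D t -> 0 <= chi t <= phi t + psi t} ->
  (Lp_of p D chi <= Lp_of p D phi + Lp_of p D psi)%E.
Proof.
move=> p1 mD aphi apsi phi0 psi0 le.
have p0 : 0 < p by exact: lt_le_trans p1.
have [a [ma ea aD a0]] := ae_measurable_rep mD aphi phi0.
have [b [mb eb bD b0]] := ae_measurable_rep mD apsi psi0.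
rewrite (eq_Lp_of p0 ea) (eq_Lp_of p0 eb) (Lp_of_Lnorm _ _ a0)// (Lp_of_Lnorm _ _ b0)//.
apply: le_trans (minkowski_EFin mu ma mb p1).
rewrite -(@Lp_of_Lnorm p D)//; last 2 first.
- by move=> t; rewrite addr_ge0.
- by move=> t Dt /=; rewrite aD// bD// addr0.
apply: le_Lp_of => //; apply: (aeS3 le ea eb) => t h1 h2 h3 Dt.
by rewrite /= -h2// -h3// h1.
Qed.

Lemma Lp_of_Z p D (c : R) phi : 0 < p -> measurable D -> 0 <= c ->
  ae_measurable D phi -> (forall t, 0 <= phi t) ->
  Lp_of p D (fun t => c * phi t) = (c%:E * Lp_of p D phi)%E.
Proof.
move=> p0 mD c0 aphi phi0.
have [a [ma ea _ a0]] := ae_measurable_rep mD aphi phi0.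
have -> : Lp_of p D (fun t => c * phi t) = Lp_of p D (fun t => c * a t).
  by apply: eq_Lp_of => //; apply: (aeS ea) => t h /h ->.
rewrite (eq_Lp_of p0 ea) /Lp_of.
under eq_integral do rewrite powRM// EFinM.
rewrite ge0_integralZl_EFin//; last 3 first.
- by move=> t _; rewrite lee_fin powR_ge0.
- by apply/measurable_EFinP; apply: measurable_funTS; exact: (measurableT_comp (measurable_powR _)).
- exact: powR_ge0.
rewrite poweRM ?lee_fin ?powR_ge0//; last first.
  by apply: integral_ge0 => t _; rewrite lee_fin powR_ge0.
by rewrite poweR_EFin -powRrM divff ?gt_eqF// powRr1.
Qed.

(** Dominated convergence, as the level tends to infinity. *)
Lemma integral_tail D (G : R -> R) (e : R) : measurable D ->
  ae_measurable D G -> (forall t, 0 <= G t) ->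
  (\int[mu]_(t in D) (G t)%:E < +oo)%E -> 0 < e ->
  exists M : R, 0 < M /\
   (\int[mu]_(t in D) ((if M < G t then G t else 0)%R)%:E <= e%:E)%E.
Proof.
move=> mD aG G0 Gfin e0.
have [a [ma ea aD a0]] := ae_measurable_rep mD aG G0.
have afin : (\int[mu]_(t in D) (a t)%:E < +oo)%E.
  rewrite (@ae_eq_integralW D (EFin \o a) (EFin \o G))//=.
  - by move=> t _; rewrite lee_fin.
  - by move=> t _; rewrite lee_fin.
  - by apply: (aeS ea) => t h /h ->.
have meas n : measurable_fun D (fun t => ((if n.+1%:R < a t then a t else 0)%R)%:E).
  apply/measurable_EFinP; apply: measurable_funTS.
  by apply: measurable_fun_ifT => //; exact: measurable_fun_ltr.
have H1 : {ae mu, forall t, D t ->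
    (fun n => ((if n.+1%:R < a t then a t else 0)%R)%:E) @ \oo --> (cst 0%E t : \bar R)}.
  apply: nearW => t _; apply: cvg_near_cst.
  near=> n; case: ifPn => //; rewrite ltNge => /negP H; exfalso; apply: H.
  apply: ltW; apply: lt_le_trans (_ : n%:R <= _); last by rewrite ler_nat.
  near: n; exact: nbhs_infty_gtr.
have H2 : mu.-integrable D (EFin \o a).
  apply/integrableP; split; first exact/measurable_EFinP/measurable_funTS.
  by under eq_integral do rewrite /= ger0_norm//.
have H3 : {ae mu, forall t n, D t ->
    (`|((if n.+1%:R < a t then a t else 0)%R)%:E| <= (EFin \o a) t)%E}.
  apply: nearW => t n _; rewrite lee_fin; case: ifP => _; last by rewrite normr0.
  by rewrite ger0_norm.
have [_ _ /=] := @dominated_convergence _ _ R mu D mD _ _ _ meas (measurable_cst _) H1 H2 H3.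
rewrite integral0 => /fine_cvgP[fin] /cvgrPdist_lt /(_ _ e0) H.
near \oo => n.
exists n.+1%:R; split => //.
rewrite (@ae_eq_integralW D _ (fun t => ((if n.+1%:R < a t then a t else 0)%R)%:E)); last 3 first.
- by move=> t _; rewrite lee_fin; case: ifP.
- by move=> t _; rewrite lee_fin; case: ifP.
- by apply: (aeS ea) => t h /h ->.
have fn : (\int[mu]_(t in D) ((if n.+1%:R < a t then a t else 0)%R)%:E)%E \is a fin_num.
  by near: n.
rewrite -(fineK fn) lee_fin; apply: le_trans (ler_norm _) _.
rewrite -normrN -sub0r; apply: ltW; near: n; exact: H.
Unshelve. all: by end_near. Qed.

End LowerIntegrals.

(** * Almost everywhere limits *)

Section AeLimits.
Context (R : realType).

Lemma squeeze_cvg0 (u v : nat -> R) : (forall k, 0 <= u k <= v k) ->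
  v @ \oo --> (0 : R) -> u @ \oo --> (0 : R).
Proof.
move=> uv /cvgrPdist_lt cv; apply/cvgrPdist_lt => e /cv; apply: filterS => k.
have /andP[u0 u1] := uv k; rewrite !sub0r !normrN !ger0_norm//; last exact: le_trans u1.
exact: le_lt_trans.
Qed.

Local Notation mu := (@lebesgue_measure R).
Implicit Types (I : set R).

Lemma squeeze_cvgD0 (u v w : nat -> R) : (forall k, 0 <= u k <= v k + w k) ->
  v @ \oo --> (0 : R) -> w @ \oo --> (0 : R) -> u @ \oo --> (0 : R).
Proof.
move=> uvw cv cw; apply: (squeeze_cvg0 uvw).
have h := @cvgD _ R^o _ _ _ v w 0 0 cv cw; rewrite addr0 in h; exact: h.
Qed.

(** The limsup of Borel representatives represents the limit. *)
Lemma ae_measurable_lim I (psi : nat -> R -> R) (phi : R -> R) :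
  (forall k, ae_measurable I (psi k)) ->
  {ae mu, forall t, I t -> (fun k => psi k t) @ \oo --> phi t} ->
  ae_measurable I phi.
Proof.
move=> /choice[a Ha] h.
have ea : {ae mu, forall t, forall k, I t -> psi k t = a k t}.
  by apply/ae_foralln => k; have [_] := Ha k.
exists (fun t => fine (limn_esup (fun k => (a k t)%:E))); split.
  apply: measurableT_comp => //; apply: measurable_fun_limn_esup => k.
  by apply/measurable_EFinP; have [] := Ha k.
apply: (aeS2 h ea) => t h1 h2 It.
have -> : limn_esup (fun k => (a k t)%:E) = (phi t)%:E.
  apply: (@cvg_limn_einf_sup R _ _ _).2.
  apply: cvg_EFin; first by apply: nearW.
  by under eq_fun => k do rewrite /= -h2//; exact: h1.
by [].
Qed.

Lemma bounded_cvg_integral0 I (psi : nat -> R -> R) : measurable I ->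
  (mu I < +oo)%E -> (forall k, ae_measurable I (psi k)) ->
  (forall k t, 0 <= psi k t <= 1) ->
  {ae mu, forall t, I t -> (fun k => psi k t) @ \oo --> (0 : R)} ->
  (fun k => \int[mu]_(t in I) (psi k t)%:E)%E @ \oo --> (0 : \bar R).
Proof.
move=> mI Ifin apsi psi01 cv.
have psi0 k t : 0 <= psi k t by have /andP[] := psi01 k t.
have /choice[a Ha] := fun k => ae_measurable_rep mI (apsi k) (psi0 k).
pose b k t := Num.min 1 (a k t).
have mb k : measurable_fun I (EFin \o b k).
  apply/measurable_EFinP; apply: measurable_funTS; apply: measurable_minr => //.
  by have [] := Ha k.
have b01 k t : 0 <= b k t <= 1.
  by have [_ _ _ a0] := Ha k; rewrite /b le_min ler01 a0/= ge_min lexx.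
have eb : {ae mu, forall t, forall k, I t -> psi k t = b k t}.
  apply/ae_foralln => k; have [_ e _ _] := Ha k; apply: (aeS e) => t e' It.
  by rewrite /b -e'//; have /andP[_ h] := psi01 k t; rewrite min_r.
have -> : (fun k => \int[mu]_(t in I) (psi k t)%:E)%E =
          (fun k => \int[mu]_(t in I) (b k t)%:E)%E.
  apply/funext => k; apply: ae_eq_integralW.
  - by move=> t _; rewrite lee_fin.
  - by move=> t _; rewrite lee_fin; have /andP[] := b01 k t.
  - by apply: (aeS eb) => t e It; rewrite e.
have H1 : {ae mu, forall t, I t ->
    (fun k => (EFin \o b k) t) @ \oo --> (cst 0%E t : \bar R)}.
  apply: (aeS2 cv eb) => t h1 h2 It; apply: cvg_EFin; first exact: nearW.
  by under eq_fun => k do rewrite /= -h2//; exact: h1.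
have H2 : mu.-integrable I (EFin \o cst 1).
  apply/integrableP; split; first by apply/measurable_EFinP; exact: measurable_cst.
  by under eq_integral do rewrite /= normr1; rewrite integral_cst// mul1e.
have H3 : {ae mu, forall t k, I t -> (`|(EFin \o b k) t| <= (EFin \o cst 1%R) t)%E}.
  apply: nearW => t n _; rewrite lee_fin; have /andP[b0 b1] := b01 n t.
  by rewrite ger0_norm.
have [_ _ /=] := @dominated_convergence _ _ R mu I mI _ _ _ mb (measurable_cst _) H1 H2 H3.
by rewrite integral0.
Qed.

(** The sum of the [psi k] has a finite integral, so that it is finite almost
    everywhere. *)
Lemma summable_integral_ae_cvg0 I (psi : nat -> R -> R) : measurable I ->
  (forall k, ae_measurable I (psi k)) -> (forall k t, 0 <= psi k t) ->
  (forall k, (\int[mu]_(t in I) (psi k t)%:E <= (1 / (2 ^ (k + 1))%:R)%:E)%E) ->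
  {ae mu, forall t, I t -> (fun k => psi k t) @ \oo --> (0 : R)}.
Proof.
move=> mI apsi psi0 hle.
have /choice[a Ha] := fun k => ae_measurable_rep mI (apsi k) (psi0 k).
have a0 k t : 0 <= a k t by have [] := Ha k.
have ma k : measurable_fun I (EFin \o a k).
  by apply/measurable_EFinP; apply: measurable_funTS; have [] := Ha k.
have ea : {ae mu, forall t, forall k, I t -> psi k t = a k t}.
  by apply/ae_foralln => k; have [] := Ha k.
have inta k : (\int[mu]_(t in I) (a k t)%:E <= (1 / (2 ^ (k + 1))%:R)%:E)%E.
  apply: le_trans (hle k); apply: ge0_ae_le_integralW.
  - by move=> t _; rewrite lee_fin.
  - by move=> t _; rewrite lee_fin.
  - by apply: (aeS ea) => t e It; rewrite e.
have fin : (\int[mu]_(t in I) (\sum_(0 <= k <oo) (a k t)%:E) < +oo)%E.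
  rewrite (@integral_nneseries _ _ _ mu I mI (fun k => EFin \o a k))//; last first.
    by move=> k t _; rewrite lee_fin.
  apply: (@le_lt_trans _ _ (\sum_(0 <= k <oo) (1 / (2 ^ (k + 1))%:R)%:E)%E).
    apply: lee_nneseries => [k _ _|k _]; last exact: inta.
    by apply: integral_ge0 => t _; rewrite lee_fin.
  have /cvg_lim -> // := @cvg_geometric_eseries_half R 1 0.
  by rewrite ltry.
have int : mu.-integrable I (fun t => \sum_(0 <= k <oo) (a k t)%:E)%E.
  apply/integrableP; split.
    apply: (@ge0_emeasurable_sum _ _ _ _ (fun k => EFin \o a k)) => // k t _ _.
    by rewrite lee_fin.
  have sum0 t : (0 <= \sum_(0 <= k <oo) (a k t)%:E)%E.
    by apply: nneseries_ge0 => k _ _; rewrite lee_fin.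
  apply: le_lt_trans fin; apply: ge0_ae_le_integralW => //.
  by apply: nearW => t _; rewrite gee0_abs.
have fin2 := @integrable_ae _ _ _ mu I mI _ int.
apply: (aeS2 fin2 ea) => t h1 h2 It.
under eq_fun => k do rewrite h2//.
apply: cvg_series_cvg_0; apply: nondecreasing_is_cvgn.
  by apply/nondecreasing_seqP => n; rewrite seriesSr lerDl.
exists (fine (\sum_(0 <= k <oo) (a k t)%:E)%E) => _ [n _ <-].
rewrite -lee_fin fineK ?h1// /series /= -sumEFin.
by apply: nneseries_lim_ge => k _ _; rewrite lee_fin.
Qed.

End AeLimits.

(** * Strongly measurable functions *)

Section StronglyMeasurable.
Context (R : realType) (V : normedModType R).
Local Notation mu := (@lebesgue_measure R).
Implicit Types (Y : normed_sub V) (D I : set R) (f g : R -> V) (s : simple_data V).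

(** Common to the whole space and to the domain of an operator with its graph
    norm, so that both are treated at once. *)
Record seminormed_subspace Y : Prop := SeminormedSubspace {
  sub0 : scarrier Y 0;
  subD : forall x y, scarrier Y x -> scarrier Y y -> scarrier Y (x + y);
  subZ : forall (a : R) x, scarrier Y x -> scarrier Y (a *: x);
  snorm_ge0 : forall x, 0 <= snorm Y x;
  snormD : forall x y, scarrier Y x -> scarrier Y y ->
    snorm Y (x + y) <= snorm Y x + snorm Y y;
  snormZ : forall (a : R) x, scarrier Y x -> snorm Y (a *: x) = `|a| * snorm Y x }.

Lemma whole_seminormed : seminormed_subspace (whole V).
Proof.
split => //=; [by move=> x y _ _; exact: ler_normD | by move=> a x _; exact: normrZ].
Qed.

Section Seminormed.
Variables (Y : normed_sub V) (HY : seminormed_subspace Y).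

Lemma subN x : scarrier Y x -> scarrier Y (- x).
Proof. by rewrite -scaleN1r; exact: subZ. Qed.

Lemma subB x y : scarrier Y x -> scarrier Y y -> scarrier Y (x - y).
Proof. by move=> hx /subN; exact: subD. Qed.

Lemma snormN x : scarrier Y x -> snorm Y (- x) = snorm Y x.
Proof. by move=> hx; rewrite -scaleN1r snormZ// normrN1 mul1r. Qed.

Lemma snorm0 : snorm Y 0 = 0.
Proof. by have := snormZ HY 0 (sub0 HY); rewrite normr0 mul0r scale0r. Qed.

Lemma snormBC x y : scarrier Y x -> scarrier Y y -> snorm Y (x - y) = snorm Y (y - x).
Proof. by move=> hx hy; rewrite -snormN ?opprB//; exact: subB. Qed.

Lemma snorm_dist x y : scarrier Y x -> scarrier Y y ->
  `|snorm Y x - snorm Y y| <= snorm Y (x - y).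
Proof.
move=> hx hy; rewrite ler_norml; apply/andP; split.
  rewrite lerNl opprB lerBlDr snormBC// -{1}(subrK x y) .
  by apply: snormD => //; exact: subB.
by rewrite lerBlDr -{1}(subrK y x); apply: snormD => //; exact: subB.
Qed.

Lemma is_simple_nil : is_simple Y [::].
Proof. by []. Qed.

Lemma is_simple_cons e s : is_simple Y (e :: s) <->
  [/\ measurable e.1, (mu e.1 < +oo)%E & scarrier Y e.2] /\ is_simple Y s.
Proof.
split=> [h|[h1 h2] [|i]//=]; first by split; [exact: (h 0)|move=> i si; exact: (h i.+1)].
by rewrite ltnS; exact: h2.
Qed.

Lemma is_simple_cat s s' : is_simple Y s -> is_simple Y s' -> is_simple Y (s ++ s').
Proof.
by elim: s => //= e s IH /is_simple_cons[he hs] hs'; apply/is_simple_cons; split => //; exact: IH.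
Qed.

Definition scale_simple (a : R) s : simple_data V := [seq (e.1, a *: e.2) | e <- s].
Definition restrict_simple D s : simple_data V := [seq (e.1 `&` D, e.2) | e <- s].

Lemma is_simple_scale a s : is_simple Y s -> is_simple Y (scale_simple a s).
Proof.
elim: s => //= e s IH /is_simple_cons[[h1 h2 h3] hs]; apply/is_simple_cons.
by split; [split => //=; exact: subZ | exact: IH].
Qed.

Lemma is_simple_restrict D s : measurable D ->
  is_simple Y s -> is_simple Y (restrict_simple D s).
Proof.
move=> mD; elim: s => //= e s IH /is_simple_cons[[h1 h2 h3] hs]; apply/is_simple_cons.
split; last exact: IH.
split => //=; first exact: measurableI.
by apply: le_lt_trans h2; apply: le_measure; rewrite ?inE//; exact: measurableI.
Qed.

Lemma simple_fun_nil t : simple_fun ([::] : simple_data V) t = 0.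
Proof. by rewrite /simple_fun big_nil. Qed.

Lemma simple_fun_cons e s t :
  simple_fun (e :: s) t = (\1_(e.1) t : R) *: e.2 + simple_fun s t.
Proof. by rewrite /simple_fun big_cons. Qed.

Lemma simple_fun_cat s s' t : simple_fun (s ++ s') t = simple_fun s t + simple_fun s' t.
Proof. by rewrite /simple_fun big_cat. Qed.

Lemma simple_fun_scale a s t : simple_fun (scale_simple a s) t = a *: simple_fun s t.
Proof.
rewrite /simple_fun big_map scaler_sumr; apply: eq_bigr => e _ /=.
by rewrite !scalerA mulrC.
Qed.

Lemma simple_fun_restrict D s t :
  simple_fun (restrict_simple D s) t = (\1_D t : R) *: simple_fun s t.
Proof.
rewrite /simple_fun big_map scaler_sumr; apply: eq_bigr => e _ /=.
by rewrite indicI scalerA mulrC.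
Qed.

Lemma simple_fun_carrier s t : is_simple Y s -> scarrier Y (simple_fun s t).
Proof.
elim: s => [|e s IH]; first by rewrite simple_fun_nil => _; exact: sub0.
move=> /is_simple_cons[[_ _ h] hs]; rewrite simple_fun_cons.
by apply: (subD HY); [exact: subZ|exact: IH].
Qed.

(** As a simple function takes finitely many values, [G] is arbitrary. *)
Lemma measurable_simple_comp (G : V -> R) s : is_simple Y s ->
  measurable_fun setT (fun t => G (simple_fun s t)).
Proof.
elim: s G => [|e s IH] G.
  by move=> _; under eq_fun do rewrite simple_fun_nil; exact: measurable_cst.
move=> /is_simple_cons[[me _ _] hs].
have -> : (fun t => G (simple_fun (e :: s) t)) =
   (fun t => (\1_(e.1) t : R) * G (e.2 + simple_fun s t) +
             (1 - (\1_(e.1) t : R)) * G (simple_fun s t)).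
  apply/funext => t; rewrite simple_fun_cons indicE; case: (t \in e.1) => /=.
    by rewrite mulr1n scale1r mul1r subrr mul0r addr0.
  by rewrite mulr0n scale0r mul0r subr0 mul1r !add0r.
apply: measurable_funD; apply: measurable_funM.
- exact: measurable_indic.
- exact: (IH (fun x => G (e.2 + x))).
- by apply: measurable_funB => //; exact: measurable_indic.
- exact: IH.
Qed.

Lemma strongly_measurable_carrier I f : strongly_measurable Y I f ->
  {ae mu, forall t, I t -> scarrier Y (f t)}.
Proof. by move=> [s [_ h]]; apply: (aeS h) => t h' /h' []. Qed.

Lemma strongly_measurable_snorm I f : strongly_measurable Y I f ->
  ae_measurable I (fun t => snorm Y (f t)).
Proof.
move=> [s [hs h]].
apply: (@ae_measurable_lim _ _ (fun k t => snorm Y (simple_fun (s k) t))).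
  by move=> k; apply: ae_measurable_fun_eq; exact: measurable_simple_comp.
apply: (aeS h) => t h' It; have [ft cv] := h' It.
apply/cvgrPdist_le => e e0; move/cvgrPdist_le/(_ e e0): cv; apply: filterS => k.
rewrite sub0r normrN ger0_norm ?snorm_ge0//; apply: le_trans.
by rewrite distrC; apply: snorm_dist => //; exact: simple_fun_carrier.
Qed.

Lemma strongly_measurable_simple I s : is_simple Y s ->
  strongly_measurable Y I (simple_fun s).
Proof.
move=> hs; exists (fun=> s); split => //; apply: nearW => t _.
split; first exact: simple_fun_carrier.
by rewrite subrr snorm0; exact: cvg_cst.
Qed.

Lemma strongly_measurable_cst I x : measurable I -> (mu I < +oo)%E ->
  scarrier Y x -> strongly_measurable Y I (fun=> x).
Proof.
move=> mI fI Yx; exists (fun=> [:: (I, x)]); split; first by move=> k; apply/is_simple_cons.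
apply: nearW => t It; split => //.
rewrite simple_fun_cons simple_fun_nil addr0 indicE mem_set// scale1r subrr snorm0.
exact: cvg_cst.
Qed.

Lemma strongly_measurableD I f g : strongly_measurable Y I f ->
  strongly_measurable Y I g -> strongly_measurable Y I (fun t => f t + g t).
Proof.
move=> [s [hs h]] [s' [hs' h']]; exists (fun k => s k ++ s' k); split.
  by move=> k; exact: is_simple_cat.
apply: (aeS2 h h') => t h1 h2 It; have [ft cf] := h1 It; have [gt cg] := h2 It.
split; first exact: subD.
apply: (squeeze_cvgD0 _ cf cg) => k; rewrite snorm_ge0//= simple_fun_cat opprD addrACA.
by apply: snormD => //; apply: subB => //; exact: simple_fun_carrier.
Qed.

Lemma strongly_measurableZ I (a : R) f : strongly_measurable Y I f ->
  strongly_measurable Y I (fun t => a *: f t).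
Proof.
move=> [s [hs h]]; exists (fun k => scale_simple a (s k)); split.
  by move=> k; exact: is_simple_scale.
apply: (aeS h) => t h1 It; have [ft cf] := h1 It; split; first exact: subZ.
rewrite -(mulr0 `|a|).
under eq_fun => k.
  rewrite simple_fun_scale -scalerBr snormZ//; last first.
    by apply: subB => //; exact: simple_fun_carrier.
  over.
by apply: cvgM => //; exact: cvg_cst.
Qed.

Lemma strongly_measurableB I f g : strongly_measurable Y I f ->
  strongly_measurable Y I g -> strongly_measurable Y I (fun t => f t - g t).
Proof.
move=> hf /(strongly_measurableZ (-1)) hg.
by under eq_fun do rewrite -scaleN1r; exact: strongly_measurableD.
Qed.

Lemma strongly_measurable_ae I f g : {ae mu, forall t, I t -> f t = g t} ->
  strongly_measurable Y I f -> strongly_measurable Y I g.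
Proof.
move=> e [s [hs h]]; exists s; split => //.
by apply: (aeS2 e h) => t e' h' It; rewrite -e'//; exact: h'.
Qed.

Lemma strongly_measurable_sub I D f : D `<=` I ->
  strongly_measurable Y I f -> strongly_measurable Y D f.
Proof.
by move=> DI [s [hs h]]; exists s; split => //; apply: (aeS h) => t h' /DI /h'.
Qed.

Lemma strongly_measurable_indic I D f : measurable D -> 
  strongly_measurable Y I f -> strongly_measurable Y I (fun t => (\1_D t : R) *: f t).
Proof.
move=> mD [s [hs h]]; exists (fun k => restrict_simple D (s k)); split.
  by move=> k; exact: is_simple_restrict.
apply: (aeS h) => t h1 It; have [ft cf] := h1 It; split; first exact: subZ.
move: cf; apply: squeeze_cvg0 => k; rewrite snorm_ge0//= simple_fun_restrict -scalerBr.
rewrite snormZ//; last by apply: subB => //; exact: simple_fun_carrier.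
by rewrite ler_piMl ?snorm_ge0// indicE; case: (_ \in _); rewrite ?normr1 ?normr0.
Qed.

(** For each [n] the simple functions of [f n] converge in measure, so that one
    of them is as close to [f n] as needed for the errors to be summable. *)
Lemma strongly_measurable_lim I (f : nat -> R -> V) g : measurable I ->
  (mu I < +oo)%E -> (forall n, strongly_measurable Y I (f n)) ->
  {ae mu, forall t, I t -> scarrier Y (g t) /\
     (fun n => snorm Y (f n t - g t)) @ \oo --> (0 : R)} ->
  strongly_measurable Y I g.
Proof.
move=> mI Ifin hf hg.
have /choice[s Hs] := hf.
pose phi n k t := Num.min 1 (snorm Y (simple_fun (s n k) t - f n t)).
have phi01 n k t : 0 <= phi n k t <= 1.
  by rewrite /phi le_min ler01 snorm_ge0//= ge_min lexx.
have aphi n k : ae_measurable I (phi n k).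
  apply: (@ae_measurable_comp _ _ _ (fun x => Num.min 1 x)).
    by apply: measurable_minr.
  apply: strongly_measurable_snorm; apply: strongly_measurableB => //.
  by apply: strongly_measurable_simple; have [] := Hs n.
have phicv n : {ae mu, forall t, I t -> (fun k => phi n k t) @ \oo --> (0 : R)}.
  have [_ h] := Hs n; apply: (aeS h) => t h' It; have [_] := h' It.
  apply: squeeze_cvg0 => k; have /andP[-> _]/= := phi01 n k t.
  by rewrite /phi ge_min lexx orbT.
have /choice[kk Hk] : forall n, exists k,
    (\int[mu]_(t in I) (phi n k t)%:E <= (1 / (2 ^ (n + 1))%:R)%:E)%E.
  move=> n; have := bounded_cvg_integral0 mI Ifin (aphi n) (phi01 n) (phicv n).
  have e0 : (0 < (1 / (2 ^ (n + 1))%:R)%:E :> \bar R)%E.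
    by rewrite lte_fin divr_gt0// ltr0n expn_gt0.
  move=> /fine_cvgP[fin /cvgrPdist_lt /(_ _ e0) H].
  near \oo => k; exists k.
  have fn : (\int[mu]_(t in I) (phi n k t)%:E)%E \is a fin_num by near: k.
  rewrite -(fineK fn) lee_fin; apply: le_trans (ler_norm _) _.
  by rewrite -normrN -sub0r; apply: ltW; near: k; exact: H.
have cv0 := @summable_integral_ae_cvg0 _ I (fun n => phi n (kk n)) mI
  (fun n => aphi n _) (fun n t => proj1 (andP (phi01 n (kk n) t))) Hk.
exists (fun n => s n (kk n)); split; first by move=> n; have [] := Hs n.
have hc : {ae mu, forall t, forall n, I t -> scarrier Y (f n t)}.
  by apply/ae_foralln => n; exact: strongly_measurable_carrier.
apply: (aeS3 cv0 hc hg) => t h1 h2 h3 It; have [gt cg] := h3 It; split => //.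
have {h1} h1 := h1 It.
have h1' : (fun n => snorm Y (simple_fun (s n (kk n)) t - f n t)) @ \oo --> (0:R).
  apply/cvgrPdist_lt => e e0.
  have e1 : 0 < Num.min 1 e by rewrite lt_min ltr01.
  move/cvgrPdist_lt/(_ _ e1): h1; apply: filterS => n.
  rewrite !sub0r !normrN !ger0_norm ?snorm_ge0//; last first.
    by have /andP[] := phi01 n (kk n) t.
  rewrite /phi !lt_min => /andP[].
  by rewrite !gt_min ltxx/= => h; case/orP => // e1'; have := lt_trans h e1'.
apply: (squeeze_cvgD0 _ h1' cg) => n; rewrite snorm_ge0//=.
have -> : simple_fun (s n (kk n)) t - g t =
   (simple_fun (s n (kk n)) t - f n t) + (f n t - g t) by rewrite addrA subrK.
by apply: snormD => //; apply: subB => //;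
  [apply: simple_fun_carrier; have [] := Hs n|exact: h2|exact: h2].
Unshelve. all: by end_near. Qed.

End Seminormed.
End StronglyMeasurable.

(** * The Bochner integral *)

Section BochnerIntegral.
Context (R : realType) (V : normedModType R).
Local Notation mu := (@lebesgue_measure R).
Local Notation W := (whole V).
Local Notation HW := (@whole_seminormed R V).
Implicit Types (D I J : set R) (f g : R -> V) (s : simple_data V) (v : V).

Lemma simple_integral_nil I : simple_integral I ([::] : simple_data V) = 0.
Proof. by rewrite /simple_integral big_nil. Qed.

Lemma simple_integral_cons I e s :
  simple_integral I (e :: s) = fine (mu (e.1 `&` I)) *: e.2 + simple_integral I s.
Proof. by rewrite /simple_integral big_cons. Qed.

Lemma simple_integral_cat I s s' :
  simple_integral I (s ++ s') = simple_integral I s + simple_integral I s'.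
Proof. by rewrite /simple_integral big_cat. Qed.

Lemma simple_integral_scale I a s :
  simple_integral I (scale_simple a s) = a *: simple_integral I s.
Proof.
rewrite /simple_integral big_map scaler_sumr; apply: eq_bigr => e _ /=.
by rewrite !scalerA mulrC.
Qed.

Lemma simple_integral_restrict I J s : J `<=` I ->
  simple_integral I (restrict_simple J s) = simple_integral J s.
Proof.
move=> JI; rewrite /simple_integral big_map; apply: eq_bigr => e _ /=.
by rewrite -setIA (setIidl JI).
Qed.

Lemma measure_finI D E : measurable D -> measurable E ->
  (mu D < +oo)%E -> (mu (D `&` E) < +oo)%E.
Proof.
move=> mD mE; apply: le_lt_trans; apply: le_measure; rewrite ?inE//.
exact: measurableI.
Qed.

Lemma simple_integral_setI D E s : measurable D -> measurable E ->
  is_simple W s -> simple_integral D s =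
  simple_integral (D `&` E) s + simple_integral (D `&` ~` E) s.
Proof.
move=> mD mE; elim: s => [|e s IH]; first by rewrite !simple_integral_nil addr0.
move=> /is_simple_cons[[me fe _] hs]; rewrite !simple_integral_cons IH//.
rewrite addrACA -scalerDl; congr (_ *: _ + _).
have mEc : measurable (~` E) by exact: measurableC.
rewrite -fineD; last 2 first.
- by rewrite ge0_fin_numE//; apply: measure_finI => //; exact: measurableI.
- by rewrite ge0_fin_numE//; apply: measure_finI => //; exact: measurableI.
rewrite -measureU; last 3 first.
- by apply: measurableI => //; exact: measurableI.
- by apply: measurableI => //; exact: measurableI.
- by apply/seteqP; split => // x [[_ [_ h]] [_ [_ h']]].
by rewrite -setIUr -setIUr setUv setIT.
Qed.

(** The constant [v] is there for the induction: on the set of the first term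
    of [s] and on its complement, this term becomes part of the constant. *)
Lemma le_norm_simple_integral D s v : measurable D -> (mu D < +oo)%E ->
  is_simple W s ->
  (`|fine (mu D) *: v + simple_integral D s|%:E <=
   \int[mu]_(t in D) (`|v + simple_fun s t|)%:E)%E.
Proof.
elim: s D v => [|e s IH] D v mD fD.
  move=> _; under eq_integral do rewrite simple_fun_nil addr0.
  rewrite simple_integral_nil addr0 normrZ integral_cst// EFinM muleC ger0_norm.
    by rewrite fineK// ge0_fin_numE.
  exact: fine_ge0.
move=> hes; have /is_simple_cons[[me fe _] hs] := hes.
have mec : measurable (~` e.1) by exact: measurableC.
have -> : (\int[mu]_(t in D) `|v + simple_fun (e :: s) t|%:E =
  \int[mu]_(t in D `&` e.1) `|(v + e.2) + simple_fun s t|%:E +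
  \int[mu]_(t in D `&` ~` e.1) `|v + simple_fun s t|%:E)%E.
  have DU : D = (D `&` e.1) `|` (D `&` ~` e.1) by rewrite -setIUr setUv setIT.
  rewrite {1}DU ge0_integral_setU//; last 4 first.
  - exact: measurableI.
  - exact: measurableI.
  - apply/measurable_EFinP; apply: measurable_funTS.
    exact: (measurable_simple_comp (fun x => `|v + x|) hes).
  - apply/disj_setPS => x [[_ h] [_ h']].
    exact: h'.
  congr (_ + _)%E; apply: eq_integral => t; rewrite inE => -[_ te];
    rewrite simple_fun_cons indicE.
    by rewrite mem_set// scale1r addrA.
  by rewrite memNset// scale0r add0r.
have -> : fine (mu D) *: v + simple_integral D (e :: s) =
  (fine (mu (D `&` e.1)) *: (v + e.2) + simple_integral (D `&` e.1) s) +
  (fine (mu (D `&` ~` e.1)) *: v + simple_integral (D `&` ~` e.1) s).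
  have fineE : fine (mu D) = fine (mu (D `&` e.1)) + fine (mu (D `&` ~` e.1)).
    rewrite -fineD; last 2 first.
    - by rewrite ge0_fin_numE//; exact: measure_finI.
    - by rewrite ge0_fin_numE//; exact: measure_finI.
    rewrite -measureU; last 3 first.
    - exact: measurableI.
    - exact: measurableI.
    - by apply/seteqP; split => // x [[_ h] [_ h']].
    by rewrite -setIUr setUv setIT.
  rewrite simple_integral_cons (simple_integral_setI mD me hs) [e.1 `&` D]setIC.
  rewrite fineE scalerDl scalerDr [RHS]addrACA [LHS]addrA; congr (_ + _).
  exact: addrAC.
apply: (@le_trans _ _ (`|fine (mu (D `&` e.1)) *: (v + e.2) + simple_integral (D `&` e.1) s|%:E
  + `|fine (mu (D `&` ~` e.1)) *: v + simple_integral (D `&` ~` e.1) s|%:E)%E).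
  by rewrite -EFinD lee_fin ler_normD.
by apply: leeD; apply: IH => //; try exact: measurableI; exact: measure_finI.
Qed.

Lemma le_norm_simple_integral0 D s : measurable D -> (mu D < +oo)%E ->
  is_simple W s ->
  (`|simple_integral D s|%:E <= \int[mu]_(t in D) (`|simple_fun s t|)%:E)%E.
Proof.
move=> mD fD hs; have := le_norm_simple_integral 0 mD fD hs.
by rewrite scaler0 add0r; under eq_integral do rewrite add0r.
Qed.

Lemma ae_measurable_norm D f : strongly_measurable W D f ->
  ae_measurable D (fun t => `|f t|).
Proof. exact: (strongly_measurable_snorm HW). Qed.

Lemma ae_measurable_dist_simple D f s : strongly_measurable W D f ->
  is_simple W s -> ae_measurable D (fun t => `|f t - simple_fun s t|).
Proof.
move=> hf hs; apply: ae_measurable_norm; apply: (strongly_measurableB HW) => //.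
exact: (strongly_measurable_simple HW).
Qed.

Lemma is_bochner_le_norm I f v : measurable I -> (mu I < +oo)%E ->
  is_bochner I f v -> (`|v|%:E <= \int[mu]_(t in I) (`|f t|)%:E)%E.
Proof.
move=> mI fI [mf [s [hs cf cs]]].
have [->|Ifin] := eqVneq (\int[mu]_(t in I) (`|f t|)%:E)%E +oo%E; first exact: leey.
apply/lee_addgt0Pr => e e0.
have e2 : 0 < e / 2 by rewrite divr_gt0.
move/cvgrPdist_lt/(_ _ e2): cs => cs.
move/fine_cvgP: cf => -[ffin /cvgrPdist_lt/(_ _ e2) cf].
near \oo => k.
have h1 : `|v - simple_integral I (s k)| < e / 2 by near: k.
have h2 : `|0 - fine (\int[mu]_(t in I) (`|f t - simple_fun (s k) t|)%:E)%E| < e / 2.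
  by near: k.
have h3 : (\int[mu]_(t in I) (`|f t - simple_fun (s k) t|)%:E)%E \is a fin_num.
  by near: k; exact: ffin.
have h4 := le_norm_simple_integral0 mI fI (hs k).
have h5 : (\int[mu]_(t in I) (`|simple_fun (s k) t|)%:E <=
    \int[mu]_(t in I) (`|f t|)%:E +
    \int[mu]_(t in I) (`|f t - simple_fun (s k) t|)%:E)%E.
  apply: le_integralD => //.
  - exact: ae_measurable_norm.
  - exact: ae_measurable_dist_simple.
  - apply: nearW => t _; have := ler_normD (simple_fun (s k) t - f t) (f t).
    by rewrite subrK distrC addrC.
apply: (@le_trans _ _ (`|simple_integral I (s k)|%:E + (e / 2)%:E)%E).
  rewrite -EFinD lee_fin -{1}(subrK (simple_integral I (s k)) v) addrC.
  by rewrite (le_trans (ler_normD _ _))// lerD2l ltW.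
rewrite [in leRHS](splitr e) EFinD addeA; apply: leeD => //.
apply: (le_trans h4); apply: (le_trans h5); apply: leeD => //.
rewrite -(fineK h3) lee_fin; apply: le_trans (ler_norm _) _.
by rewrite -normrN -sub0r ltW.
Unshelve. all: by end_near. Qed.

Lemma simple_integrable I s : measurable I -> is_simple W s ->
  (\int[mu]_(t in I) (`|simple_fun s t|)%:E < +oo)%E.
Proof.
move=> mI; elim: s => [|e s IH].
  by move=> _; under eq_integral do rewrite simple_fun_nil normr0; rewrite integral0 ltry.
move=> hes; have /is_simple_cons[[me fe _] hs] := hes.
have h : (\int[mu]_(t in I) (`|simple_fun (e :: s) t|)%:E <=
  \int[mu]_(t in I) (`|e.2| * \1_(e.1) t)%:E + \int[mu]_(t in I) (`|simple_fun s t|)%:E)%E.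
  apply: le_integralD => //.
  - apply: ae_measurable_fun_eq; apply: measurable_funM => //.
  - by apply: ae_measurable_fun_eq; exact: (measurable_simple_comp (fun x => `|x|) hs).
  - apply: nearW => t _; rewrite simple_fun_cons (le_trans (ler_normD _ _))// lerD2r.
    by rewrite normrZ mulrC ger0_norm.
apply: (le_lt_trans h); apply: lte_add_pinfty; last exact: IH.
under eq_integral do rewrite EFinM.
rewrite ge0_integralZl_EFin//; last 2 first.
- by rewrite integral_indic// lte_mul_pinfty//; exact: measure_finI.
- by apply/measurable_EFinP; exact: measurable_indic.
Qed.

Lemma is_bochner_integrable I f v : measurable I -> is_bochner I f v ->
  (\int[mu]_(t in I) (`|f t|)%:E < +oo)%E.
Proof.
move=> mI [mf [s [hs /fine_cvgP[ffin _] _]]].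
near \oo => k.
have h3 : (\int[mu]_(t in I) (`|f t - simple_fun (s k) t|)%:E)%E \is a fin_num.
  by near: k; exact: ffin.
have h : (\int[mu]_(t in I) (`|f t|)%:E <=
    \int[mu]_(t in I) (`|f t - simple_fun (s k) t|)%:E +
    \int[mu]_(t in I) (`|simple_fun (s k) t|)%:E)%E.
  apply: le_integralD => //.
  - exact: ae_measurable_dist_simple.
  - by apply: ae_measurable_fun_eq; exact: (measurable_simple_comp (fun x => `|x|) (hs k)).
  - by apply: nearW => t _; rewrite -{1}(subrK (simple_fun (s k) t) (f t)) ler_normD.
apply: (le_lt_trans h); apply: lte_add_pinfty; last exact: simple_integrable.
by rewrite ltey_eq h3.
Unshelve. all: by end_near. Qed.

Lemma squeeze_cvge0 (u v : nat -> \bar R) : (forall k, (0 <= u k <= v k)%E) ->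
  v @ \oo --> (0 : \bar R) -> u @ \oo --> (0 : \bar R).
Proof.
move=> uv cv.
apply: (@squeeze_cvge nat \oo _ R (fun=> 0%E) u v _ 0%E _ cv); first exact: nearW.
exact: cvg_cst.
Qed.

Lemma is_bochnerD I f g v w : measurable I ->
  is_bochner I f v -> is_bochner I g w ->
  is_bochner I (fun t => f t + g t) (v + w).
Proof.
move=> mI [mf [s [hs cf cs]]] [mg [s' [hs' cg cs']]]; split.
  exact: (strongly_measurableD HW).
exists (fun k => s k ++ s' k); split.
- by move=> k; exact: is_simple_cat.
- have cfg := @cvgeD nat \oo _ R _ _ 0%E 0%E isT cf cg.
  rewrite adde0 in cfg; apply: squeeze_cvge0 (cfg _) => k.
  rewrite integral_ge0//=; apply: le_integralD => //.
  + exact: ae_measurable_dist_simple.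
  + exact: ae_measurable_dist_simple.
  + apply: nearW => t _; rewrite simple_fun_cat opprD addrACA.
    exact: ler_normD.
- by under eq_fun do rewrite simple_integral_cat; exact: cvgD.
Qed.

Lemma is_bochnerZ I f v (a : R) : measurable I ->
  is_bochner I f v -> is_bochner I (fun t => a *: f t) (a *: v).
Proof.
move=> mI [mf [s [hs cf cs]]]; split.
  exact: (strongly_measurableZ HW).
exists (fun k => scale_simple a (s k)); split.
- by move=> k; exact: (is_simple_scale HW).
- have cfa := cvgeZl (isT : (`|a|%:E \is a fin_num)) cf; rewrite mule0 in cfa.
  apply: squeeze_cvge0 cfa => k.
  rewrite integral_ge0//=.
  have [b [mb eb _ b0]] := ae_measurable_rep mI
     (ae_measurable_dist_simple mf (hs k)) (fun t => normr_ge0 _).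
  rewrite [X in (_ <= _ * X)%E](@ae_eq_integralW _ I _ (EFin \o b))//=; last 2 first.
  + by move=> t _; rewrite lee_fin.
  + by apply: (aeS eb) => t e It; rewrite e.
  rewrite -ge0_integralZl_EFin//; last 2 first.
  + by move=> t _; rewrite lee_fin.
  + by apply/measurable_EFinP; exact: measurable_funTS.
  apply: ge0_ae_le_integralW => //.
  + by move=> t _; rewrite mule_ge0// lee_fin.
  + apply: (aeS eb) => t e It; rewrite /= simple_fun_scale -scalerBr normrZ EFinM.
    by rewrite e.
- by under eq_fun do rewrite simple_integral_scale; exact: cvgZr.
Qed.

Lemma is_bochnerB I f g v w : measurable I ->
  is_bochner I f v -> is_bochner I g w ->
  is_bochner I (fun t => f t - g t) (v - w).
Proof.
move=> mI hf /(is_bochnerZ (-1) mI) hg; rewrite -scaleN1r.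
by under eq_fun do rewrite -scaleN1r; exact: is_bochnerD.
Qed.

Lemma is_bochner_ae I f g v : {ae mu, forall t, I t -> f t = g t} ->
  is_bochner I f v -> is_bochner I g v.
Proof.
move=> e [mf [s [hs cf cs]]]; split; first exact: (strongly_measurable_ae e).
exists s; split => //.
suff -> : (fun k => \int[mu]_(t in I) (`|g t - simple_fun (s k) t|)%:E)%E =
  (fun k => \int[mu]_(t in I) (`|f t - simple_fun (s k) t|)%:E)%E by [].
apply/funext => k; apply: ae_eq_integralW => //.
by apply: (aeS e) => t e' It; rewrite e'.
Qed.

(** As [f] vanishes off [J], cutting the simple functions off [J] does not
    spoil their convergence in [L^1 (I)], which controls the integrals. *)
Lemma is_bochner_sub I J f v : measurable I -> measurable J -> (mu I < +oo)%E ->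
  J `<=` I -> (forall t, I t -> ~ J t -> f t = 0) ->
  is_bochner I f v -> is_bochner J f v.
Proof.
move=> mI mJ fI JI f0 [mf [s [hs cf cs]]].
split; first exact: (strongly_measurable_sub JI).
exists (fun k => restrict_simple J (s k)); split.
- by move=> k; exact: is_simple_restrict.
- apply: squeeze_cvge0 cf => k; rewrite integral_ge0//=.
  apply: le_trans (le_integral_set JI _) => //.
  apply: ge0_ae_le_integralW => //; apply: nearW => t Jt.
  by rewrite simple_fun_restrict indicE mem_set// scale1r.
under eq_fun do rewrite -(@simple_integral_restrict I J)//.
have <- : v + 0 = v by rewrite addr0.
have -> : (fun k => simple_integral I (restrict_simple J (restrict_simple J (s k)))) =
  (fun k => simple_integral I (s k) -
     simple_integral I (s k ++ scale_simple (-1) (restrict_simple J (s k)))).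
  apply/funext => k; rewrite simple_integral_cat simple_integral_scale scaleN1r opprD addrA subrr sub0r opprK.
  by rewrite !simple_integral_restrict.
rewrite -oppr0; apply: cvgB => //; apply: norm_cvg0.
apply/cvgrPdist_lt => e e0.
move/fine_cvgP: cf => -[ffin /cvgrPdist_lt/(_ _ e0) cf].
near=> k.
have h2 : `|0 - fine (\int[mu]_(t in I) (`|f t - simple_fun (s k) t|)%:E)%E| < e.
  by near: k.
have h3 : (\int[mu]_(t in I) (`|f t - simple_fun (s k) t|)%:E)%E \is a fin_num.
  by near: k; exact: ffin.
rewrite sub0r normrN normr_id; apply: le_lt_trans h2.
rewrite -lee_fin sub0r normrN [in leRHS]ger0_norm ?fine_ge0 ?integral_ge0// fineK//.
have hs' : is_simple W (s k ++ scale_simple (-1) (restrict_simple J (s k))).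
  apply: is_simple_cat => //; apply: (is_simple_scale HW).
  exact: is_simple_restrict.
apply: le_trans (le_norm_simple_integral0 mI fI hs') _.
apply: ge0_ae_le_integralW => //; apply: nearW => t It.
rewrite simple_fun_cat simple_fun_scale simple_fun_restrict indicE lee_fin.
have [tJ|tJ] := boolP (t \in J); first by rewrite scale1r scaleN1r subrr normr0.
rewrite scale0r scaler0 addr0 f0// ?sub0r ?normrN//.
by move/mem_set => h; rewrite h in tJ.
Unshelve. all: by end_near. Qed.

Definition real_simple (r : seq (set R * R)) (t : R) : R :=
  \sum_(e <- r) e.2 * \1_(e.1) t.

Definition vector_simple (x : V) (r : seq (set R * R)) : simple_data V :=
  [seq (e.1, e.2 *: x) | e <- r].

Lemma simple_fun_vector x r t :
  simple_fun (vector_simple x r) t = real_simple r t *: x.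
Proof.
rewrite /simple_fun big_map /real_simple scaler_suml; apply: eq_bigr => e _.
by rewrite /= scalerA mulrC.
Qed.

Lemma measurable_real_simple (r : seq (set R * R)) :
  (forall e, e \in r -> measurable e.1) -> measurable_fun setT (real_simple r).
Proof.
elim: r => [|e r IH] h.
  by rewrite /real_simple; under eq_fun do rewrite big_nil; exact: measurable_cst.
rewrite /real_simple; under eq_fun do rewrite big_cons; apply: measurable_funD.
  by apply: measurable_funM => //; apply: measurable_indic; apply: h; exact: mem_head.
by apply: IH => e' re'; apply: h; rewrite inE re' orbT.
Qed.

Lemma simple_integral_vector I x (r : seq (set R * R)) : measurable I ->
  (forall e, e \in r -> [/\ measurable e.1, (mu e.1 < +oo)%E & 0 <= e.2]) ->
  simple_integral I (vector_simple x r) =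
  fine (\int[mu]_(t in I) (real_simple r t)%:E) *: x.
Proof.
move=> mI hr.
suff [-> ->] : simple_integral I (vector_simple x r) =
    (\sum_(e <- r) e.2 * fine (mu (e.1 `&` I))) *: x /\
    (\int[mu]_(t in I) (real_simple r t)%:E =
    (\sum_(e <- r) e.2 * fine (mu (e.1 `&` I)))%:E)%E by [].
split.
  rewrite /simple_integral big_map scaler_suml; apply: eq_bigr => e _ /=.
  by rewrite scalerA mulrC.
elim: r hr => [|e r IH] hr.
  by rewrite big_nil; under eq_integral do rewrite /real_simple big_nil; rewrite integral0.
have [me fe e0] := hr e (mem_head _ _).
have hr' : forall e, e \in r -> [/\ measurable e.1, (mu e.1 < +oo)%E & 0 <= e.2].
  by move=> e' re'; apply: hr; rewrite inE re' orbT.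
rewrite big_cons EFinD -IH//.
under eq_integral do rewrite /real_simple big_cons EFinD.
rewrite ge0_integralD//; last 4 first.
- by move=> t _; rewrite lee_fin mulr_ge0.
- by apply/measurable_EFinP; apply: measurable_funTS; apply: measurable_funM.
- move=> t _; rewrite lee_fin big_seq; apply: sumr_ge0 => e' re'.
  by rewrite mulr_ge0//; have [] := hr' _ re'.
- apply/measurable_EFinP; apply: measurable_funTS; apply: measurable_real_simple.
  by move=> e' re'; have [] := hr' _ re'.
congr (_ + _)%E; under eq_integral do rewrite EFinM.
rewrite ge0_integralZl_EFin//; last first.
  by apply/measurable_EFinP.
rewrite integral_indic// EFinM fineK// ge0_fin_numE//.
exact: measure_finI.
Qed.

Import HBNNSimple.

(** The simple approximations are the increasing simple approximations of [c],
    multiplied by [x]. *)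
Lemma is_bochner_scalar I (c : R -> R) (x : V) : measurable I -> (mu I < +oo)%E ->
  measurable_fun setT c -> (forall t, 0 <= c t) ->
  (\int[mu]_(t in I) (c t)%:E < +oo)%E ->
  is_bochner I (fun t => c t *: x) (fine (\int[mu]_(t in I) (c t)%:E) *: x).
Proof.
move=> mI fI mc c0 cfin.
have mcI : measurable_fun I (EFin \o c).
  by apply/measurable_EFinP; exact: measurable_funTS.
pose h := nnsfun_approx mI mcI.
have hcvE t : I t -> (EFin \o (fun k => h k t)) @ \oo --> (c t)%:E.
  by move=> It; apply: (cvg_nnsfun_approx mI mcI) => // u _; rewrite /= lee_fin.
have hcv t : I t -> (fun k => h k t) @ \oo --> c t.
  by move=> /hcvE/fine_cvgP[].
have hle t k : I t -> h k t <= c t.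
  move=> It; have <- : limn (fun k => h k t) = c t by apply/cvg_lim => //; exact: hcv.
  apply: nondecreasing_cvgn_le; last by apply/cvg_ex; exists (c t); exact: hcv.
  by move=> m n mn; exact/lefP/nd_nnsfun_approx.
pose r k : seq (set R * R) :=
  [seq (h k @^-1` [set y] `&` I, y) | y <- finmap.enum_fset (fset_set (range (h k)))].
have hr k e : e \in r k -> [/\ measurable e.1, (mu e.1 < +oo)%E & 0 <= e.2].
  move=> /mapP[y]; rewrite in_fset_set// inE => -[u _ <-] -> /=; split => //.
  - by apply: measurableI.
  - by rewrite setIC; apply: measure_finI.
have rE k t : I t -> real_simple (r k) t = h k t.
  move=> It; rewrite (fimfunE (h k) t) fsbig_finite//= /real_simple big_map.
  apply: eq_bigr => y _ /=; congr (_ * _).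
  by rewrite indicI /= [\1_I t]indicE mem_set// mulr1.
have hs k : is_simple W (vector_simple x (r k)).
  elim: (r k) (hr k) => [_|e r' IH hr']; first exact: is_simple_nil.
  have [m1 m2 _] := hr' e (mem_head _ _).
  apply/is_simple_cons; split => //.
  by apply: IH => e' re'; apply: hr'; rewrite inE re' orbT.
have sE k t : I t -> simple_fun (vector_simple x (r k)) t = h k t *: x.
  by move=> It; rewrite simple_fun_vector rE.
have H1 : {ae mu, forall t, I t -> (fun k => (EFin \o h k) t) @ \oo --> (EFin \o c) t}.
  by apply: nearW => t It; exact: hcvE.
have H2 : mu.-integrable I (EFin \o c).
  apply/integrableP; split => //.
  by under eq_integral do rewrite /= ger0_norm//.
have H3 : {ae mu, forall t k, I t -> (`|(EFin \o h k) t| <= (EFin \o c) t)%E}.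
  by apply: nearW => t k It; rewrite lee_fin ger0_norm// hle.
have mh k : measurable_fun I (EFin \o h k).
  by apply/measurable_EFinP; exact: measurable_funTS.
have [_ cv1 cv2] := @dominated_convergence _ _ R mu I mI _ _ _ mh mcI H1 H2 H3.
split.
  exists (fun k => vector_simple x (r k)); split => //.
  apply: nearW => t It; split => //=.
  under eq_fun => k do rewrite sE// -scalerBl normrZ.
  rewrite -(mul0r `|x|); apply: cvgMr_tmp.
  rewrite -(normr0 R) -(subrr (c t)); apply: cvg_norm; apply: cvgB; last exact: cvg_cst.
  exact: hcv.
have cc t k : I t -> `|c t *: x - simple_fun (vector_simple x (r k)) t| = `|h k t - c t| * `|x|.
  by move=> It; rewrite sE// -scalerBl normrZ distrC.
exists (fun k => vector_simple x (r k)); split => //.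
- have -> : (fun k => \int[mu]_(t in I) `|c t *: x - simple_fun (vector_simple x (r k)) t|%:E)%E =
    (fun k => (`|x|%:E * \int[mu]_(t in I) `|(EFin \o h k) t - (EFin \o c) t|)%E).
    apply/funext => k; rewrite -ge0_integralZl_EFin//; last first.
      apply: measurableT_comp => //; apply: emeasurable_funB => //; exact: mh.
    by apply: eq_integral => t; rewrite inE => It /=; rewrite cc// mulrC EFinM.
  have := cvgeZl (isT : `|x|%:E \is a fin_num) cv1; rewrite mule0; exact.
have -> : (fun k => simple_integral I (vector_simple x (r k))) =
   (fun k => fine (\int[mu]_(t in I) (h k t)%:E)%E *: x).
  apply/funext => k; rewrite (simple_integral_vector _ mI (hr k)); congr (fine _ *: _).
  by apply: eq_integral => t; rewrite inE => It; rewrite rE.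
apply: cvgZr_tmp; apply: fine_cvg; rewrite fineK//.
by rewrite ge0_fin_numE// integral_ge0// => t _; rewrite lee_fin.
Qed.

End BochnerIntegral.

(** * Smooth test functions *)

Section SmoothStep.
Context (R : realType).
Local Notation mu := (@lebesgue_measure R).
Implicit Types (f g : R -> R) (x a b e : R) (m : nat).

(** The derivatives of [x |-> exp (- 1 / x)], extended by [0] to [x <= 0], are
    combinations of these functions. *)
Definition flat m x : R := if 0 < x then x^-1 ^+ m * expR (- x^-1) else 0.

Lemma flat_le0 m x : x <= 0 -> flat m x = 0.
Proof. by rewrite /flat ltNge => ->. Qed.

Lemma flat_gt0 m x : 0 < x -> 0 < flat m x.
Proof. by move=> x0; rewrite /flat x0 mulr_gt0 ?expR_gt0// exprn_gt0// invr_gt0. Qed.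

Lemma flat_ge0 m x : 0 <= flat m x.
Proof. by have [x0|x0] := ltP 0 x; [exact/ltW/flat_gt0|rewrite flat_le0]. Qed.

Lemma flatS_id m x : flat m.+1 x * x = flat m x.
Proof.
rewrite /flat; case: ifPn => x0; last by rewrite mul0r.
have xn : x != 0 by rewrite gt_eqF.
by rewrite exprS; field.
Qed.

(** The exponential dominates the power [m + 1] of [1 / x]. *)
Lemma flat_le m x : flat m x <= m.+1`!%:R * `|x|.
Proof.
have [x0|x0] := ltP 0 x; last by rewrite flat_le0// mulr_ge0.
rewrite /flat x0 (gtr0_norm x0) expRN -ler_pdivlMr ?invr_gt0 ?expR_gt0//  invrK.
set y := x^-1; have y0 : 0 < y by rewrite invr_gt0.
have h := expR_ge1Dxn m (ltW y0).
have h' : y ^+ m.+1 / m.+1`!%:R <= expR y by apply: le_trans h; rewrite lerDr.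
have -> : y ^+ m = m.+1`!%:R * x * (y ^+ m.+1 / m.+1`!%:R).
  rewrite exprS /y; field.
  by apply/andP; split; apply: lt0r_neq0; rewrite // ltr0n fact_gt0.
by rewrite ler_wpM2l// mulr_ge0// ltW.
Qed.

Lemma is_derive_flat m x :
  is_derive x 1 (flat m) (flat m.+2 x - m%:R * flat m.+1 x).
Proof.
have [x0|x0|->] := ltrgt0P x.
- rewrite /flat x0.
  apply: (@near_eq_is_derive _ _ _ (fun z : R => z^-1 ^+ m * expR (- z^-1))).
    near=> z; rewrite /flat ifT//; near: z; exact: lt_nbhsr.
  have dV : is_derive x 1 (fun z : R => z^-1) (- x ^- 2).
    have := @is_deriveV R id x 1 1 _ _; rewrite gt_eqF// => /(_ isT (is_derive_id _ _)).
    by rewrite /= /GRing.scale/= mulr1.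
  have dX := @is_deriveX _ _ _ m _ _ _ dV; rewrite exprfctE in dX.
  have dE : is_derive x 1 (fun z : R => expR (- z^-1)) (expR (- x^-1) * x ^- 2).
    have dN := is_deriveN dV; rewrite opprK in dN.
    exact: (is_derive1_comp (is_derive_expR _) dN).
  have := is_deriveM dX dE; rewrite /GRing.scale/=.
  set D := (X in is_derive _ _ _ X); set D' := (X in _ -> is_derive _ _ _ X).
  suff -> : D = D' by [].
  rewrite /D /D' exprVn; case: m {dX D D'} => [|m] /=.
    by rewrite expr0 !mul0r subr0 mulr0 addr0 mul1r -exprVn mulrC.
  rewrite -!exprVn (exprS _ m.+2) !(exprS _ m.+1) !(exprS _ m).
  by set y := x^-1; set E := expR _; ring.
- rewrite !flat_le0 ?ltW// mulr0 subr0.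
  have d0 : is_derive x 1 (cst (0 : R) : R -> R) 0 by exact: is_derive_cst.
  apply: near_eq_is_derive d0.
  near=> z; rewrite flat_le0//; apply: ltW; near: z; exact: lt_nbhsl.
- rewrite !flat_le0// mulr0 subr0; apply/is_derive1_caratheodory.
  exists (flat m.+1); split; last by rewrite flat_le0.
    by move=> z; rewrite subr0 flatS_id [flat m 0]flat_le0// subr0.
  apply/cvgrPdist_lt => e e0; rewrite flat_le0//.
  have c0 : 0 < m.+2`!%:R :> R by rewrite ltr0n fact_gt0.
  near=> z; rewrite sub0r normrN ger0_norm ?flat_ge0//.
  apply: le_lt_trans (flat_le _ _) _; rewrite -ltr_pdivlMl//.
  near: z; exists (m.+2`!%:R^-1 * e); first by rewrite /= mulr_gt0// invr_gt0.
  by move=> z /=; rewrite sub0r normrN.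
Unshelve. all: by end_near. Qed.

(** A class that is closed under differentiation by construction, and contains
    a smooth step; smoothness follows for all of its members at once. *)
Inductive elementary_smooth : (R -> R) -> Prop :=
| smooth_cst c : elementary_smooth (fun=> c)
| smooth_flat m a b : elementary_smooth (fun x => flat m (a * x + b))
| smoothD f g : elementary_smooth f -> elementary_smooth g ->
    elementary_smooth (fun x => f x + g x)
| smoothM f g : elementary_smooth f -> elementary_smooth g ->
    elementary_smooth (fun x => f x * g x)
| smoothV f : (forall x, f x != 0) -> elementary_smooth f ->
    elementary_smooth (fun x => (f x)^-1).

Lemma is_derive_affine a b x : is_derive x 1 (fun z : R => a * z + b) a.
Proof.
apply/is_derive1_caratheodory; exists (cst a); split => // [z|]; first by rewrite /cst; ring.
exact: cvg_cst.
Qed.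

Lemma is_derive_comp_affine f a b x df : is_derive (a * x + b) 1 f df ->
  is_derive x 1 (fun z => f (a * z + b)) (df * a).
Proof.
move=> d; exact: (@is_derive1_comp R f (fun z => a * z + b) x df a d (is_derive_affine a b x)).
Qed.

Lemma smooth_affine f a b : elementary_smooth f ->
  elementary_smooth (fun x => f (a * x + b)).
Proof.
elim=> [c|m c d|g h _ IHg _ IHh|g h _ IHg _ IHh|g g0 _ IH].
- exact: smooth_cst.
- have -> : (fun x => flat m (c * (a * x + b) + d)) =
            (fun x => flat m ((c * a) * x + (c * b + d))).
    by apply/funext => x; congr flat; ring.
  exact: smooth_flat.
- exact: smoothD.
- exact: smoothM.
- by apply: (smoothV (f := fun x => g (a * x + b))).
Qed.

Lemma smooth_is_derive f : elementary_smooth f ->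
  exists g, elementary_smooth g /\ forall x, is_derive x 1 f (g x).
Proof.
elim=> {f} [c|m a b|f g _ [f' [sf df]] _ [g' [sg dg]]
           |f g sf0 [f' [sf df]] sg0 [g' [sg dg]]|f f0 sf0 [f' [sf df]]].
- exists (fun=> 0); split; [exact: smooth_cst|move=> x; exact: is_derive_cst].
- exists (fun x => (flat m.+2 (a * x + b) + (- m%:R) * flat m.+1 (a * x + b)) * a); split.
    apply: smoothM; last exact: smooth_cst.
    apply: smoothD; first exact: smooth_flat.
    by apply: smoothM; [exact: smooth_cst|exact: smooth_flat].
  move=> x; have := is_derive_comp_affine (is_derive_flat m (a * x + b)).
  by rewrite mulNr.
- exists (fun x => f' x + g' x); split; first exact: smoothD.
  by move=> x; exact: is_deriveD.
- exists (fun x => f x * g' x + g x * f' x); split.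
    by apply: smoothD; exact: smoothM.
  by move=> x; exact: is_deriveM.
- exists (fun x => (-1) * ((f x)^-1 * (f x)^-1) * f' x); split.
    apply: smoothM => //; apply: smoothM; first exact: smooth_cst.
    by apply: smoothM; exact: smoothV.
  move=> x; have := is_deriveV (f0 x) (df x).
  by rewrite /GRing.scale/= expr2 invfM mulN1r.
Qed.

Lemma smooth_derive1 f : elementary_smooth f -> elementary_smooth (derive1 f).
Proof.
move=> /smooth_is_derive[g [sg dg]].
suff -> : derive1 f = g by [].
by apply/funext => x; rewrite derive1E; exact: derive_val.
Qed.

Lemma smooth_derivable f k x : elementary_smooth f -> derivable (derive1n k f) x 1.
Proof.
move=> sf; have : elementary_smooth (derive1n k f).
  by elim: k => // k IH; rewrite derive1nS; exact: smooth_derive1.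
by move=> /smooth_is_derive[g [_ dg]]; have := dg x => -[].
Qed.

Lemma smooth_continuous f : elementary_smooth f -> continuous f.
Proof.
move=> sf x; apply: differentiable_continuous; apply/derivable1_diffP.
by have := @smooth_derivable f 0 x sf; rewrite derive1n0.
Qed.

Definition step x : R := flat 0 x / (flat 0 x + flat 0 (1 - x)).

(** The derivative of [step], in closed form. *)
Definition bump x : R :=
  (flat 2 x * flat 0 (1 - x) + flat 0 x * flat 2 (1 - x)) /
  (flat 0 x + flat 0 (1 - x)) ^+ 2.

Lemma step_den_gt0 x : 0 < flat 0 x + flat 0 (1 - x).
Proof.
have [x0|x0] := ltP 0 x; first by rewrite ltr_pwDl ?flat_gt0 ?flat_ge0.
by rewrite ltr_wpDl ?flat_ge0 ?flat_gt0// subr_gt0 (le_lt_trans x0).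
Qed.

Lemma smooth_flat1B m : elementary_smooth (fun x => flat m (1 - x)).
Proof.
have -> : (fun x => flat m (1 - x)) = (fun x => flat m (-1 * x + 1)).
  by apply/funext => x; congr flat; ring.
exact: smooth_flat.
Qed.

Lemma smooth_flat0 m : elementary_smooth (flat m).
Proof.
have -> : flat m = (fun x => flat m (1 * x + 0)).
  by apply/funext => x; congr flat; ring.
exact: smooth_flat.
Qed.

Lemma smooth_step : elementary_smooth step.
Proof.
apply: smoothM; first exact: smooth_flat0.
apply: smoothV; first by move=> x; rewrite gt_eqF// step_den_gt0.
by apply: smoothD; [exact: smooth_flat0|exact: smooth_flat1B].
Qed.

Lemma is_derive_step x : is_derive x 1 step (bump x).
Proof.
have d1 := is_derive_flat 0 x.
have d2 : is_derive x 1 (fun z => flat 0 (1 - z)) (- flat 2 (1 - x)).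
  have -> : (fun z => flat 0 (1 - z)) = (fun z => flat 0 (-1 * z + 1)).
    by apply/funext => z; congr flat; ring.
  have := is_derive_comp_affine (is_derive_flat 0 (-1 * x + 1)).
  by rewrite mulN1r mul0r subr0 mulrN1 [- x + 1]addrC.
rewrite mul0r subr0 in d1.
have dD : is_derive x 1 (fun z => flat 0 z + flat 0 (1 - z)) (flat 2 x - flat 2 (1 - x)).
  exact: is_deriveD.
have den0 : flat 0 x + flat 0 (1 - x) != 0 by rewrite gt_eqF// step_den_gt0.
have := is_deriveM d1 (@is_deriveV _ (fun z => flat 0 z + flat 0 (1 - z)) _ _ _ den0 dD).
rewrite /GRing.scale/=.
set D := (X in is_derive _ _ _ X).
suff -> : bump x = D by [].
rewrite /D /bump; have := step_den_gt0 x.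
set u := flat 0 x; set v := flat 0 (1 - x); set w := flat 2 x; set z := flat 2 _ => h.
field; exact: lt0r_neq0.
Qed.

Lemma bumpE : bump = derive1 step.
Proof.
apply/funext => x; rewrite derive1E; have [_ <-//] := is_derive_step x.
Qed.

Lemma smooth_bump : elementary_smooth bump.
Proof. by rewrite bumpE; apply: smooth_derive1; exact: smooth_step. Qed.

Lemma step_le0 x : x <= 0 -> step x = 0.
Proof. by move=> x0; rewrite /step flat_le0// mul0r. Qed.

Lemma step_ge1 x : 1 <= x -> step x = 1.
Proof.
move=> x1; rewrite /step [flat 0 (1 - x)]flat_le0 ?subr_le0// addr0 divff// gt_eqF//.
by rewrite flat_gt0// (lt_le_trans _ x1).
Qed.

Lemma step_itv x : 0 <= step x <= 1.
Proof.
rewrite /step divr_ge0 ?flat_ge0 ?(ltW (step_den_gt0 _))//=.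
by rewrite ler_pdivrMr ?step_den_gt0// mul1r lerDl flat_ge0.
Qed.

Lemma bump_ge0 x : 0 <= bump x.
Proof.
rewrite /bump divr_ge0// ?sqr_ge0//.
by rewrite addr_ge0// mulr_ge0// flat_ge0.
Qed.

Lemma bump_out x : x <= 0 \/ 1 <= x -> bump x = 0.
Proof.
by rewrite /bump => -[h|h]; rewrite ?(flat_le0 _ h) ?mul0r ?addr0 ?mul0r//
  !(@flat_le0 _ (1 - x)) ?subr_le0// !mulr0 addr0 mul0r.
Qed.

Lemma bump_bounded : exists C, 0 < C /\ forall x, bump x <= C.
Proof.
have cb : {within `[0, 1], continuous bump}.
  by apply: continuous_subspaceT; exact: smooth_continuous smooth_bump.
have [c _ hc] := EVT_max ler01 cb.
exists (bump c + 1); split; first by rewrite ltr_wpDl ?bump_ge0.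
move=> x; have [x01|] := boolP (x \in `[0, 1]).
  by rewrite (le_trans (hc _ x01))// lerDl.
rewrite in_itv/= negb_and -!ltNge => /orP[h|h]; rewrite bump_out ?addr_ge0 ?bump_ge0//.
  by left; exact: ltW.
by right; exact: ltW.
Qed.

(** For [e > 0], a probability density supported in [[a, a + e]]. *)
Definition kernel a e x : R := e^-1 * bump (e^-1 * x + (- a / e)).

(** A difference of two steps of width [e]: up after [a], down before [b]. *)
Definition plateau a b e x : R :=
  step (e^-1 * x + (- a / e)) - step (e^-1 * x + (- (b - e) / e)).

Lemma smooth_kernel a e : elementary_smooth (kernel a e).
Proof. by apply: smoothM; [exact: smooth_cst|exact/smooth_affine/smooth_bump]. Qed.

Lemma smooth_plateau a b e : elementary_smooth (plateau a b e).
Proof.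
have -> : plateau a b e = (fun x => step (e^-1 * x + (- a / e)) +
    (-1) * step (e^-1 * x + (- (b - e) / e))).
  by apply/funext => x; rewrite mulN1r.
apply: smoothD; first exact/smooth_affine/smooth_step.
by apply: smoothM; [exact: smooth_cst|exact/smooth_affine/smooth_step].
Qed.

Lemma is_derive_stepe a e x : is_derive x 1 (fun z => step (e^-1 * z + (- a / e))) (kernel a e x).
Proof.
have := is_derive_comp_affine (is_derive_step (e^-1 * x + (- a / e))).
by rewrite /kernel [_^-1 * bump _]mulrC.
Qed.

Lemma derive1_plateau a b e x :
  derive1 (plateau a b e) x = kernel a e x - kernel (b - e) e x.
Proof.
rewrite derive1E.
by have [] := is_deriveB (is_derive_stepe a e x) (is_derive_stepe (b - e) e x).
Qed.

Lemma affineE a e x : 0 < e -> e^-1 * x + (- a / e) = (x - a) / e.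
Proof. by move=> e0; rewrite mulrC mulrBl mulNr. Qed.

Lemma kernel_ge0 a e x : 0 < e -> 0 <= kernel a e x.
Proof. by move=> e0; rewrite mulr_ge0 ?bump_ge0// invr_ge0 ltW. Qed.

Lemma kernel_out a e x : 0 < e -> ~ `[a, a + e]%classic x -> kernel a e x = 0.
Proof.
move=> e0 h; rewrite /kernel affineE// bump_out ?mulr0//.
have [xa|ax] := leP x a; [left|right].
  by rewrite pmulr_lle0 ?invr_gt0// subr_le0.
rewrite ler_pdivlMr// mul1r lerBrDl; rewrite leNgt; apply/negP => h'; apply: h.
by rewrite /= in_itv/= !ltW.
Qed.

Lemma integral_kernel a e (I : set R) : 0 < e -> measurable I ->
  `[a, a + e] `<=` I -> (\int[mu]_(x in I) (kernel a e x)%:E = 1)%E.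
Proof.
move=> e0 mI aI; transitivity (\int[mu]_(x in `[a, (a + e)%R]) (kernel a e x)%:E)%E.
  rewrite integral_mkcond [RHS]integral_mkcond; apply: eq_integral => x _.
  rewrite /patch; have [xa|xa] := boolP (x \in `[a, a + e]%classic).
    by rewrite mem_set//; apply: aI; rewrite inE in xa.
  by case: ifP => // _; rewrite kernel_out//; move: xa; rewrite notin_setE.
have ae : a < a + e by rewrite ltrDl.
rewrite (@continuous_FTC2 _ _ (fun z => step (e^-1 * z + (- a / e))))//.
- have -> : e^-1 * (a + e) + - a / e = 1 by field; exact: lt0r_neq0.
  have -> : e^-1 * a + - a / e = 0 by field; exact: lt0r_neq0.
  by rewrite (step_le0 (lexx 0)) (step_ge1 (lexx 1)) -EFinB subr0.
- by apply: continuous_subspaceT; exact/smooth_continuous/smooth_kernel.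
- have cs : continuous (fun z : R => step (e^-1 * z + (- a / e))).
    exact/smooth_continuous/smooth_affine/smooth_step.
  split.
  + by move=> x _; have [] := is_derive_stepe a e x.
  + by apply: cvg_at_right_filter; exact: cs.
  + by apply: cvg_at_left_filter; exact: cs.
- by move=> x _; rewrite derive1E; have [] := is_derive_stepe a e x.
Qed.

Lemma test_function_kernel (I : set R) a e : 0 < e -> `[a, a + e] `<=` interior I ->
  test_function I (kernel a e).
Proof.
move=> e0 aI; split; first by move=> k x; exact/smooth_derivable/smooth_kernel.
by exists a, (a + e); split => // x; exact: kernel_out.
Qed.

Lemma plateau_out a b e x : 0 < e -> a <= b - e -> ~ `[a, b]%classic x -> plateau a b e x = 0.
Proof.
move=> e0 ab h; rewrite /plateau !affineE//.
have [xa|ax] := leP x a.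
  by rewrite !step_le0 ?subrr// pmulr_lle0 ?invr_gt0// subr_le0// (le_trans xa).
have bx : b < x.
  by rewrite ltNge; apply/negP => xb; apply: h; rewrite /= in_itv/= xb ltW.
by rewrite !step_ge1 ?subrr// ler_pdivlMr// mul1r; lra.
Qed.

Lemma plateau_in a b e x : 0 < e -> a + e <= x -> x <= b - e -> plateau a b e x = 1.
Proof.
move=> e0 ax xb; rewrite /plateau !affineE// step_ge1 ?step_le0 ?subr0//.
  by rewrite pmulr_lle0 ?invr_gt0// subr_le0.
by rewrite ler_pdivlMr// mul1r; lra.
Qed.

Lemma plateau_norm a b e x : `|plateau a b e x| <= 1.
Proof.
rewrite /plateau; set u := step _; set v := step _.
have /andP[u0 u1] : 0 <= u <= 1 by exact: step_itv.
have /andP[v0 v1] : 0 <= v <= 1 by exact: step_itv.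
by rewrite ler_norml; apply/andP; split; lra.
Qed.

Lemma test_function_plateau (I : set R) a b e : 0 < e -> a <= b - e ->
  `[a, b] `<=` interior I -> test_function I (plateau a b e).
Proof.
move=> e0 ab aI; split; first by move=> k x; exact/smooth_derivable/smooth_plateau.
by exists a, b; split => // x; exact: plateau_out.
Qed.

End SmoothStep.

(** * Weak derivatives *)

Section WeakDerivative.
Context (R : realType) (V : normedModType R).
Local Notation mu := (@lebesgue_measure R).
Local Notation W := (whole V).
Local Notation HW := (@whole_seminormed R V).
Implicit Types (I J : set R) (f g : R -> V) (a b c d : R).

(** Covers the half-open intervals of the linear problem and the compact ones
    on which solutions are defined. *)
Record bounded_interval a b I : Prop := BoundedInterval {
  bi_measurable : measurable I;
  bi_sub : `]a, b[ `<=` I;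
  bi_sup : I `<=` `[a, b] }.

Lemma bi_finite a b I : bounded_interval a b I -> (mu I < +oo)%E.
Proof.
move=> [mI _ h]; apply: (@le_lt_trans _ _ (mu `[a, b])).
  by apply: le_measure; rewrite ?inE.
by rewrite lebesgue_measure_itv/=; case: ifP => _; rewrite ?ltry// -EFinB ltry.
Qed.

Lemma bi_interior a b I c d : bounded_interval a b I -> a < c -> d < b ->
  `[c, d] `<=` interior I.
Proof.
move=> [_ h _] ac db; apply: (@subset_trans _ `]a, b[).
  move=> x /=; rewrite !in_itv/= => /andP[cx xd].
  by rewrite (lt_le_trans ac cx) (le_lt_trans xd db).
by rewrite -open_subsetE//; exact: itv_open.
Qed.

Lemma bi_sub_right a b I t d : bounded_interval a b I -> I t -> t + d < b ->
  `[t, t + d] `<=` I.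
Proof.
move=> bI It tdb r; rewrite /= in_itv/= => /andP[r1 r2].
have [<-//|tr] := eqVneq t r; apply: (bi_sub bI); rewrite /= in_itv/=.
rewrite (le_lt_trans r2 tdb) andbT.
have /andP[at' _] : a <= t <= b by have := bi_sup bI It; rewrite /= in_itv.
by apply: (le_lt_trans at'); rewrite lt_neqAle tr.
Qed.

Lemma ae_neq c : {ae mu, forall t, t <> c}.
Proof.
exists [set c]; split => //; first exact: lebesgue_measure_set1.
by move=> x /= /contrapT.
Qed.

Lemma bi_ae a b I (P : R -> Prop) : bounded_interval a b I ->
  {ae mu, forall t, `]a, b[%classic t -> P t} -> {ae mu, forall t, I t -> P t}.
Proof.
move=> [_ _ h] hP; apply: (aeS3 hP (ae_neq a) (ae_neq b)) => t h1 ta tb It.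
apply: h1; have := h _ It; rewrite /= !in_itv/= !lt_neqAle => /andP[-> ->].
by rewrite !andbT; apply/andP; split; apply/eqP => // ta'; apply: ta.
Qed.

Lemma test_function_sub I J phi : J `<=` I -> test_function J phi -> test_function I phi.
Proof.
move=> JI [h [a [b [ab h0]]]]; split => //; exists a, b; split => //.
by apply: subset_trans ab _; exact: interiorS.
Qed.

Lemma test_function_out I phi t : test_function I phi -> ~ I t ->
  phi t = 0 /\ derive1 phi t = 0.
Proof.
move=> [h [a [b [ab h0]]]] It.
have tab : ~ `[a, b]%classic t by move=> /ab /interior_subset.
split; first exact: h0.
have oab : open (~` `[a, b]%classic : set R) by apply: closed_openC; exact: itv_closed.
rewrite derive1E -(@near_eq_derive _ _ _ (cst 0 : R -> R)); first by rewrite derive_cst.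
have : nbhs t (~` `[a, b]%classic) by exact: open_nbhs_nbhs.
by apply: filterS => z hz; rewrite h0.
Qed.

Lemma is_weak_derivative_sub I J f g : measurable I -> measurable J ->
  (mu I < +oo)%E -> J `<=` I -> is_weak_derivative I f g -> is_weak_derivative J f g.
Proof.
move=> mI mJ fI JI h phi tphi.
have [v [h1 h2]] := h phi (test_function_sub JI tphi).
exists v; split.
- apply: (is_bochner_sub mI mJ fI JI _ h1) => t _ Jt.
  by have [_ ->] := test_function_out tphi Jt; rewrite scale0r.
- apply: (is_bochner_sub mI mJ fI JI _ h2) => t _ Jt.
  by have [-> _] := test_function_out tphi Jt; rewrite scale0r.
Qed.

Lemma is_weak_derivativeB I f g f' g' : measurable I ->
  is_weak_derivative I f f' -> is_weak_derivative I g g' ->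
  is_weak_derivative I (fun t => f t - g t) (fun t => f' t - g' t).
Proof.
move=> mI hf hg phi tphi.
have [v [h1 h2]] := hf phi tphi; have [w [h3 h4]] := hg phi tphi.
exists (v - w); split.
- by under eq_fun do rewrite scalerBr; exact: is_bochnerB.
- by under eq_fun do rewrite scalerBr; rewrite opprD; exact: is_bochnerB.
Qed.

Lemma is_weak_derivative_ext I f f' g : (forall t, I t -> f t = f' t) ->
  is_weak_derivative I f g -> is_weak_derivative I f' g.
Proof.
move=> e h phi /h[v [h1 h2]]; exists v; split => //.
by apply: is_bochner_ae h1; apply: nearW => t It; rewrite e.
Qed.

Lemma weak_derivative_ext I f f' : (forall t, I t -> f t = f' t) ->
  weak_derivative I f = weak_derivative I f'.
Proof.
move=> e; rewrite /weak_derivative.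
suff -> : [set g | is_weak_derivative I f g] = [set g | is_weak_derivative I f' g] by [].
apply/seteqP; split => g; apply: is_weak_derivative_ext => // t It.
by rewrite e.
Qed.

Lemma weak_derivativeP I f g : is_weak_derivative I f g ->
  is_weak_derivative I f (weak_derivative I f).
Proof. by move=> h; rewrite /weak_derivative; case: xgetP => [h' _ //|/(_ g)]. Qed.

(** A countable set that contains all values of the simple functions [s k]. *)
Definition simple_value (s : nat -> simple_data V) (i : nat) : V :=
  if unpickle i is Some (k, m) then \sum_(e <- mask m (s k)) e.2 else 0.

Lemma simple_valueP (s : nat -> simple_data V) k t :
  exists i, simple_fun (s k) t = simple_value s i.
Proof.
exists (pickle (k, [seq t \in e.1 | e <- s k])); rewrite /simple_value pickleK.
elim: (s k) => [|e s' IH]; first by rewrite simple_fun_nil big_nil.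
rewrite simple_fun_cons /= indicE; case: (t \in e.1); rewrite ?big_cons IH.
  by rewrite scale1r.
by rewrite scale0r add0r.
Qed.

Lemma kernel_le (C : R) a e x : 0 < e -> (forall x, bump x <= C) ->
  kernel a e x <= C / e.
Proof. by move=> e0 hC; rewrite /kernel mulrC ler_wpM2r// invr_ge0 ltW. Qed.

Lemma measurable_kernel a e : measurable_fun setT (kernel a e).
Proof.
by apply: continuous_measurable_fun; apply: smooth_continuous; exact: smooth_kernel.
Qed.

Lemma integral_sub0 I J (c : R -> \bar R) : J `<=` I ->
  (forall t, I t -> ~ J t -> c t = 0%E) ->
  (\int[mu]_(t in I) c t = \int[mu]_(t in J) c t)%E.
Proof.
move=> JI h; rewrite integral_mkcond [RHS]integral_mkcond; apply: eq_integral => t _.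
rewrite /patch; have [tJ|tJ] := boolP (t \in J).
  by rewrite mem_set//; apply: JI; rewrite inE in tJ.
by case: ifPn => // tI; apply: h; [rewrite inE in tI|move: tJ; rewrite notin_setE].
Qed.

(** At a Lebesgue point, testing [g - x] against a kernel of mass one bounds
    [x] by the size of [g - x] near the point; [x] is then chosen close to [g t]. *)
Lemma weak_derivative_zero a b I g : bounded_interval a b I ->
  (forall phi, test_function I phi -> is_bochner I (fun t => phi t *: g t) 0) ->
  {ae mu, forall t, I t -> g t = 0}.
Proof.
move=> bI h0; apply: (bi_ae bI).
have mI := bi_measurable bI; have fI := bi_finite bI.
suff loc a' b' : a < a' -> a' < b' -> b' < b ->
    {ae mu, forall t, `]a', b'[%classic t -> g t = 0}.
  have loc' n : {ae mu, forall t, `](a + n.+1%:R^-1), (b - n.+1%:R^-1)[%classic t -> g t = 0}.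
    have [ab'|ab'] := ltP (a + n.+1%:R^-1) (b - n.+1%:R^-1).
      apply: loc => //; first by rewrite ltrDl invr_gt0.
      by rewrite ltrBlDr ltrDl invr_gt0.
    apply: nearW => t; rewrite /= in_itv/= => /andP[h1 h2].
    by have := lt_trans h1 h2; rewrite ltNge ab'.
  have /ae_foralln loc'' := loc'.
  apply: (aeS loc'') => t H; rewrite /= in_itv/= => /andP[ta tb].
  have d0 : 0 < Num.min (t - a) (b - t) by rewrite lt_min !subr_gt0 ta.
  near \oo => n; apply: (H n); rewrite /= in_itv/=.
  have : n.+1%:R^-1 < Num.min (t - a) (b - t).
    by near: n; exact: near_infty_natSinv_lt (PosNum d0).
  move: (n.+1%:R^-1) => z.
  by rewrite lt_min => /andP[h1 h2]; apply/andP; split; lra.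
move=> aa' ab' bb'.
pose e := Num.min (a' - a) (b - b') / 2.
have e0 : 0 < e by rewrite divr_gt0// lt_min !subr_gt0 aa'.
have eM : e < a' - a /\ e < b - b'.
  have : e < Num.min (a' - a) (b - b').
    have : 0 < Num.min (a' - a) (b - b') by rewrite lt_min !subr_gt0 aa'.
    by rewrite /e; move: (Num.min _ _) => z z0; lra.
  by rewrite lt_min => /andP.
have [e1 e2] := eM.
(* [P *: g] is integrable on [I], and is [g] on [[a', b']] *)
pose P := plateau (a' - e) (b' + e) e.
have tP : test_function I P.
  apply: test_function_plateau => //; first by rewrite addrK; lra.
  by apply: (bi_interior bI); lra.
pose G t := P t *: g t.
have GE t : `[a', b']%classic t -> G t = g t.
  rewrite /= in_itv/= => /andP[h1 h2]; rewrite /G /P plateau_in ?scale1r//.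
    by rewrite subrK.
  by rewrite addrK.
have bG := h0 P tP.
have intG := is_bochner_integrable mI bG.
have [[s [hs cs]] _] := bG.
pose F x t := `|G t - x|.
have mF x : ae_measurable I (F x).
  apply: ae_measurable_norm; apply: (strongly_measurableB HW) => //; first by have [] := bG.
  exact: (strongly_measurable_cst HW).
have F0 x t : 0 <= F x t by rewrite /F.
have /choice[psi Hpsi] := fun x => ae_measurable_rep mI (mF x) (F0 x).
have intF x : (\int[mu]_(t in I) (F x t)%:E < +oo)%E.
  apply: (@le_lt_trans _ _ (\int[mu]_(t in I) (`|G t|)%:E + \int[mu]_(t in I) (cst `|x| t)%:E)%E).
    apply: le_integralD => //.
    - by apply: ae_measurable_norm; have [] := bG.
    - exact: ae_measurable_fun_eq.
    - by apply: nearW => t _; rewrite /F /cst ler_normB.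
  apply: lte_add_pinfty => //.
  by rewrite /cst/= integral_cst// lte_mul_pinfty.
have lpsi x : locally_integrable setT (psi x).
  have [m1 m2 m3 m4] := Hpsi x.
  apply: open_integrable_locally; first exact: openT.
  apply/integrableP; split; first exact/measurable_EFinP.
  under eq_integral do rewrite /= ger0_norm//.
  rewrite (@integral_sub0 setT I)//; last by move=> t _ It; rewrite m3.
  apply: le_lt_trans (intF x); apply: ge0_ae_le_integralW.
  - by move=> t _; rewrite lee_fin.
  - by move=> t _; rewrite lee_fin.
  - by apply: (aeS m2) => t e' It; rewrite e'.
have [C [C0 hC]] := @bump_bounded R.
(* the kernel of width [r / 2] to the right of [t], in the ball of radius [r] *)
have key x t : `]a', b'[%classic t -> lebesgue_pt (psi x) t ->
    `|x| <= 4 * C * psi x t.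
  rewrite /= in_itv/= => /andP[t1 t2] /fine_cvgP[fin cv].
  have [m1 m2 m3 m4] := Hpsi x.
  apply/ler_addgt0Pr => eta eta0.
  have eta1 : 0 < eta / (4 * C) by rewrite divr_gt0// mulr_gt0.
  move/cvgrPdist_lt/(_ _ eta1): cv => cv.
  near (0:R)^'+ => r.
  have r0 : 0 < r by near: r; exact: nbhs_right_gt.
  have rb : r < b' - t by near: r; apply: nbhs_right_lt; rewrite subr_gt0.
  have hfin : davg (psi x) t r \is a fin_num by near: r.
  have hd : `|0 - fine (davg (psi x) t r)| < eta / (4 * C) by near: r.
  pose d := r / 2; have d0 : 0 < d by rewrite divr_gt0.
  have sub1 : `[t, t + d] `<=` `[a', b'].
    by move=> z; rewrite /= !in_itv/= /d => /andP[z1 z2]; apply/andP; split; lra.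
  have subI : `[t, t + d] `<=` interior I.
    by apply: (bi_interior bI); rewrite /d; lra.
  have tk := test_function_kernel d0 subI.
  have subI' : `[t, t + d] `<=` I by apply: subset_trans subI (@interior_subset _ _).
  have b1 := h0 _ tk.
  have ik := integral_kernel d0 mI subI'.
  have b2 : is_bochner I (fun z => kernel t d z *: x) x.
    have := @is_bochner_scalar R V I (kernel t d) x mI fI (measurable_kernel _ _)
      (fun z => kernel_ge0 t z d0); rewrite ik ltry /= scale1r; exact.
  have b3 := is_bochnerB mI b1 b2; rewrite sub0r in b3.
  have := is_bochner_le_norm mI fI b3; rewrite normrN => hle.
  rewrite -lee_fin; apply: (le_trans hle).
  apply: (@le_trans _ _ ((C / d)%:E * \int[mu]_(z in ball t r) (psi x z)%:E)%E).
    rewrite -ge0_integralZl_EFin//; last 4 first.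
    - exact: measurable_ball.
    - by move=> z _; rewrite lee_fin.
    - by apply/measurable_EFinP; exact: measurable_funTS.
    - by rewrite divr_ge0// ltW.
    rewrite (@integral_sub0 I `[t, (t + d)%R]%classic)//; last first.
      by move=> z _ hz; rewrite kernel_out// !scale0r subr0 normr0.
    apply: (@le_trans _ _ (\int[mu]_(z in `[t, (t + d)%R]) ((C / d)%:E * (psi x z)%:E))%E).
      apply: ge0_ae_le_integralW.
      - by move=> z _; rewrite lee_fin.
      - by move=> z _; rewrite mule_ge0// lee_fin// divr_ge0// ltW.
      - apply: (aeS m2) => z ez hz; rewrite -scalerBr normrZ -EFinM lee_fin.
        rewrite -(GE z)//; last exact: sub1.
        rewrite -ez; last exact: subI'.
        by rewrite ger0_norm ?kernel_ge0// ler_wpM2r// kernel_le.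
    apply: le_integral_set.
      move=> z; rewrite /= in_itv/= /ball/= => /andP[z1 z2].
      by rewrite ltr_distlC; rewrite /d in z2; apply/andP; split; lra.
    by move=> z _; rewrite mule_ge0// lee_fin// divr_ge0// ltW.
  have mB : measurable (ball t r) by exact: measurable_ball.
  have muB : (mu (ball t r) = (r *+ 2)%:E)%E by rewrite lebesgue_measure_ball// ltW.
  have intle : (\int[mu]_(z in ball t r) (psi x z)%:E <=
      (r *+ 2 * (psi x t + fine (davg (psi x) t r)))%:E)%E.
    rewrite mulrDr EFinD.
    have -> : ((r *+ 2 * fine (davg (psi x) t r))%:E =
       \int[mu]_(z in ball t r) (`|center (psi x t) (psi x z)|)%:E)%E.
      rewrite EFinM fineK// /davg /iavg muB muleA.
      rewrite inver gt_eqF ?mulrn_wgt0// -EFinM divff ?mul1e// gt_eqF// mulrn_wgt0//.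
    have -> : ((r *+ 2 * psi x t)%:E = \int[mu]_(z in ball t r) (cst (psi x t) z)%:E)%E.
      transitivity ((psi x t)%:E * mu (ball t r))%E; first by rewrite muB -EFinM mulrC.
      by rewrite -[RHS]/(\int[mu]_(z in ball t r) cst (psi x t)%:E z)%E integral_cst.
    apply: le_integralD => //.
    - exact: ae_measurable_fun_eq.
    - by apply: ae_measurable_fun_eq; apply: measurableT_comp => //; exact: measurable_funB.
    - by move=> z; rewrite /cst.
    - apply: nearW => z _; rewrite /cst/=.
      by rewrite -lerBlDl; exact: ler_norm.
  apply: (@le_trans _ _ ((C / d)%:E * (r *+ 2 * (psi x t + fine (davg (psi x) t r)))%:E)%E).
    by apply: lee_wpmul2l => //; rewrite lee_fin divr_ge0// ltW.
  rewrite -EFinM lee_fin.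
  have -> : C / d * (r *+ 2 * (psi x t + fine (davg (psi x) t r))) =
    4 * C * psi x t + 4 * C * fine (davg (psi x) t r).
    by rewrite /d -mulr_natr; field; rewrite gt_eqF.
  rewrite lerD2l; have C4 : 0 < 4 * C by rewrite mulr_gt0.
  rewrite mulrC -ler_pdivlMr//; apply: le_trans (ler_norm _) _.
  by rewrite -normrN -sub0r ltW.
have aeL : {ae mu, forall t, forall i, lebesgue_pt (psi (simple_value s i)) t}.
  by apply/ae_foralln => i; exact: lebesgue_differentiation.
have aeP : {ae mu, forall t, forall i, I t -> F (simple_value s i) t = psi (simple_value s i) t}.
  by apply/ae_foralln => i; have [] := Hpsi (simple_value s i).
apply: (aeS3 aeL aeP cs) => t hL hP hc tab.
have tab' : `[a', b']%classic t by move: tab; apply: subset_itv_oo_cc.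
have It : I t.
  apply: (bi_sub bI); move: tab; rewrite /= !in_itv/= => /andP[t1 t2].
  by rewrite (lt_trans aa' t1) (lt_trans t2 bb').
have [_ cv] := hc It.
apply/eqP; rewrite -normr_le0; apply/ler_addgt0Pr => eta eta0; rewrite add0r.
have C1 : 0 < 4 * C + 1 by rewrite addr_gt0// mulr_gt0.
have eta1 : 0 < eta / (4 * C + 1) by rewrite divr_gt0.
move/cvgrPdist_lt/(_ _ eta1): cv => cv.
near \oo => k.
have hk : `|0 - `|simple_fun (s k) t - G t| | < eta / (4 * C + 1) by near: k.
have [i ik] := simple_valueP s k t.
have := key _ _ tab (hL i); rewrite -hP// -ik /F => hx.
rewrite sub0r normrN normr_id distrC in hk.
rewrite -(GE t)//; apply: (@le_trans _ _ (`|G t - simple_fun (s k) t| + `|simple_fun (s k) t|)).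
  by rewrite -{1}(subrK (simple_fun (s k) t) (G t)) ler_normD.
apply: (@le_trans _ _ ((4 * C + 1) * `|G t - simple_fun (s k) t|)).
  by rewrite mulrDl mul1r addrC lerD2r.
by rewrite mulrC -ler_pdivlMr// ltW.
Unshelve. all: by end_near. Qed.

Lemma is_weak_derivative_unique a b I f g1 g2 : bounded_interval a b I ->
  is_weak_derivative I f g1 -> is_weak_derivative I f g2 ->
  {ae mu, forall t, I t -> g1 t = g2 t}.
Proof.
move=> bI h1 h2; have mI := bi_measurable bI.
have h := is_weak_derivativeB mI h1 h2.
suff H : {ae mu, forall t, I t -> g1 t - g2 t = 0}.
  by apply: (aeS H) => t e It; apply/eqP; rewrite -subr_eq0 e.
apply: (weak_derivative_zero bI) => phi /h[v [hv1 hv2]].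
have v0 : v = 0.
  apply/eqP; rewrite -normr_le0 -lee_fin.
  apply: le_trans (is_bochner_le_norm mI (bi_finite bI) hv1) _.
  rewrite (_ : (\int[mu]_(t in I) _)%E = 0%E)//.
  by apply: integral0_eq => t It; rewrite subrr scaler0 normr0.
by rewrite v0 oppr0 in hv2.
Qed.

(** Testing against a plateau that is [1] on [[s, t]] up to short ramps. *)
Lemma weak_derivative_increment a b I f g s t : bounded_interval a b I ->
  is_weak_derivative I f g -> a < s -> s < t -> t < b ->
  {for s, continuous f} -> {for t, continuous f} ->
  (`|f t - f s|%:E <= \int[mu]_(r in `[s, t]) (`|g r|)%:E)%E.
Proof.
move=> bI hw as_ st tb cs ct; have mI := bi_measurable bI; have fI := bi_finite bI.
apply/lee_addgt0Pr => eta eta0.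
have eta1 : 0 < eta / 2 by rewrite divr_gt0.
move/cvgrPdist_lt/(_ _ eta1): (cs) => /nbhs_ballP[d1 /= d10 hd1].
move/cvgrPdist_lt/(_ _ eta1): (ct) => /nbhs_ballP[d2 /= d20 hd2].
pose m := Num.min (t - s) (Num.min d1 d2).
have m0 : 0 < m by rewrite !lt_min subr_gt0 st d10 d20.
have [ms [md1 md2]] : m <= t - s /\ m <= d1 /\ m <= d2.
  by rewrite /m !ge_min !lexx !orbT.
pose e := m / 2; have e0 : 0 < e by rewrite divr_gt0.
have em : e < m by rewrite /e; lra.
have subI : `[s, t] `<=` interior I by exact: (bi_interior bI).
have subI' : `[s, t] `<=` I by apply: subset_trans subI (@interior_subset _ _).
have tp : test_function I (plateau s t e) by apply: test_function_plateau => //; lra.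
have [v [h1 h2]] := hw _ tp.
have scal c (x : V) : s <= c -> c + e <= t -> is_bochner I (fun z => kernel c e z *: x) x.
  move=> sc ce.
  have sub : `[c, c + e] `<=` I.
    apply: subset_trans subI' => z; rewrite /= !in_itv/= => /andP[z1 z2].
    by apply/andP; split; lra.
  have := @is_bochner_scalar R V I (kernel c e) x mI fI (measurable_kernel _ _)
      (fun z => kernel_ge0 c z e0); rewrite (integral_kernel e0 mI sub) ltry /= scale1r; exact.
have b1 := scal s (f s) (lexx _) ltac:(lra).
have b2 := scal (t - e) (f t) ltac:(lra) ltac:(by rewrite subrK).
have b3 := is_bochnerB mI h1 (is_bochnerB mI b1 b2).
have n3 := is_bochner_le_norm mI fI b3.
have n2 := is_bochner_le_norm mI fI h2.
have i2 : (\int[mu]_(z in I) `|plateau s t e z *: g z|%:E <=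
   \int[mu]_(z in `[s, t]) (`|g z|)%:E)%E.
  rewrite (@integral_sub0 I `[s, t]%classic)//; last first.
    by move=> z _ hz; rewrite plateau_out// ?scale0r ?normr0//; lra.
  apply: ge0_ae_le_integralW => //; apply: nearW => z _.
  by rewrite lee_fin normrZ ler_piMl// plateau_norm.
have i3 : (\int[mu]_(z in I) `|derive1 (plateau s t e) z *: f z -
    (kernel s e z *: f s - kernel (t - e) e z *: f t)|%:E <= eta%:E)%E.
  apply: (@le_trans _ _ (\int[mu]_(z in I) ((eta / 2 * kernel s e z)%:E) +
     \int[mu]_(z in I) ((eta / 2 * kernel (t - e) e z)%:E))%E).
    apply: le_integralD => //.
    - by apply: ae_measurable_fun_eq; apply: measurable_funM => //; exact: measurable_kernel.
    - by apply: ae_measurable_fun_eq; apply: measurable_funM => //; exact: measurable_kernel.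
    - by move=> z; rewrite mulr_ge0 ?kernel_ge0// ltW.
    - by move=> z; rewrite mulr_ge0 ?kernel_ge0// ltW.
    - apply: nearW => z Iz; rewrite derive1_plateau.
      have -> : (kernel s e z - kernel (t - e) e z) *: f z -
         (kernel s e z *: f s - kernel (t - e) e z *: f t) =
         kernel s e z *: (f z - f s) - kernel (t - e) e z *: (f z - f t).
        by rewrite scalerBl !scalerBr !opprB addrACA [in RHS]addrACA; congr (_ + _); rewrite addrC.
      apply: le_trans (ler_normB _ _) _; rewrite (normrZ (kernel s e z)) (normrZ (kernel (t - e) e z)).
      rewrite (ger0_norm (kernel_ge0 s z e0)) (ger0_norm (kernel_ge0 (t - e) z e0)).
      rewrite lerD//.
        have [hz|hz] := pselect (`[s, s + e]%classic z); last by rewrite kernel_out// mul0r mulr0.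
        rewrite mulrC ler_wpM2r ?kernel_ge0// distrC ltW//; apply: hd1.
        move: hz; rewrite /= in_itv/= /ball/= => /andP[z1 z2].
        by rewrite ltr_distlC; apply/andP; split; lra.
      have [hz|hz] := pselect (`[(t - e), (t - e) + e]%classic z); last by rewrite kernel_out// mul0r mulr0.
      rewrite mulrC ler_wpM2r ?kernel_ge0// distrC ltW//; apply: hd2.
      move: hz; rewrite /= in_itv/= /ball/= => /andP[z1 z2].
      by rewrite ltr_distlC; apply/andP; split; lra.
  have ik c : s <= c -> c + e <= t -> (\int[mu]_(z in I) (eta / 2 * kernel c e z)%:E = (eta / 2)%:E)%E.
    move=> sc ce; under eq_integral do rewrite EFinM.
    rewrite ge0_integralZl_EFin//; last 3 first.
    - by move=> z _; rewrite lee_fin kernel_ge0.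
    - by apply/measurable_EFinP; apply: measurable_funTS; exact: measurable_kernel.
    - exact: ltW.
    rewrite integral_kernel ?mule1// => z; rewrite /= in_itv/= => /andP[z1 z2].
    by apply: subI'; rewrite /= in_itv/=; apply/andP; split; lra.
  have ha : s + e <= t by lra.
  have hb : s <= t - e by lra.
  rewrite (ik _ (lexx s) ha) (ik _ hb); last by rewrite subrK.
  by rewrite -EFinD -splitr.
rewrite normrN in n2.
have -> : f t - f s = (v - (f s - f t)) - v by rewrite opprB addrAC subrr add0r.
apply: (@le_trans _ _ (`|v|%:E + `|v - (f s - f t)|%:E)%E).
  by rewrite -EFinD lee_fin [leRHS]addrC ler_normB.
by apply: leeD; [exact: le_trans i2|exact: le_trans i3].
Qed.

End WeakDerivative.

(** * Integrals of powers *)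

Section Hardy.
Context (R : realType).
Local Notation mu := (@lebesgue_measure R).
Implicit Types (D : set R) (f g : R -> R) (p q t d s r : R).

Lemma Lp_of_hoelder p q D f g : 0 < p -> 0 < q -> p^-1 + q^-1 = 1 ->
  measurable D -> ae_measurable D f -> ae_measurable D g ->
  (forall x, 0 <= f x) -> (forall x, 0 <= g x) ->
  (\int[mu]_(x in D) (f x * g x)%:E <= Lp_of p D f * Lp_of q D g)%E.
Proof.
move=> p0 q0 pq mD af ag f0 g0.
have [a [ma ea aD a0]] := ae_measurable_rep mD af f0.
have [b [mb eb bD b0]] := ae_measurable_rep mD ag g0.
rewrite (eq_Lp_of p0 ea) (eq_Lp_of q0 eb).
rewrite (Lp_of_Lnorm _ _ a0)// (Lp_of_Lnorm _ _ b0)//.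
apply: le_trans (hoelder mu ma mb p0 q0 pq).
rewrite -(@Lp_of_Lnorm _ 1 D)//; last 2 first.
- by move=> x; rewrite mulr_ge0.
- by move=> x Dx /=; rewrite aD// mul0r.
rewrite /Lp_of invr1 poweRe1; last by apply: integral_ge0 => x _; rewrite lee_fin powR_ge0.
apply: ge0_ae_le_integralW.
- by move=> x _; rewrite lee_fin mulr_ge0.
- by move=> x _; rewrite lee_fin powR_ge0.
apply: (aeS2 ea eb) => x h1 h2 Dx; rewrite h1// h2// powRr1//.
by rewrite mulr_ge0.
Qed.

Lemma Lp_of_cst p D (c : R) : 0 < p -> measurable D -> 0 <= c ->
  Lp_of p D (fun=> c) = (c%:E * (mu D) `^ p^-1)%E.
Proof.
move=> p0 mD c0; rewrite /Lp_of.
rewrite -[X in (X `^ _)%E]/(\int[mu]_(x in D) cst (c `^ p)%:E x)%E integral_cst//.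
rewrite poweRM ?lee_fin ?powR_ge0// poweR_EFin -powRrM divff ?gt_eqF// powRr1//.
Qed.

Lemma integral_le_Lp_of p D f : 1 < p -> measurable D -> (mu D < +oo)%E ->
  ae_measurable D f -> (forall x, 0 <= f x) ->
  (\int[mu]_(x in D) (f x)%:E <= Lp_of p D f * (mu D) `^ (1 - p^-1))%E.
Proof.
move=> p1 mD fD af f0; have p0 : 0 < p by exact: lt_trans p1.
have q0 : 0 < (1 - p^-1)^-1 by rewrite invr_gt0 subr_gt0 invf_lt1.
have := @Lp_of_hoelder p (1 - p^-1)^-1 D f (fun=> 1) p0 q0 _ mD af
  (ae_measurable_fun_eq _ (measurable_cst _)) f0 (fun=> ler01).
rewrite invrK Lp_of_cst// mul1e invrK; under eq_integral do rewrite mulr1.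
by apply; lra.
Qed.

Lemma integral_nondecreasing_le (F : nat -> set R) f (B : \bar R) :
  {homo F : n m / (n <= m)%N >-> n `<=` m} -> (forall n, measurable (F n)) ->
  measurable_fun setT f -> (forall x, 0 <= f x) ->
  (forall n, \int[mu]_(x in F n) (f x)%:E <= B)%E ->
  (\int[mu]_(x in \bigcup_n F n) (f x)%:E <= B)%E.
Proof.
move=> nd mF mf f0 h.
have cv : (\int[mu]_(x in F i) (f x)%:E)%E @[i --> \oo] -->
    (\int[mu]_(x in \bigcup_i F i) (f x)%:E)%E.
  apply: ge0_nondecreasing_set_cvg_integral => //.
  - by move=> n m nm; apply/subsetPset; exact: nd.
  - by move=> i; apply/measurable_EFinP; exact: measurable_funTS.
  - by move=> i x _; rewrite lee_fin.
rewrite -(cvg_lim _ cv)//; apply: lime_le; first by apply/cvg_ex; eexists; exact: cv.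
exact: nearW.
Qed.

Lemma is_derive_shift_powR t (c : R) x : t < x ->
  is_derive x 1 (fun z => (z - t) `^ c) (c * (x - t) `^ (c - 1)).
Proof.
move=> tx; have xt : 0 < x - t by rewrite subr_gt0.
have h := @is_derive_comp_affine R (fun z => z `^ c) 1 (- t) x (c * (x - t) `^ (c - 1)).
have -> : (fun z => (z - t) `^ c) = (fun z => (1 * z + - t) `^ c).
  by apply/funext => z; rewrite mul1r.
by rewrite -[X in is_derive _ _ _ X]mulr1; apply: h; rewrite mul1r; exact: is_derive1_powR.
Qed.

Lemma integral_powR t (c u v : R) : c != 0 -> 0 < u -> u < v ->
  (\int[mu]_(x in `[(t + u)%R, (t + v)%R]) ((x - t) `^ (c - 1))%:E =
   ((v `^ c - u `^ c) / c)%:E)%E.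
Proof.
move=> c0 u0 uv.
have ctn a x : t < x -> {for x, continuous (fun z => (z - t) `^ a)}.
  move=> tx; have [d _] := is_derive_shift_powR a tx.
  by apply: differentiable_continuous; exact/derivable1_diffP.
rewrite (@continuous_FTC2 _ _ (fun z => c^-1 * (z - t) `^ c)).
- by rewrite ![t + _]addrC !addrK -EFinB -mulrBr mulrC.
- by rewrite ltrD2l.
- apply: continuous_in_subspaceT => x; rewrite inE/= in_itv/= => /andP[xl _].
  by apply: ctn; apply: lt_le_trans xl; rewrite ltrDl.
- have der x : t < x -> derivable (fun z => c^-1 * (z - t) `^ c) x 1.
    by move=> tx; apply: derivableM => //; have [] := is_derive_shift_powR c tx.
  split.
  + move=> x; rewrite in_itv/= => /andP[xl _].
    by apply: der; apply: lt_trans xl; rewrite ltrDl.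
  + apply: cvg_at_right_filter; apply: cvgMl_tmp; apply: ctn; by rewrite ltrDl.
  + apply: cvg_at_left_filter; apply: cvgMl_tmp; apply: ctn.
    by rewrite ltrDl (lt_trans u0).
- move=> x; rewrite in_itv/= => /andP[xl _].
  have tx : t < x by apply: lt_trans xl; rewrite ltrDl.
  have [d1 d2] := is_derive_shift_powR c tx.
  rewrite derive1E deriveM//= derive_cst scaler0 addr0 d2 /GRing.scale/=.
  by rewrite mulrA mulVf// mul1r.
Qed.

Lemma measurable_shift_powR t (c : R) :
  measurable_fun setT (fun x : R => (x - t) `^ c).
Proof.
apply: (@measurableT_comp _ _ _ _ _ _ (fun x : R => x `^ c)); first exact: measurable_powR.
exact: measurable_funB.
Qed.

Lemma integral_powR_near0 t (b d : R) : 0 < b < 1 -> 0 < d ->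
  (\int[mu]_(x in `]t, (t + d)%R]) ((x - t) `^ (- b))%:E <=
   (d `^ (1 - b) / (1 - b))%:E)%E.
Proof.
move=> /andP[b0 b1] d0.
have b1' : 0 < 1 - b by rewrite subr_gt0.
pose F n := `[t + d / n.+2%:R, t + d]%classic : set R.
have -> : `]t, t + d]%classic = \bigcup_n F n.
  apply/seteqP; split => [x|x [n _]]; rewrite /F /= !in_itv/= => /andP[x1 x2].
    have e0 : 0 < (x - t) / d by rewrite divr_gt0// subr_gt0.
    near \oo => n; exists n => //=; rewrite in_itv/= x2 andbT.
    have : n.+1%:R^-1 < (x - t) / d.
      by near: n; exact: near_infty_natSinv_lt (PosNum e0).
    rewrite ltr_pdivlMr// mulrC => h; rewrite -lerBrDl; apply: le_trans (ltW h).
    by rewrite ler_pM2l// lef_pV2 ?posrE// ler_nat.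
  by rewrite x2 andbT; apply: lt_le_trans x1; rewrite ltrDl divr_gt0.
apply: integral_nondecreasing_le.
- move=> n m nm x; rewrite /F /= !in_itv/= => /andP[x1 ->]; rewrite andbT.
  by apply: le_trans x1; rewrite lerD2l ler_pM2l// lef_pV2 ?posrE// ler_nat.
- by move=> n; exact: measurable_itv.
- exact: measurable_shift_powR.
- by move=> x; rewrite powR_ge0.
- move=> n; have u0 : 0 < d / n.+2%:R by rewrite divr_gt0.
  have uv : d / n.+2%:R < d by rewrite ltr_pdivrMr// ltr_pMr// ltr1n.
  have := integral_powR t (lt0r_neq0 b1') u0 uv.
  have -> : 1 - b - 1 = - b by rewrite addrAC subrr add0r.
  move=> ->; rewrite lee_fin ler_pM2r ?invr_gt0//.
  by rewrite lerBlDr lerDl powR_ge0.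
Unshelve. all: by end_near. Qed.

Lemma integral_powR_tail (b r : R) : 0 < b -> 0 < r ->
  (\int[mu]_(x in `[r, +oo[) (x `^ (- b - 1))%:E <= (r `^ (- b) / b)%:E)%E.
Proof.
move=> b0 r0.
pose F n := `[r, r + n.+1%:R]%classic : set R.
have -> : `[r, +oo[%classic = \bigcup_n F n.
  apply/seteqP; split => [x|x [n _]]; rewrite /F /= !in_itv/= ?andbT; last by case/andP.
  move=> x1; near \oo => n; exists n => //=; rewrite in_itv/= x1/=.
  rewrite -lerBlDl; apply: le_trans (_ : n%:R <= _); last by rewrite ler_nat.
  by near: n; exact: nbhs_infty_ger.
apply: integral_nondecreasing_le.
- move=> n m nm x; rewrite /F /= !in_itv/= => /andP[-> x1]; apply: (le_trans x1).
  by rewrite lerD2l ler_nat.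
- by move=> n; exact: measurable_itv.
- by have := measurable_shift_powR 0 (- b - 1); under eq_fun do rewrite subr0.
- by move=> x; rewrite powR_ge0.
- move=> n; have bn0 : - b != 0 by rewrite oppr_eq0 gt_eqF.
  have rn : r < r + n.+1%:R by rewrite ltrDl.
  have := integral_powR 0 bn0 r0 rn; rewrite !add0r.
  under eq_integral do rewrite subr0; move=> ->.
  rewrite lee_fin invrN mulrN -mulNr opprB ler_pM2r ?invr_gt0//.
  by rewrite lerBlDr lerDl powR_ge0.
Unshelve. all: by end_near. Qed.

Lemma cvg_powR p (u : nat -> R) (l : R) : 0 < p -> (forall n, 0 <= u n) ->
  u @ \oo --> l -> (fun n => u n `^ p) @ \oo --> l `^ p.
Proof.
move=> p0 u0 cu.
have l0 : 0 <= l.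
  by rewrite -(cvg_lim _ cu)//; apply: limr_ge; [apply/cvg_ex; exists l|exact: nearW].
have [l1|l1] := ltP 0 l.
  have [d _] := is_derive1_powR p l1.
  have c : {for l, continuous (fun z : R => z `^ p)}.
    by apply: differentiable_continuous; exact/derivable1_diffP.
  apply/cvgrPdist_lt => e e0; move/cvgrPdist_lt/(_ _ e0): c => c.
  exact: (cu _ c).
have -> : l = 0 by apply/eqP; rewrite eq_le l1.
rewrite powR0 ?gt_eqF//; apply/cvgrPdist_lt => e e0.
have e1 : 0 < e `^ p^-1 by rewrite powR_gt0.
move/cvgrPdist_lt/(_ _ e1): cu; apply: filterS => n.
have -> : l = 0 by apply/eqP; rewrite eq_le l1.
rewrite !sub0r !normrN !ger0_norm ?powR_ge0// => h.
have := gt0_ltr_powR p0 (u0 n) (powR_ge0 _ _) h.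
by rewrite -powRrM mulVf ?gt_eqF// powRr1// ltW.
Qed.

End Hardy.

(** * Hardy's inequality *)

Section HardyInequality.
Context (R : realType).
Local Notation mu := (@lebesgue_measure R).
Variables (p q : R) (p1 : 1 < p) (q0 : 0 < q) (pq : p^-1 + q^-1 = 1).

Let p0 : 0 < p. Proof. exact: lt_trans p1. Qed.

Let q1 : q^-1 < 1.
Proof. by rewrite -pq ltrDr invr_gt0. Qed.

Let p1' : p^-1 < 1.
Proof. by rewrite invf_lt1. Qed.

Let pdq : p / q = p - 1.
Proof.
have -> : q^-1 = 1 - p^-1 by rewrite -pq addrC addKr.
by rewrite mulrBr mulr1 divff// gt_eqF.
Qed.

(** Hoelder's inequality with the weight [(x - t) `^ (p * q)^-1]. *)
Let hardy_pointwise (a : R -> R) (t s k : R) : 0 < s -> 0 <= k ->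
  measurable_fun setT a -> (forall x, 0 <= a x) ->
  (k%:E <= \int[mu]_(x in `]t, (t + s)%R]) (a x)%:E)%E ->
  (((k / s) `^ p)%:E <= (q `^ (p - 1) * s `^ (- q^-1 - 1))%:E *
     \int[mu]_(x in `]t, (t + s)%R]) (a x `^ p * (x - t) `^ q^-1)%:E)%E.
Proof.
move=> s0 k0 ma a0 hk.
set D := `]t, t + s]%classic in hk *.
have mD : measurable D by exact: measurable_itv.
set Phi := (\int[mu]_(x in D) _)%E.
have Phi0 : (0 <= Phi)%E.
  by apply: integral_ge0 => x _; rewrite lee_fin mulr_ge0// powR_ge0.
pose w x := (x - t) `^ (p * q)^-1; pose v x := (x - t) `^ (- (p * q)^-1).
have hold := @Lp_of_hoelder R p q D (fun x => a x * w x) v p0 q0 pq mD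
  (ae_measurable_fun_eq _ (measurable_funM ma (measurable_shift_powR _ _)))
  (ae_measurable_fun_eq _ (measurable_shift_powR _ _))
  (fun x => mulr_ge0 (a0 x) (powR_ge0 _ _)) (fun x => powR_ge0 _ _).
have e1 : (\int[mu]_(x in D) (a x * w x * v x)%:E = \int[mu]_(x in D) (a x)%:E)%E.
  apply: eq_integral => x; rewrite inE /D /= in_itv/= => /andP[tx _].
  rewrite -mulrA /w /v -powRD; last by rewrite subrr eqxx/= subr_eq0 gt_eqF.
  by rewrite subrr powRr0 mulr1.
have e2 : Lp_of p D (fun x => a x * w x) = (Phi `^ p^-1)%E.
  rewrite /Lp_of /Phi; congr (_ `^ _)%E; apply: eq_integral => x _.
  rewrite powRM ?powR_ge0// /w -powRrM; congr ((_ * _ `^ _)%:E).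
  by rewrite invfM mulrAC mulVf ?mul1r// gt_eqF.
have e3 : (Lp_of q D v <= ((s `^ q^-1 * q) `^ q^-1)%:E)%E.
  rewrite /Lp_of -poweR_EFin; apply: gt0_ler_poweR.
  - by rewrite invr_ge0 ltW.
  - by rewrite in_itv/= leey andbT integral_ge0// => x _; rewrite lee_fin powR_ge0.
  - by rewrite in_itv/= leey andbT lee_fin mulr_ge0 ?powR_ge0// ltW.
  have b01 : 0 < p^-1 < 1 by rewrite invr_gt0 p0 p1'.
  have := integral_powR_near0 t b01 s0.
  have -> : 1 - p^-1 = q^-1 by rewrite -pq addrC addKr.
  rewrite invrK; apply: le_trans; apply: ge0_ae_le_integralW.
  - by move=> x _; rewrite lee_fin powR_ge0.
  - by move=> x _; rewrite lee_fin powR_ge0.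
  apply: nearW => x _; rewrite /v -powRrM lee_fin.
  suff -> : - (p * q)^-1 * q = - p^-1 by [].
  by rewrite mulNr invfM -mulrA mulVf ?mulr1// gt_eqF.
rewrite e1 e2 in hold.
have hk2 : (k%:E <= Phi `^ p^-1 * ((s `^ q^-1 * q) `^ q^-1)%:E)%E.
  apply: (le_trans hk); apply: (le_trans hold).
  by apply: lee_wpmul2l => //; exact: poweR_ge0.
have hk3 : ((k `^ p)%:E <= Phi * ((s `^ q^-1 * q) `^ (p - 1))%:E)%E.
  have := hk2; move=> /(@gt0_ler_poweR R p (ltW p0) k%:E _).
  rewrite !in_itv/= !leey !andbT lee_fin k0.
  have -> : (0 <= Phi `^ p^-1 * ((s `^ q^-1 * q) `^ q^-1)%:E)%E.
    by rewrite mule_ge0 ?poweR_ge0// lee_fin powR_ge0.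
  move=> /(_ isT isT); rewrite poweRM ?poweR_ge0 ?lee_fin ?powR_ge0// !poweR_EFin.
  rewrite -poweRrM mulVf ?gt_eqF// poweRe1// -powRrM [q^-1 * p]mulrC pdq.
  exact.
have sE : ((k / s) `^ p = s `^ (- p) * k `^ p)%R.
  have si : 0 <= s^-1 by rewrite invr_ge0 ltW.
  rewrite powRM// [RHS]mulrC; congr (_ * _).
  by rewrite -[s^-1]powR_inv1 ?(ltW s0)// -powRrM mulN1r.
rewrite sE EFinM.
apply: (@le_trans _ _ ((s `^ (- p))%:E * (Phi * ((s `^ q^-1 * q) `^ (p - 1))%:E))%E).
  by apply: lee_wpmul2l => //; rewrite lee_fin powR_ge0.
rewrite [(Phi * _)%E]muleC muleA -EFinM le_eqVlt; apply/orP; left; apply/eqP.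
congr ((_)%:E * _)%E.
rewrite powRM ?powR_ge0 ?(ltW q0)// -powRrM mulrA mulrC -powRD; last first.
  by apply/implyP => _; rewrite gt_eqF.
congr (_ * _ `^ _).
have -> : q^-1 * (p - 1) = p / q - q^-1 by rewrite mulrBr mulr1 mulrC.
rewrite pdq; lra.
Qed.

(** The integrand of the double integral, extended by [0] to the plane for
    Tonelli's theorem. *)
Let kern (a : R -> R) (t d : R) (z : R * R) : R :=
  if [&& 0 < z.1, z.1 <= d, t < z.2 & z.2 <= t + z.1] then
    z.1 `^ (- q^-1 - 1) * (a z.2 `^ p * (z.2 - t) `^ q^-1) else 0.

Let measurable_kern a t d : measurable_fun setT a ->
  measurable_fun setT (kern a t d).
Proof.
move=> ma; apply: measurable_fun_ifT => //.
  apply: measurable_and; first by apply: measurable_fun_ltr => //; exact: measurable_fst.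
  apply: measurable_and; first by apply: measurable_fun_ler => //; exact: measurable_fst.
  apply: measurable_and; first by apply: measurable_fun_ltr => //; exact: measurable_snd.
  apply: measurable_fun_ler; first exact: measurable_snd.
  by apply: measurable_funD => //; exact: measurable_fst.
apply: measurable_funM.
  apply: (@measurableT_comp _ _ _ _ _ _ (fun x : R => x `^ (- q^-1 - 1))).
    exact: measurable_powR.
  exact: measurable_fst.
apply: measurable_funM.
  apply: (@measurableT_comp _ _ _ _ _ _ (fun x : R => a x `^ p)); last exact: measurable_snd.
  exact: (measurableT_comp (measurable_powR _)).
apply: (@measurableT_comp _ _ _ _ _ _ (fun x : R => (x - t) `^ q^-1)); last exact: measurable_snd.
exact: measurable_shift_powR.
Qed.

Let kern_ge0 a t d z : 0 <= kern a t d z.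
Proof. by rewrite /kern; case: ifP => // _; rewrite !mulr_ge0// powR_ge0. Qed.

(** The pointwise bound is integrated in [s]; after exchanging the integrals,
    the inner one is that of a power of [s] over a half-line. *)
Lemma hardy (g k : R -> R) (t d : R) : 0 < d ->
  ae_measurable `[t, t + d] g -> (forall x, 0 <= g x) -> (forall s, 0 <= k s) ->
  (forall s, 0 < s <= d -> ((k s)%:E <= \int[mu]_(x in `[t, (t + s)%R]) (g x)%:E)%E) ->
  (\int[mu]_(s in `]0%R, d]) ((k s / s) `^ p)%:E <=
    (q `^ p)%:E * \int[mu]_(x in `[t, (t + d)%R]) (g x `^ p)%:E)%E.
Proof.
move=> d0 ag g0 k0 hk.
have [a [ma ea _ a0]] := ae_measurable_rep (measurable_itv _) ag g0.
have -> : (\int[mu]_(x in `[t, (t + d)%R]) (g x `^ p)%:E =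
           \int[mu]_(x in `[t, (t + d)%R]) (a x `^ p)%:E)%E.
  apply: ae_eq_integralW => [x _|x _|].
  - by rewrite lee_fin powR_ge0.
  - by rewrite lee_fin powR_ge0.
  - by apply: (aeS ea) => x e /e ->.
have hk' s : 0 < s -> s <= d -> ((k s)%:E <= \int[mu]_(x in `]t, (t + s)%R]) (a x)%:E)%E.
  move=> s0 sd; apply: (le_trans (hk s _)); first by rewrite s0.
  rewrite integral_itv_obnd_cbnd; last first.
    by apply/measurable_EFinP; exact: measurable_funTS.
  apply: ge0_ae_le_integralW.
  - by move=> x _; rewrite lee_fin.
  - by move=> x _; rewrite lee_fin.
  - apply: (aeS ea) => x e; rewrite /= !in_itv/= => /andP[x1 x2].
    by rewrite e// /= in_itv/= x1/= (le_trans x2)// lerD2l.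
pose c := q `^ (p - 1).
have c0 : 0 <= c by exact: powR_ge0.
have mk := measurable_kern t d ma.
have mk1 s : measurable_fun setT (fun x => (kern a t d (s, x))%:E).
  by apply/measurable_EFinP; apply: (measurableT_comp mk); exact: measurable_pair1.
have mk2 x : measurable_fun setT (fun s => (kern a t d (s, x))%:E).
  by apply/measurable_EFinP; apply: (measurableT_comp mk); exact: measurable_pair2.
apply: (@le_trans _ _ (c%:E * \int[mu]_s \int[mu]_x (kern a t d (s, x))%:E)%E).
  rewrite -ge0_integralZl_EFin//; last 2 first.
  - by move=> s _; apply: integral_ge0 => x _; rewrite lee_fin.
  - have := @measurable_fun_fubini_tonelli_F _ _ _ _ R mu (EFin \o kern a t d).
    by apply => //; [exact/measurable_EFinP|move=> z; rewrite lee_fin].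
  rewrite [leLHS]integral_mkcond; apply: ge0_ae_le_integralW.
  - by move=> s _; apply: erestrict_ge0 => x _; rewrite lee_fin powR_ge0.
  - by move=> s _; rewrite mule_ge0// ?lee_fin// integral_ge0// => x _; rewrite lee_fin.
  apply: nearW => s _; rewrite /patch; case: ifPn => sD; last first.
    by rewrite mule_ge0// ?lee_fin// integral_ge0// => x _; rewrite lee_fin.
  move: sD; rewrite inE/= in_itv/= => /andP[s0 sd].
  apply: (le_trans (hardy_pointwise s0 (k0 s) ma a0 (hk' _ s0 sd))).
  rewrite EFinM -muleA; apply: lee_wpmul2l => //.
  rewrite -ge0_integralZl_EFin//; last 3 first.
  - by move=> x _; rewrite lee_fin mulr_ge0// powR_ge0.
  - apply/measurable_EFinP; apply: measurable_funTS; apply: measurable_funM.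
      exact: (measurableT_comp (measurable_powR _)).
    exact: measurable_shift_powR.
  - exact: powR_ge0.
  rewrite [leLHS]integral_mkcond; apply: ge0_ae_le_integralW.
  - move=> x _; apply: erestrict_ge0 => y _.
    by rewrite mule_ge0// lee_fin ?powR_ge0// mulr_ge0// powR_ge0.
  - by move=> x _; rewrite lee_fin.
  apply: nearW => x _; rewrite /patch; case: ifPn => xD; last by rewrite lee_fin.
  move: xD; rewrite inE/= in_itv/= => /andP[x1 x2].
  by rewrite /kern/= s0 sd x1 x2/= -EFinM.
rewrite (@fubini_tonelli _ _ _ _ R mu mu (EFin \o kern a t d))/=; last 2 first.
- exact/measurable_EFinP.
- by move=> z; rewrite lee_fin.
have qpE : q `^ p = c * q.
  have -> : p = (p - 1) + 1 by rewrite subrK.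
  by rewrite powRD ?powRr1 ?(ltW q0)// (gt_eqF q0) implybT.
rewrite qpE EFinM -muleA; apply: lee_wpmul2l => //.
rewrite -ge0_integralZl_EFin//; last 3 first.
- by move=> x _; rewrite lee_fin powR_ge0.
- by apply/measurable_EFinP; apply: measurable_funTS;
    exact: (measurableT_comp (measurable_powR _)).
- exact: ltW.
rewrite [leRHS]integral_mkcond; apply: ge0_ae_le_integralW.
- by move=> x _; apply: integral_ge0 => s _; rewrite lee_fin.
- move=> x _; apply: erestrict_ge0 => y _.
  by rewrite mule_ge0// lee_fin ?powR_ge0// ltW.
apply: nearW => x _.
have [xin|xout] := pselect (t < x /\ x <= t + d); last first.
  rewrite (_ : (\int[mu]_s _)%E = 0%E).
    apply: erestrict_ge0 => y _.
    by rewrite mule_ge0// lee_fin ?powR_ge0// ltW.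
  apply: integral0_eq => s _; rewrite /kern/=; case: ifPn => // /and4P[h1 h2 h3 h4].
  by exfalso; apply: xout; split => //; apply: (le_trans h4); rewrite lerD2l.
have [tx xd] := xin; have xt : 0 < x - t by rewrite subr_gt0.
rewrite patchE mem_set/=; last by rewrite in_itv/= ltW.
set A := a x `^ p * (x - t) `^ q^-1.
have A0 : 0 <= A by rewrite mulr_ge0// powR_ge0.
have qi0 : 0 < q^-1 by rewrite invr_gt0.
apply: (@le_trans _ _ (A%:E * \int[mu]_(s in `[(x - t)%R, +oo[) (s `^ (- q^-1 - 1))%:E)%E).
  rewrite -ge0_integralZl_EFin//; last 2 first.
  - by move=> s _; rewrite lee_fin powR_ge0.
  - by apply/measurable_EFinP; apply: measurable_funTS; exact: measurable_powR.
  rewrite [leRHS]integral_mkcond; apply: ge0_ae_le_integralW.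
  - by move=> s _; rewrite lee_fin.
  - by move=> s _; apply: erestrict_ge0 => y _; rewrite mule_ge0// lee_fin ?powR_ge0.
  apply: nearW => s _; rewrite /kern/=; case: ifPn => [/and4P[h1 h2 h3 h4]|_]; last first.
    by apply: erestrict_ge0 => y _; rewrite mule_ge0// lee_fin ?powR_ge0.
  by rewrite patchE mem_set/= ?in_itv/= ?andbT ?lerBlDl// -EFinM lee_fin mulrC.
apply: (@le_trans _ _ (A%:E * ((x - t) `^ (- q^-1) / q^-1)%:E)%E).
  by apply: lee_wpmul2l; rewrite ?lee_fin//; exact: integral_powR_tail.
rewrite -!EFinM lee_fin invrK /A mulrA -[_ * _ * (x - t) `^ _]mulrA -powRD; last first.
  by rewrite subrr eqxx/= gt_eqF.
by rewrite subrr powRr0 mulr1 mulrC.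
Qed.

End HardyInequality.

(** * The K-functional and the interpolation norm *)

Section InterpolationNorm.
Context (R : realType) (X : completeNormedModType R) (A : linear_operator X) (p : R).
Hypothesis p1 : 1 < p.
Local Notation mu := (@lebesgue_measure R).
Local Notation DA := (graph_space A).
Implicit Types (x y : X) (s d c : R).

Let p0 : 0 < p. Proof. exact: lt_trans p1. Qed.

Lemma app0 : A 0 = 0.
Proof.
have := app_linear (-1) (dom0 A) (dom0 A).
by rewrite scaler0 addr0 scaleN1r addNr.
Qed.

Lemma domD x y : dom A x -> dom A y -> dom A (x + y).
Proof. by move=> hx hy; rewrite -[x]scale1r; exact: dom_linear. Qed.

Lemma domZ c x : dom A x -> dom A (c *: x).
Proof. by move=> hx; rewrite -[_ *: _]addr0; apply: dom_linear => //; exact: dom0. Qed.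

Lemma appD x y : dom A x -> dom A y -> A (x + y) = A x + A y.
Proof. by move=> hx hy; rewrite -{1}[x]scale1r app_linear// scale1r. Qed.

Lemma appZ c x : dom A x -> A (c *: x) = c *: A x.
Proof.
move=> hx; rewrite -{1}[_ *: _]addr0 app_linear//; last exact: dom0.
by rewrite app0 addr0.
Qed.

Lemma graph_seminormed : seminormed_subspace DA.
Proof.
split => /=.
- exact: dom0.
- by move=> x y; exact: domD.
- by move=> c x; exact: domZ.
- by move=> x; rewrite addr_ge0.
- move=> x y hx hy; rewrite appD// addrACA.
  by rewrite lerD// ler_normD.
- by move=> c x hx; rewrite appZ// !normrZ mulrDr.
Qed.

Lemma simple_fun_app (s : simple_data X) (t : R) : is_simple DA s ->
  simple_fun [seq (e.1, A e.2) | e <- s] t = A (simple_fun s t).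
Proof.
elim: s => [|e s IH]; first by rewrite !simple_fun_nil app0.
move=> /is_simple_cons[[_ _ h] hs]; rewrite /= !simple_fun_cons IH//=.
rewrite appD ?appZ//; first exact: domZ.
exact: (simple_fun_carrier graph_seminormed).
Qed.

Lemma strongly_measurable_app I f : strongly_measurable DA I f ->
  strongly_measurable (whole X) I (fun t => A (f t)).
Proof.
move=> [s [hs h]]; exists (fun k => [seq (e.1, A e.2) | e <- s k]); split.
  move=> k; elim: (s k) (hs k) => [_|e s' IH]; first exact: is_simple_nil.
  by move=> /is_simple_cons[[h1 h2 _] hs']; apply/is_simple_cons; split => //; exact: IH.
apply: (aeS h) => t h' It; have [ft cv] := h' It; split => //.
apply: squeeze_cvg0 cv => k /=; rewrite normr_ge0 simple_fun_app//=.
have sk : dom A (simple_fun (s k) t) by exact: (simple_fun_carrier graph_seminormed).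
rewrite -scaleN1r -appZ// -appD ?scaleN1r//; last by rewrite -scaleN1r; exact: domZ.
by rewrite lerDr normr_ge0.
Qed.

Lemma K_le s x b : 0 <= s -> dom A b ->
  K_functional A s x <= `|x - b| + s * (`|b| + `|A b|).
Proof.
move=> s0 hb; apply: ge_inf; last first.
  by exists (x - b), b; split => //; rewrite subrK.
exists 0 => r [a [b' [_ _ ->]]]; rewrite addr_ge0// mulr_ge0//.
by rewrite /= addr_ge0.
Qed.

Lemma le_K s x c : (forall b, dom A b -> c <= `|x - b| + s * (`|b| + `|A b|)) ->
  c <= K_functional A s x.
Proof.
move=> h; apply: lb_le_inf.
  by exists (`|x| + s * snorm DA 0), x, 0; split; rewrite ?addr0//; exact: dom0.
move=> r [a [b [hb xab ->]]]; have := h b hb.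
by rewrite {1}xab addrK.
Qed.

Lemma K_ge0 s x : 0 <= s -> 0 <= K_functional A s x.
Proof. by move=> s0; apply: le_K => b _; rewrite addr_ge0// mulr_ge0// addr_ge0. Qed.

Lemma K_le_norm s x : 0 <= s -> K_functional A s x <= `|x|.
Proof.
move=> s0; apply: le_trans (K_le x s0 (dom0 A)) _.
by rewrite subr0 app0 normr0 addr0 mulr0 addr0.
Qed.

Lemma K_adherent s x (e : R) : 0 <= s -> 0 < e ->
  exists b, dom A b /\ `|x - b| + s * (`|b| + `|A b|) < K_functional A s x + e.
Proof.
move=> s0 e0; apply: contrapT => h.
have : K_functional A s x + e <= K_functional A s x.
  apply: le_K => b hb; rewrite leNgt; apply/negP => h'; apply: h; by exists b.
by rewrite leNgt ltrDl e0.
Qed.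

Lemma K_D s x y : 0 <= s ->
  K_functional A s (x + y) <= K_functional A s x + K_functional A s y.
Proof.
move=> s0; apply/ler_addgt0Pr => e e0.
have e2 : 0 < e / 2 by rewrite divr_gt0.
have [b [hb b1]] := K_adherent x s0 e2; have [b' [hb' b2]] := K_adherent y s0 e2.
apply: le_trans (K_le _ s0 (domD hb hb')) _.
rewrite appD//.
have n1 : `|x + y - (b + b')| <= `|x - b| + `|y - b'|.
  by rewrite opprD addrACA ler_normD.
have n2 : s * (`|b + b'| + `|A b + A b'|) <= s * (`|b| + `|A b|) + s * (`|b'| + `|A b'|).
  by rewrite -mulrDr ler_wpM2l// addrACA lerD// ler_normD.
move: b1 b2 n1 n2; move: (s * _) (s * _) (s * _) => u v w; lra.
Qed.

Lemma K_Z s c x : 0 <= s -> K_functional A s (c *: x) <= `|c| * K_functional A s x.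
Proof.
move=> s0; apply/ler_addgt0Pr => e e0.
have c1 : 0 < `|c| + 1 by rewrite ltr_wpDl.
have e2 : 0 < e / (`|c| + 1) by rewrite divr_gt0.
have [b [hb b1]] := K_adherent x s0 e2.
apply: le_trans (K_le _ s0 (domZ c hb)) _.
rewrite appZ// -scalerBr !normrZ -mulrDr mulrCA -mulrDr.
apply: (@le_trans _ _ (`|c| * (K_functional A s x + e / (`|c| + 1)))).
  by rewrite ler_wpM2l// ltW.
rewrite mulrDr lerD2l mulrCA ler_piMr ?(ltW e0)//.
by rewrite ler_pdivrMr// mul1r lerDl.
Qed.

Lemma K_mono s s' x : 0 <= s -> s <= s' -> K_functional A s x <= K_functional A s' x.
Proof.
move=> s0 ss'; apply: le_K => b hb; apply: le_trans (K_le x s0 hb) _.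
by rewrite lerD2l ler_wpM2r// addr_ge0.
Qed.

Lemma K_ge_norm s x : 0 <= s -> Num.min 1 s * `|x| <= K_functional A s x.
Proof.
move=> s0; apply: le_K => b hb.
have m0 : 0 <= Num.min 1 s by rewrite le_min ler01.
apply: (@le_trans _ _ (Num.min 1 s * (`|x - b| + `|b|))).
  by rewrite ler_wpM2l// -{1}(subrK b x) ler_normD.
rewrite mulrDr lerD//; first by rewrite ler_piMl// ge_min lexx.
apply: (@le_trans _ _ (s * `|b|)); first by rewrite ler_wpM2r// ge_min lexx orbT.
by rewrite ler_wpM2l// lerDl.
Qed.

(** The interpolation norm is the [L^p] norm of this function on [(0, oo)]. *)
Definition K_quot x s : R := if 0 < s then K_functional A s x / s else 0.

Lemma K_quot_ge0 x s : 0 <= K_quot x s.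
Proof. by rewrite /K_quot; case: ifP => // s0; rewrite divr_ge0 ?K_ge0 ?ltW. Qed.

Lemma measurable_K_quot x : measurable_fun setT (K_quot x).
Proof.
pose f s := if 0 < s then K_functional A s x else 0.
have mf : measurable_fun setT f.
  apply: nondecreasing_measurable => // s s' ss'; rewrite /f.
  case: ifPn => s0; first by rewrite (lt_le_trans s0 ss') K_mono// ltW.
  by case: ifP => // s'0; rewrite K_ge0// ltW.
have -> : K_quot x = (fun s => f s * (s - 0) `^ (-1)).
  apply/funext => s; rewrite /K_quot /f; case: ifPn => s0; last by rewrite mul0r.
  by rewrite subr0 powR_inv1// ltW.
by apply: measurable_funM => //; exact: measurable_shift_powR.
Qed.

Lemma K_quotD x y s : K_quot (x + y) s <= K_quot x s + K_quot y s.
Proof.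
rewrite /K_quot; case: ifPn => s0; last by rewrite addr0.
by rewrite -mulrDl ler_wpM2r ?invr_ge0 ?(ltW s0)// K_D// ltW.
Qed.

Lemma K_quotZ c x s : K_quot (c *: x) s <= `|c| * K_quot x s.
Proof.
rewrite /K_quot; case: ifPn => s0; last by rewrite mulr0.
by rewrite mulrA ler_wpM2r ?invr_ge0 ?(ltW s0)// K_Z// ltW.
Qed.

Lemma Xp_normE x : Xp_norm A p x = Lp_of p `]0, +oo[ (K_quot x).
Proof.
rewrite /Xp_norm /interp_norm /Lp_of; congr (_ `^ _)%E.
apply: eq_integral => s; rewrite inE/= in_itv/= andbT => s0.
rewrite /K_quot s0; congr (_%:E).
have K0 : 0 <= K_functional A s x by rewrite K_ge0// ltW.
rewrite !powRM ?powR_ge0 ?invr_ge0 ?(ltW s0)//.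
rewrite [LHS]mulrAC [RHS]mulrC; congr (_ * _).
rewrite -powRrM -[X in _ * X]powR_inv1 ?(ltW s0)// -powRD; last by rewrite (gt_eqF s0) implybT.
rewrite -[s^-1]powR_inv1 ?(ltW s0)// -powRrM; congr (_ `^ _).
by field; exact: lt0r_neq0.
Qed.

Let mI : measurable (`]0, +oo[%classic : set R). Proof. exact: measurable_itv. Qed.

Let aK x D : ae_measurable D (K_quot x).
Proof. by apply: ae_measurable_fun_eq; exact: measurable_K_quot. Qed.

Lemma Xp_norm_ge0 x : (0 <= Xp_norm A p x)%E.
Proof. by rewrite Xp_normE Lp_of_ge0. Qed.

Lemma Xp_normD x y : (Xp_norm A p (x + y)%R <= Xp_norm A p x + Xp_norm A p y)%E.
Proof.
rewrite !Xp_normE; apply: Lp_of_D; rewrite ?ltW//.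
- exact: K_quot_ge0.
- exact: K_quot_ge0.
- by apply: nearW => s _; rewrite K_quot_ge0 K_quotD.
Qed.

Lemma Xp_normZ c x : (Xp_norm A p (c *: x)%R <= `|c|%:E * Xp_norm A p x)%E.
Proof.
rewrite !Xp_normE -Lp_of_Z//; last exact: K_quot_ge0.
by apply: le_Lp_of => //; apply: nearW => s _; rewrite K_quot_ge0 K_quotZ.
Qed.

(** On [(1, 2]] the quotient [K s x / s] is at least [`|x| / 2]. *)
Lemma norm_le_Xp x : (`|x|%:E <= 2%:E * Xp_norm A p x)%E.
Proof.
suff h : ((`|x| / 2)%:E <= Xp_norm A p x)%E.
  have : (2%:E * (`|x| / 2)%:E <= 2%:E * Xp_norm A p x)%E by apply: lee_wpmul2l.
  by rewrite -EFinM mulrC divfK.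
rewrite Xp_normE; apply: (@le_trans _ _ (Lp_of p `]1%R, 2%R] (fun=> `|x| / 2))).
  rewrite Lp_of_cst ?divr_ge0//=.
  rewrite lebesgue_measure_itv/= lte_fin ltr1n/=.
  have -> : 2 - 1 = 1 :> R by lra.
  by rewrite powR1 mule1.
apply: (@le_trans _ _ (Lp_of p `]1%R, 2%R] (K_quot x))); last first.
  apply: le_Lp_of_set => // s; rewrite /= !in_itv/= andbT => /andP[s1 _].
  exact: lt_trans s1.
apply: le_Lp_of => //; apply: nearW => s; rewrite /= in_itv/= => /andP[s1 s2].
have s0 : 0 < s by apply: lt_trans s1.
rewrite divr_ge0//= /K_quot s0 ler_pdivlMr//.
apply: (@le_trans _ _ `|x|).
  by rewrite -mulrA ler_piMr// mulrC ler_pdivrMr// mul1r.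
by have := K_ge_norm x (ltW s0); rewrite min_l ?(ltW s1)// mul1r.
Qed.

Lemma K_quot_dist x y s : `|K_quot x s - K_quot y s| <= `|x - y| * (s - 0) `^ (-1).
Proof.
rewrite /K_quot; case: ifPn => s0; last first.
  by rewrite subr0 normr0 mulr_ge0// powR_ge0.
rewrite subr0 powR_inv1 ?(ltW s0)// -mulrBl normrM [`|s^-1|]ger0_norm ?invr_ge0 ?(ltW s0)//.
rewrite ler_wpM2r ?invr_ge0 ?(ltW s0)// ler_norml; have s0' := ltW s0.
have h1 : K_functional A s x <= K_functional A s (x - y) + K_functional A s y.
  by rewrite -{1}(subrK y x); exact: K_D.
have h2 : K_functional A s y <= K_functional A s (y - x) + K_functional A s x.
  by rewrite -{1}(subrK x y); exact: K_D.
have h3 := K_le_norm (x - y) s0'; have h4 := K_le_norm (y - x) s0'.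
rewrite distrC in h4; apply/andP; split; lra.
Qed.

Lemma cvg_K_quot (u : nat -> X) x s : u @ \oo --> x ->
  (fun n => K_quot (u n) s) @ \oo --> K_quot x s.
Proof.
move=> cu; apply/cvgrPdist_lt => e e0.
have c1 : 0 < (s - 0) `^ (-1) + 1 by rewrite ltr_wpDl// powR_ge0.
have e1 : 0 < e / ((s - 0) `^ (-1) + 1) by rewrite divr_gt0.
move/cvgrPdist_lt/(_ _ e1): cu; apply: filterS => n hn.
apply: le_lt_trans (K_quot_dist _ _ _) _.
apply: (@le_lt_trans _ _ (`|x - u n| * ((s - 0) `^ (-1) + 1))).
  by rewrite ler_wpM2l// lerDl.
by rewrite -ltr_pdivlMr.
Qed.

(** Fatou's lemma, as the K-functional is continuous in [x]. *)
Lemma Xp_norm_lsc (u : nat -> X) x (M : R) : u @ \oo --> x ->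
  (forall n, (Xp_norm A p (u n) <= M%:E)%E) -> (Xp_norm A p x <= M%:E)%E.
Proof.
move=> cu hM.
have M0 : 0 <= M by rewrite -lee_fin; apply: le_trans (hM 0%N); exact: Xp_norm_ge0.
have intM n : (\int[mu]_(s in `]0%R, +oo[) (K_quot (u n) s `^ p)%:E <= (M `^ p)%:E)%E.
  have := hM n; rewrite Xp_normE => /(@gt0_ler_poweR R p (ltW p0) _ _).
  rewrite !in_itv/= !leey !andbT lee_fin M0 Lp_of_ge0 => /(_ isT isT).
  rewrite /Lp_of -poweRrM mulVf ?gt_eqF// poweRe1//.
  by apply: integral_ge0 => s _; rewrite lee_fin powR_ge0.
have cv s : (fun n => (K_quot (u n) s `^ p)%:E) @ \oo --> (K_quot x s `^ p)%:E.
  apply: cvg_EFin; first exact: nearW.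
  apply: cvg_powR => //; last exact: cvg_K_quot.
  by move=> n; exact: K_quot_ge0.
have : (\int[mu]_(s in `]0%R, +oo[) (K_quot x s `^ p)%:E <= (M `^ p)%:E)%E.
  have := @fatou _ _ R mu `]0%R, +oo[%classic mI (fun n s => (K_quot (u n) s `^ p)%:E).
  have -> : (\int[mu]_(s in `]0%R, +oo[) limn_einf (fun n => (K_quot (u n) s `^ p)%:E) =
    \int[mu]_(s in `]0%R, +oo[) (K_quot x s `^ p)%:E)%E.
    by apply: eq_integral => s _; apply: (cvg_limn_einf_sup (cv s)).1.
  move=> h; apply: le_trans (h _ _) _.
  - move=> n; apply/measurable_EFinP; apply: measurable_funTS.
    exact: (measurableT_comp (measurable_powR _) (measurable_K_quot _)).
  - by move=> n s _; rewrite lee_fin powR_ge0.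
  rewrite limn_einf_lim; apply: lime_le; first exact: is_cvg_einfs.
  apply: nearW => n; apply: le_trans (intM n).
  by apply: ereal_inf_lbound; exists n => /=.
by rewrite Xp_normE; exact: Lp_of_le_powR.
Qed.

(** Only [K s x <= `|x|] is used far from [0]. *)
Lemma Xp_norm_split d : 0 < d -> exists c, 0 < c /\
  forall x, (Xp_norm A p x <= Lp_of p `]0%R, d] (K_quot x) + (c * `|x|)%:E)%E.
Proof.
move=> d0; have pm0 : 0 < p - 1 by rewrite subr_gt0.
pose c := (d `^ (- (p - 1)) / (p - 1)) `^ p^-1.
exists (c + 1); split; first by rewrite ltr_wpDl// powR_ge0.
move=> x; rewrite Xp_normE.
pose f1 s : R := \1_(`]0, d]%classic : set R) s * K_quot x s.
pose f2 s : R := \1_(`[d, +oo[%classic : set R) s * (`|x| * (s - 0) `^ (-1)).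
have m1 : measurable_fun setT f1.
  by apply: measurable_funM => //; exact: measurable_K_quot.
have m2 : measurable_fun setT f2.
  apply: measurable_funM => //; apply: measurable_funM => //.
  exact: measurable_shift_powR.
apply: (@le_trans _ _ (Lp_of p `]0%R, +oo[ f1 + Lp_of p `]0%R, +oo[ f2)%E).
  apply: Lp_of_D; rewrite ?ltW//.
  - exact: ae_measurable_fun_eq.
  - exact: ae_measurable_fun_eq.
  - by move=> s; rewrite mulr_ge0// K_quot_ge0.
  - by move=> s; rewrite !mulr_ge0// powR_ge0.
  - apply: nearW => s; rewrite /= in_itv/= andbT => s0; rewrite K_quot_ge0/= /f1 /f2 !indicE.
    have [sd|sd] := leP s d.
      rewrite mem_set/= ?in_itv/= ?s0// mul1r lerDl !mulr_ge0// powR_ge0//.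
    rewrite memNset/= ?in_itv/=; last by rewrite s0/= leNgt sd.
    rewrite mul0r add0r mem_set/= ?in_itv/= ?(ltW sd)// mul1r /K_quot s0 subr0.
    by rewrite powR_inv1 ?(ltW s0)// ler_wpM2r ?invr_ge0 ?(ltW s0)// K_le_norm// ltW.
apply: leeD.
  rewrite /Lp_of; apply: gt0_ler_poweR.
  - by rewrite invr_ge0 ltW.
  - by rewrite in_itv/= leey andbT integral_ge0// => s _; rewrite lee_fin powR_ge0.
  - by rewrite in_itv/= leey andbT integral_ge0// => s _; rewrite lee_fin powR_ge0.
  rewrite [leLHS]integral_mkcond [leRHS]integral_mkcond; apply: ge0_ae_le_integralW.
  - by move=> s _; apply: erestrict_ge0 => z _; rewrite lee_fin powR_ge0.
  - by move=> s _; apply: erestrict_ge0 => z _; rewrite lee_fin powR_ge0.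
  apply: nearW => s _; rewrite /patch; case: ifPn => // sI; last first.
    by case: ifP => // _; rewrite lee_fin powR_ge0.
  rewrite /f1 indicE; case: ifPn => _; rewrite ?mul1r// mul0r powR0// gt_eqF//.
rewrite /Lp_of; apply: (@le_trans _ _ (((c `^ p * `|x| `^ p)%:E) `^ p^-1)%E); last first.
  rewrite poweR_EFin -powRM ?powR_ge0// -powRrM divff ?gt_eqF// powRr1 ?mulr_ge0 ?powR_ge0//.
  by rewrite lee_fin ler_wpM2r// lerDl.
apply: gt0_ler_poweR.
- by rewrite invr_ge0 ltW.
- by rewrite in_itv/= leey andbT integral_ge0// => s _; rewrite lee_fin powR_ge0.
- by rewrite in_itv/= leey andbT lee_fin mulr_ge0 ?powR_ge0.
apply: (@le_trans _ _ ((`|x| `^ p)%:E * \int[mu]_(s in `[d, +oo[) (s `^ (- (p - 1) - 1))%:E)%E).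
  rewrite -ge0_integralZl_EFin ?powR_ge0//; last 2 first.
  - by move=> s _; rewrite lee_fin powR_ge0.
  - by apply/measurable_EFinP; apply: measurable_funTS; exact: measurable_powR.
  rewrite [leLHS]integral_mkcond [leRHS]integral_mkcond; apply: ge0_ae_le_integralW.
  - by move=> s _; apply: erestrict_ge0 => z _; rewrite lee_fin powR_ge0.
  - by move=> s _; apply: erestrict_ge0 => z _; rewrite mule_ge0// lee_fin powR_ge0.
  apply: nearW => s _; rewrite /patch.
  have [sd|sd] := boolP (s \in `[d, +oo[%classic); last first.
    by case: ifP => // _; rewrite /f2 indicE (negbTE sd) mul0r powR0// gt_eqF.
  have s0 : 0 < s by move: sd; rewrite inE/= in_itv/= andbT; exact: lt_le_trans.
  rewrite mem_set/= ?in_itv/= ?s0// /f2 indicE sd mul1r subr0 powRM ?powR_ge0//.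
  rewrite -powRrM -EFinM lee_fin (_ : -1 * p = - (p - 1) - 1)//; lra.
rewrite EFinM muleC; apply: lee_wpmul2r; first by rewrite lee_fin powR_ge0.
rewrite /c -powRrM mulVf ?gt_eqF// powRr1; last by rewrite divr_ge0 ?powR_ge0 ?(ltW pm0).
exact: integral_powR_tail.
Qed.

End InterpolationNorm.

(** * Absolute continuity of the integral *)

Section AbsoluteContinuity.
Context (R : realType).
Local Notation mu := (@lebesgue_measure R).
Implicit Types (D E : set R) (G : R -> R).

Lemma integral_cst_set D (c : R) : measurable D ->
  (\int[mu]_(t in D) c%:E = c%:E * mu D)%E.
Proof.
by move=> mD; rewrite -[LHS]/(\int[mu]_(t in D) cst c%:E t)%E integral_cst.
Qed.

(** Below a level [M] the integral is at most [M] times the measure, above it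
    is small by integrability. *)
Lemma integral_absolutely_continuous D G (e : R) : measurable D ->
  ae_measurable D G -> (forall t, 0 <= G t) ->
  (\int[mu]_(t in D) (G t)%:E < +oo)%E -> 0 < e ->
  exists d : R, 0 < d /\ forall E, measurable E -> E `<=` D -> (mu E <= d%:E)%E ->
    (\int[mu]_(t in E) (G t)%:E <= e%:E)%E.
Proof.
move=> mD aG G0 fG e0; have e2 : 0 < e / 2 by rewrite divr_gt0.
have [M [M0 hM]] := integral_tail mD aG G0 fG e2.
exists (e / 2 / M); split; first by rewrite divr_gt0.
move=> E mE ED hE.
apply: (@le_trans _ _ (\int[mu]_(t in E) M%:E +
   \int[mu]_(t in E) ((if M < G t then G t else 0)%R)%:E)%E).
  apply: (@le_integralD _ _ (fun=> M)) => //.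
  - exact: ae_measurable_fun_eq.
  - apply: ae_measurable_sub ED _.
    apply: (@ae_measurable_comp _ _ _ (fun x => if M < x then x else 0)) => //.
    by apply: measurable_fun_ifT => //; exact: measurable_fun_ltr.
  - by move=> t; exact: ltW.
  - by move=> t; case: ifP.
  - apply: nearW => t _; case: ltP => h; first by rewrite lerDr ltW.
    by rewrite addr0.
rewrite [in leRHS](splitr e) EFinD; apply: leeD.
  rewrite integral_cst_set//; apply: (@le_trans _ _ (M%:E * (e / 2 / M)%:E)%E).
    by apply: lee_wpmul2l => //; rewrite lee_fin ltW.
  by rewrite -EFinM lee_fin mulrC divfK ?gt_eqF.
apply: le_trans hM; apply: le_integral_set => // t _.
by rewrite lee_fin; case: ifP.
Qed.

End AbsoluteContinuity.

(** * The trace theorem *)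

Section Trace.
Context (R : realType) (X : completeNormedModType R) (A : linear_operator X) (p : R).
Hypothesis p1 : 1 < p.
Local Notation mu := (@lebesgue_measure R).
Local Notation DA := (graph_space A).
Local Notation W := (whole X).
Implicit Types (x y : X) (s d c t a b : R) (I : set R) (u : R -> X).

Let p0 : 0 < p. Proof. exact: lt_trans p1. Qed.

Let q := (1 - p^-1)^-1.

Let q0 : 0 < q. Proof. by rewrite invr_gt0 subr_gt0 invf_lt1. Qed.

Let pq : p^-1 + q^-1 = 1. Proof. by rewrite invrK; lra. Qed.

(** Its [L^p] norm is equivalent to the maximal regularity norm of [u]. *)
Definition MR_density I u t : R :=
  `|weak_derivative I u t| + (`|u t| + `|A (u t)|).

Lemma MR_density_ge0 I u t : 0 <= MR_density I u t.
Proof. by rewrite !addr_ge0. Qed.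

Section FixedFunction.
Variables (a b : R) (I : set R) (u : R -> X).
Hypotheses (bI : bounded_interval a b I) (hu : in_MR A p I u).

Lemma ae_measurable_weak_derivative :
  ae_measurable I (fun t => `|weak_derivative I u t|).
Proof. by have [[_ _ [h _]] _ _] := hu; exact: ae_measurable_norm. Qed.

Lemma ae_measurable_graph : ae_measurable I (fun t => `|u t| + `|A (u t)|).
Proof.
have [_ [h _] _] := hu; exact: (strongly_measurable_snorm (graph_seminormed A) h).
Qed.

Lemma ae_measurable_MR_density : ae_measurable I (MR_density I u).
Proof.
exact: ae_measurableD ae_measurable_weak_derivative ae_measurable_graph.
Qed.

Lemma Lp_MR_density : (Lp_of p I (MR_density I u) <= MR_norm A p I u)%E.
Proof.
rewrite /MR_norm /W1p_norm addeC.
apply: (@le_trans _ _ (Lp_of p I (fun t => `|weak_derivative I u t|%R) +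
   Lp_of p I (fun t => (`|u t| + `|A (u t)|)%R))%E).
  apply: Lp_of_D; rewrite ?ltW//.
  - exact: bi_measurable bI.
  - exact: ae_measurable_weak_derivative.
  - exact: ae_measurable_graph.
  - by apply: nearW => t _; rewrite lexx andbT MR_density_ge0.
by apply: leeD => //; rewrite leeDr// poweR_ge0.
Qed.

Lemma MR_norm_fin : (MR_norm A p I u < +oo)%E.
Proof.
have [[[_ h1] _ [_ h2]] [_ h3] _] := hu.
by apply: lte_add_pinfty; [exact: h3|apply: lte_add_pinfty; [exact: h1|exact: h2]].
Qed.

Lemma MR_density_integrable : (\int[mu]_(t in I) (MR_density I u t `^ p)%:E < +oo)%E.
Proof.
have h := le_lt_trans Lp_MR_density MR_norm_fin.
rewrite ltey; apply/eqP => e; move: h; rewrite /Lp_of e.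
by rewrite poweRyr ?ltxx// gt_eqF// invr_gt0.
Qed.

Lemma bi_continuous t : `]a, b[%classic t -> {for t, continuous u}.
Proof.
move=> tab; have [_ _ ] := hu => /subspace_continuousP/(_ t (bi_sub bI tab)).
move=> cu; rewrite /prop_for /continuous_at; move: cu.
have It : nbhs t I.
  have : nbhs t `]a, b[%classic by apply: open_nbhs_nbhs; split => //; exact: itv_open.
  by apply: filterS; exact: bi_sub bI.
have -> // : within I (nbhs t) = nbhs t.
apply/seteqP; split => P; last by apply: filterS => z Pz _.
move=> h; have h2 : nbhs t ([set z | I z -> P z] `&` I) by apply: filterI.
by apply: filterS h2 => z [hz Iz]; exact: hz.
Qed.

(** In contrast with [weak_derivative_increment], [t] may be the left end of
    [I], where only one-sided continuity is available. *)
Lemma increment_le t tau : I t -> t < tau -> tau < b ->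
  (`|u t - u tau|%:E <= \int[mu]_(r in `[t, tau]) (`|weak_derivative I u r|)%:E)%E.
Proof.
move=> It ttau taub; have [[_ hw _] _ cu] := hu.
have at' : a <= t by have := bi_sup bI It; rewrite /= in_itv/= => /andP[].
apply/lee_addgt0Pr => e e0.
move/subspace_continuousP/(_ t It)/cvgrPdist_lt/(_ _ e0): cu => cu.
have [d /= d0 hd] : \forall z \near t, I z -> `|u t - u z| < e by [].
pose z := t + Num.min d (tau - t) / 2.
have m0 : 0 < Num.min d (tau - t) by rewrite lt_min d0 subr_gt0.
have [zt [zd ztau]] : t < z /\ z - t < d /\ z < tau.
  have : Num.min d (tau - t) <= d by rewrite ge_min lexx.
  have : Num.min d (tau - t) <= tau - t by rewrite ge_min lexx orbT.
  by rewrite /z; move: (Num.min _ _) m0 => m m0 h1 h2; split; [|split]; lra.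
have az : a < z by apply: le_lt_trans at' zt.
have zab : `]a, b[%classic z by rewrite /= in_itv/= az (lt_trans ztau).
have tauab : `]a, b[%classic tau by rewrite /= in_itv/= (lt_trans az).
have hz : `|u t - u z| < e.
  apply: hd; last exact: (bi_sub bI).
  by rewrite /ball/= distrC gtr0_norm// subr_gt0.
have := weak_derivative_increment bI hw az ztau taub (bi_continuous zab) (bi_continuous tauab).
move=> h; apply: (@le_trans _ _ (`|u tau - u z|%:E + e%:E)%E).
  rewrite -EFinD lee_fin -(subrK (u z) (u t)) -addrA.
  apply: le_trans (ler_normD _ _) _; rewrite (addrC `|u t - u z|) (distrC (u z)).
  by apply: lerD => //; exact: ltW.
apply: leeD => //; apply: (le_trans h); apply: le_integral_set => // r.
by rewrite /= !in_itv/= => /andP[r1 ->]; rewrite (le_trans _ r1)// ltW.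
Qed.

(** The choice [b := u tau] in the K-functional, where the graph norm at [tau]
    is at most its mean over [[t, t + s]]. *)
Lemma K_functional_le t s : I t -> 0 < s -> t + s < b ->
  ((K_functional A s (u t))%:E <= \int[mu]_(r in `[t, (t + s)%R]) (MR_density I u r)%:E)%E.
Proof.
move=> It s0 tsb.
have sub1 := bi_sub_right bI It tsb.
have ag := ae_measurable_sub sub1 ae_measurable_graph.
have aw := ae_measurable_sub sub1 ae_measurable_weak_derivative.
set n := (fun t => `|u t| + `|A (u t)|) in ag.
have n0 r : 0 <= n r by rewrite addr_ge0.
have mJ : measurable (`[t, t + s]%classic : set R) by exact: measurable_itv.
have := ae_ge0_integralD mJ aw ag (fun r => normr_ge0 _) n0 => eq1.
have le1 : (\int[mu]_(r in `[t, (t + s)%R]) `|weak_derivative I u r|%:E +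
    \int[mu]_(r in `[t, (t + s)%R]) (n r)%:E <=
    \int[mu]_(r in `[t, (t + s)%R]) (MR_density I u r)%:E)%E by rewrite eq1.
set Phi := (\int[mu]_(t in _) (n t)%:E)%E in le1.
have [Phifin|Phifin] := ltP Phi +oo%E; last first.
  apply: le_trans le1; move: Phifin; rewrite leye_eq => /eqP ->.
  by rewrite addey ?leey// -ltNye (lt_le_trans (ltNyr 0))// integral_ge0.
have Phi0 : (0 <= Phi)%E by apply: integral_ge0 => r _; rewrite lee_fin.
have PhiE : Phi = (fine Phi)%:E by rewrite fineK// ge0_fin_numE.
apply/lee_addgt0Pr => e e0.
have [tau [t1 [t2 [domt hn]]]] : exists tau, t < tau /\ tau < t + s /\
    dom A (u tau) /\ s * n tau <= fine Phi + e.
  apply: contrapT => hno.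
  have [_ [hs _] _] := hu.
  have : {ae mu, forall r, `]t, (t + s)%R[%classic r -> ((fine Phi + e) / s)%:E <= (n r)%:E}%E.
    apply: (aeS (strongly_measurable_carrier hs)) => r hr rin.
    have Ir : I r.
      by apply: sub1; move: rin; rewrite /= !in_itv/= => /andP[/ltW -> /ltW ->].
    rewrite lee_fin ler_pdivrMr//.
    rewrite leNgt; apply/negP => hlt; apply: hno; exists r.
    move: rin; rewrite /= in_itv/= => /andP[r1 r2].
    by split => //; split => //; split; [exact: hr|rewrite mulrC ltW].
  have cst0 : (0 <= ((fine Phi + e) / s)%:E)%E.
    by rewrite lee_fin divr_ge0 ?(ltW s0)// addr_ge0 ?(ltW e0)// fine_ge0.
  have n0' r : `]t, (t + s)%R[%classic r -> (0 <= (n r)%:E)%E by rewrite lee_fin.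
  move=> hae; have := ge0_ae_le_integralW (fun _ _ => cst0) n0' hae.
  rewrite integral_cst_set; last exact: measurable_itv.
  have -> : mu `]t, (t + s)%R[%classic = s%:E.
    by rewrite lebesgue_measure_itv/= lte_fin ltrDl s0 -EFinB addrAC subrr add0r.
  rewrite -EFinM divfK ?gt_eqF//.
  move=> h; have : ((fine Phi + e)%:E <= Phi)%E.
    apply: (le_trans h); apply: le_integral_set; last by move=> r _; rewrite lee_fin.
    by move=> r; rewrite /= !in_itv/= => /andP[/ltW -> /ltW ->].
  by rewrite PhiE lee_fin leNgt ltrDl e0.
have hinc := increment_le It t1 (lt_trans t2 tsb).
apply: (@le_trans _ _ (`|u t - u tau|%:E + (s * n tau)%:E)%E).
  by rewrite -EFinD lee_fin; apply: K_le => //; exact: ltW.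
apply: (@le_trans _ _ (\int[mu]_(r in `[t, (t + s)%R]) `|weak_derivative I u r|%:E + (fine Phi + e)%:E)%E).
  apply: leeD; last by rewrite lee_fin.
  apply: (le_trans hinc); apply: le_integral_set => // r.
  by rewrite /= !in_itv/= => /andP[-> r2]; rewrite (le_trans r2)// ltW.
by rewrite EFinD -PhiE addeA; apply: leeD.
Qed.

Lemma Lp_K_quot_le t d : I t -> 0 < d -> t + d < b ->
  (Lp_of p `]0%R, d] (K_quot A (u t)) <=
    q%:E * Lp_of p `[t, (t + d)%R] (MR_density I u))%E.
Proof.
move=> It d0 tdb.
have sub1 := bi_sub_right bI It tdb.
pose k s := if 0 < s then K_functional A s (u t) else 0.
have k0 s : 0 <= k s by rewrite /k; case: ifP => // s0; rewrite K_ge0// ltW.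
have := @hardy R p q p1 q0 pq (MR_density I u) k t d d0
  (ae_measurable_sub sub1 ae_measurable_MR_density) (MR_density_ge0 I u) k0.
move=> h; have {}h := h _; have : (\int[mu]_(s in `]0%R, d]) ((k s / s) `^ p)%:E <=
    (q `^ p)%:E * \int[mu]_(x in `[t, (t + d)%R]) (MR_density I u x `^ p)%:E)%E.
  apply: h => s /andP[s0 sd]; rewrite /k s0; apply: K_functional_le => //.
  by apply: le_lt_trans tdb; rewrite lerD2l.
move=> {}h; rewrite /Lp_of.
have -> : (\int[mu]_(s in `]0%R, d]) (K_quot A (u t) s `^ p)%:E =
   \int[mu]_(s in `]0%R, d]) ((k s / s) `^ p)%:E)%E.
  apply: eq_integral => s; rewrite inE/= in_itv/= => /andP[s0 _].
  by rewrite /K_quot /k s0.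
apply: (@le_trans _ _ (((q `^ p)%:E * \int[mu]_(x in `[t, (t + d)%R])
    (MR_density I u x `^ p)%:E) `^ p^-1)%E).
  apply: gt0_ler_poweR => //.
  - by rewrite invr_ge0 ltW.
  - by rewrite in_itv/= leey andbT integral_ge0// => s _; rewrite lee_fin powR_ge0.
  - rewrite in_itv/= leey andbT mule_ge0// ?lee_fin ?powR_ge0//.
    by apply: integral_ge0 => s _; rewrite lee_fin powR_ge0.
rewrite poweRM ?lee_fin ?powR_ge0//; last first.
  by apply: integral_ge0 => s _; rewrite lee_fin powR_ge0.
by rewrite poweR_EFin -powRrM divff ?gt_eqF// powRr1 ?(ltW q0).
Qed.

(** [K d (u t)] dominates [min 1 d * `|u t|]; Hoelder's inequality bounds it. *)
Lemma norm_le_Lp_density t d : I t -> 0 < d -> t + d < b ->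
  ((Num.min 1 d * `|u t|)%:E <=
   (d `^ (1 - p^-1))%:E * Lp_of p `[t, (t + d)%R] (MR_density I u))%E.
Proof.
move=> It d0 tdb.
have sub1 := bi_sub_right bI It tdb.
apply: (@le_trans _ _ (K_functional A d (u t))%:E).
  by rewrite lee_fin; apply: K_ge_norm; exact: ltW.
apply: (le_trans (K_functional_le It d0 tdb)).
have muE : (mu `[t, (t + d)%R]%classic = d%:E)%E.
  by rewrite lebesgue_measure_itv/= lte_fin ltrDl d0 -EFinB addrC addKr.
have := @integral_le_Lp_of R p `[t, (t + d)%R]%classic (MR_density I u) p1 (measurable_itv _)
  _ (ae_measurable_sub sub1 ae_measurable_MR_density) (MR_density_ge0 I u).
by rewrite muE ltry poweR_EFin muleC; exact.
Qed.

End FixedFunction.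

(** The constant only depends on the room [d] to the right of [t]. It is the
    part [s <= d] of the interpolation norm that the density controls. *)
Lemma trace_le d : 0 < d -> exists C, 0 < C /\
  forall a b I u t, bounded_interval a b I -> in_MR A p I u -> I t -> t + d < b ->
    (Xp_norm A p (u t) <= C%:E * Lp_of p I (MR_density I u))%E.
Proof.
move=> d0; have [c [c0 hc]] := Xp_norm_split A p1 d0.
have m0 : 0 < Num.min 1 d by rewrite lt_min ltr01.
pose C := q + c / Num.min 1 d * d `^ (1 - p^-1).
have C2 : 0 <= c / Num.min 1 d * d `^ (1 - p^-1).
  by rewrite mulr_ge0 ?powR_ge0// divr_ge0// ltW.
exists C; split; first by rewrite ltr_pwDl.
move=> a b I u t bI hu It tdb; apply: (le_trans (hc _)).
have sub1 := bi_sub_right bI It tdb.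
have le0 := @le_Lp_of_set R p _ _ (MR_density I u) p0 sub1.
have L0 := Lp_of_ge0 p I (MR_density I u).
rewrite /C EFinD ge0_muleDl ?lee_fin ?(ltW q0)//; apply: leeD.
  apply: (le_trans (Lp_K_quot_le bI hu It d0 tdb)).
  by apply: lee_wpmul2l => //; rewrite lee_fin ltW.
have h := norm_le_Lp_density bI hu It d0 tdb.
have -> : c * `|u t| = c / Num.min 1 d * (Num.min 1 d * `|u t|).
  by rewrite mulrA divfK// gt_eqF.
rewrite EFinM [in leRHS]EFinM -muleA; apply: lee_wpmul2l.
  by rewrite lee_fin divr_ge0// ltW.
apply: (le_trans h); apply: lee_wpmul2l => //.
by rewrite lee_fin powR_ge0.
Qed.

(** Near [0] the integrand of the interpolation norm is uniformly small, by
    Hardy's inequality and the absolute continuity of the integral; away from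
    [0] it is controlled by the continuity in [X]. *)
Lemma trace_continuous a b I u t (e : R) : bounded_interval a b I -> in_MR A p I u ->
  I t -> t < b -> 0 < e -> exists eta, 0 < eta /\ forall t', I t' -> `|t' - t| < eta ->
    (Xp_norm A p (u t' - u t)%R <= e%:E)%E.
Proof.
move=> bI hu It tb e0; have mI := bi_measurable bI.
pose e1 := e / (4 * q); have e10 : 0 < e1 by rewrite divr_gt0// mulr_gt0.
have e1p : 0 < e1 `^ p by rewrite powR_gt0.
have aG : ae_measurable I (fun r => MR_density I u r `^ p).
  apply: (@ae_measurable_comp _ _ _ (fun z : R => z `^ p)); first exact: measurable_powR.
  exact: ae_measurable_MR_density.
have [d1 [d10 hd1]] := integral_absolutely_continuous mI aG (fun r => powR_ge0 _ _)
  (MR_density_integrable bI hu) e1p.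
pose d := Num.min d1 ((b - t) / 4).
have bt0 : 0 < b - t by rewrite subr_gt0.
have d0 : 0 < d by rewrite lt_min d10 divr_gt0.
have dd1 : d <= d1 by rewrite ge_min lexx.
have db : d <= (b - t) / 4 by rewrite ge_min lexx orbT.
have [c [c0 hc]] := Xp_norm_split A p1 d0.
have [_ _ ] := hu => /subspace_continuousP/(_ t It)/cvgrPdist_lt.
have e2 : 0 < e / (2 * c) by rewrite divr_gt0// mulr_gt0.
move=> /(_ _ e2) cu.
have [z /= z0 hz] : \forall z \near t, I z -> `|u t - u z| < e / (2 * c) by [].
exists (Num.min z ((b - t) / 4)); split; first by rewrite lt_min z0 divr_gt0.
move=> t' It'; rewrite lt_min => /andP[h1 h2].
have t'b : t' + d < b.
  move: h2; rewrite ltr_norml => /andP[_ h2].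
  lra.
have tdb : t + d < b by lra.
have small r : I r -> r + d < b ->
    (Lp_of p `]0%R, d] (K_quot A (u r)) <= (e / 4)%:E)%E.
  move=> Ir rdb; apply: (le_trans (Lp_K_quot_le bI hu Ir d0 rdb)).
  have -> : e / 4 = q * e1 by rewrite /e1; field; exact: lt0r_neq0.
  rewrite EFinM; apply: lee_wpmul2l; first by rewrite lee_fin ltW.
  have sub1 := bi_sub_right bI Ir rdb.
  have muE : (mu `[r, (r + d)%R]%classic = d%:E)%E.
    by rewrite lebesgue_measure_itv/= lte_fin ltrDl d0 -EFinB addrC addKr.
  have := hd1 _ (measurable_itv _) sub1; rewrite muE lee_fin => /(_ dd1) h.
  by apply: Lp_of_le_powR => //; exact: ltW.
apply: (le_trans (hc _)).
have -> : e%:E = ((e / 4)%:E + (e / 4)%:E + (e / 2)%:E)%E.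
  by rewrite -!EFinD; congr (_%:E); field.
apply: leeD.
  apply: (@le_trans _ _ (Lp_of p `]0%R, d] (K_quot A (u t')) +
     Lp_of p `]0%R, d] (K_quot A (- u t)%R))%E).
    apply: Lp_of_D; rewrite ?ltW//.
    - by apply: ae_measurable_fun_eq; exact: measurable_K_quot.
    - by apply: ae_measurable_fun_eq; exact: measurable_K_quot.
    - exact: K_quot_ge0.
    - exact: K_quot_ge0.
    - by apply: nearW => s _; rewrite K_quot_ge0 K_quotD.
  apply: leeD; first exact: small.
  apply: le_trans (small t It tdb); apply: le_Lp_of => //; apply: nearW => s _.
  by rewrite K_quot_ge0/= -scaleN1r (le_trans (K_quotZ _ _ _ _))// normrN1 mul1r.
rewrite lee_fin; have := hz t' _ It'; rewrite /ball/= distrC => /(_ h1) hlt.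
have -> : e / 2 = c * (e / (2 * c)) by field; exact: lt0r_neq0.
by rewrite ler_wpM2l ?(ltW c0)// distrC ltW.
Qed.

End Trace.

(** * Solutions of the linear equation *)

Opaque integral lebesgue_measure poweR.

Section LinearSolutions.
Context (R : realType) (X : completeNormedModType R) (A : linear_operator X) (p t0 : R).
Hypothesis p1 : 1 < p.
Local Notation mu := (@lebesgue_measure R).
Local Notation DA := (graph_space A).
Local Notation W := (whole X).
Implicit Types (x y : X) (s d c t a b S : R) (I J : set R) (u v h : R -> X).

Let p0 : 0 < p. Proof. exact: lt_trans p1. Qed.

Lemma Lp_normE (Y : normed_sub X) I u :
  Lp_norm Y p I u = Lp_of p I (fun t => snorm Y (u t)).
Proof. by []. Qed.

Lemma eq_Lp_norm (Y : normed_sub X) I u v : {ae mu, forall t, I t -> u t = v t} ->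
  Lp_norm Y p I u = Lp_norm Y p I v.
Proof.
by move=> e; rewrite !Lp_normE; apply: eq_Lp_of p0 _; apply: (aeS e) => t h /h ->.
Qed.

Lemma in_Lp_ae (Y : normed_sub X) I u v : {ae mu, forall t, I t -> u t = v t} ->
  in_Lp Y p I u -> in_Lp Y p I v.
Proof.
move=> e [mf ff]; split; first exact: strongly_measurable_ae mf.
by rewrite -(eq_Lp_norm Y e).
Qed.

Lemma in_Lp_sub (Y : normed_sub X) I J u : J `<=` I -> in_Lp Y p I u -> in_Lp Y p J u.
Proof.
move=> JI [mf ff]; split; first exact: strongly_measurable_sub mf.
by apply: le_lt_trans ff; exact: le_Lp_of_set.
Qed.

Lemma in_LpD (Y : normed_sub X) I u v : seminormed_subspace Y -> measurable I ->
  in_Lp Y p I u -> in_Lp Y p I v -> in_Lp Y p I (fun t => u t + v t).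
Proof.
move=> HY mI [mf ff] [mg fg]; split; first exact: strongly_measurableD.
rewrite Lp_normE; apply: le_lt_trans (lte_add_pinfty ff fg).
apply: Lp_of_D; rewrite ?ltW//.
- exact: strongly_measurable_snorm.
- exact: strongly_measurable_snorm.
- by move=> t; exact: snorm_ge0.
- by move=> t; exact: snorm_ge0.
- apply: (aeS2 (strongly_measurable_carrier mf) (strongly_measurable_carrier mg)) => t h1 h2 It.
  by rewrite snorm_ge0// snormD//; [exact: h1|exact: h2].
Qed.

Lemma in_LpN (Y : normed_sub X) I u : seminormed_subspace Y ->
  in_Lp Y p I u -> in_Lp Y p I (fun t => - u t).
Proof.
move=> HY [mf ff]; split.
  apply: strongly_measurable_ae (strongly_measurableZ HY (-1) mf).
  by apply: nearW => t _; rewrite scaleN1r.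
apply: le_lt_trans ff; apply: le_Lp_of => //.
apply: (aeS (strongly_measurable_carrier mf)) => t h It.
by rewrite snorm_ge0// (snormN HY) ?lexx//; exact: h.
Qed.

Lemma in_LpB (Y : normed_sub X) I u v : seminormed_subspace Y -> measurable I ->
  in_Lp Y p I u -> in_Lp Y p I v -> in_Lp Y p I (fun t => u t - v t).
Proof. by move=> HY mI hu hv; exact: in_LpD HY mI hu (in_LpN HY hv). Qed.

Lemma in_MR_sub a b c d I J u : bounded_interval a b I -> bounded_interval c d J ->
  J `<=` I -> in_MR A p I u -> in_MR A p J u /\
  {ae mu, forall t, J t -> weak_derivative I u t = weak_derivative J u t}.
Proof.
move=> bI bJ JI [[h1 h2 h3] h4 h5].
have w := is_weak_derivative_sub (bi_measurable bI) (bi_measurable bJ) (bi_finite bI) JI h2.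
have w' := weak_derivativeP w.
have e := is_weak_derivative_unique bJ w w'.
split; last exact: e.
split; [split| |].
- exact: in_Lp_sub h1.
- exact: w'.
- by apply: in_Lp_ae e _; exact: in_Lp_sub h3.
- exact: in_Lp_sub h4.
- exact: continuous_subspaceW h5.
Qed.

Lemma MR_norm_sub a b c d I J u : bounded_interval a b I -> bounded_interval c d J ->
  J `<=` I -> in_MR A p I u -> (MR_norm A p J u <= MR_norm A p I u)%E.
Proof.
move=> bI bJ JI hu; have [_ e] := in_MR_sub bI bJ JI hu.
apply: leeD; first exact: le_Lp_of_set.
apply: leeD; first exact: le_Lp_of_set.
apply: (@le_trans _ _ (Lp_norm W p J (weak_derivative I u))); last exact: le_Lp_of_set.
apply: le_Lp_of => //; apply: (aeS e) => t h /h hE.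
by rewrite /= hE normr_ge0 lexx.
Qed.

Lemma MR_norm_ext J u v : (forall t, J t -> u t = v t) ->
  MR_norm A p J u = MR_norm A p J v.
Proof.
move=> e; rewrite /MR_norm /W1p_norm (weak_derivative_ext e).
have e' : {ae mu, forall t, J t -> u t = v t} by apply: nearW.
by rewrite (eq_Lp_norm DA e') (eq_Lp_norm W e').
Qed.

Lemma in_MRB a b I u v : bounded_interval a b I -> in_MR A p I u -> in_MR A p I v ->
  in_MR A p I (fun t => u t - v t) /\
  {ae mu, forall t, I t -> weak_derivative I u t - weak_derivative I v t =
                           weak_derivative I (fun t => u t - v t) t}.
Proof.
move=> bI [[h1 h2 h3] h4 h5] [[k1 k2 k3] k4 k5].
have mI := bi_measurable bI.
have w := is_weak_derivativeB mI h2 k2; have w' := weak_derivativeP w.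
have e := is_weak_derivative_unique bI w w'.
split; last exact: e.
have HW := @whole_seminormed R X.
split; [split| |].
- exact: in_LpB.
- exact: w'.
- by apply: in_Lp_ae e _; exact: in_LpB.
- by apply: in_LpB => //; exact: graph_seminormed.
- by move=> t; apply: cvgB; [exact: h5|exact: k5].
Qed.

Record mr_solution I h u : Prop := MRSolution {
  mrs_in : in_MR A p I u;
  mrs_eq : {ae mu, forall t, I t -> weak_derivative I u t + A (u t) = h t} }.

Lemma mr_solution_sub a b c d I J h u : bounded_interval a b I ->
  bounded_interval c d J -> J `<=` I -> mr_solution I h u -> mr_solution J h u.
Proof.
move=> bI bJ JI [hu e]; have [hu' e'] := in_MR_sub bI bJ JI hu; split => //.
by apply: (aeS2 e e') => t h1 h2 Jt; rewrite -h2// h1//; exact: JI.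
Qed.

Lemma mr_solution_ae I h h' u : {ae mu, forall t, I t -> h t = h' t} ->
  mr_solution I h u -> mr_solution I h' u.
Proof. by move=> e [hu e']; split => //; apply: (aeS2 e e') => t h1 h2 It; rewrite -h1// h2. Qed.

Lemma mr_solutionB a b I h k u v : bounded_interval a b I ->
  mr_solution I h u -> mr_solution I k v ->
  mr_solution I (fun t => h t - k t) (fun t => u t - v t).
Proof.
move=> bI [hu eu] [hv ev]; have [huv e] := in_MRB bI hu hv; split => //.
have [_ [mu1 _] _] := hu; have [_ [mv1 _] _] := hv.
have domuv : {ae mu, forall t, I t -> A (u t - v t) = A (u t) - A (v t)}.
  apply: (aeS2 (strongly_measurable_carrier mu1) (strongly_measurable_carrier mv1)).
  move=> t h1 h2 It.
  have du : dom A (u t) := h1 It; have dv : dom A (v t) := h2 It.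
  have dv' : dom A (- v t) by rewrite -scaleN1r; exact: domZ.
  by rewrite appD// -[in LHS]scaleN1r appZ// scaleN1r.
apply: (aeS2 (aeS2 domuv e (fun t => @conj _ _)) (aeS2 eu ev (fun t => @conj _ _))).
by move=> t [h1 h4] [h2 h3] It; rewrite -h4// h1// -h2// -h3// opprD addrACA.
Qed.

Lemma mr_solution_rhs a b I h u : bounded_interval a b I -> mr_solution I h u ->
  in_Lp W p I h.
Proof.
move=> bI [[[_ _ hw] [hu fu] _] e]; apply: in_Lp_ae e _.
apply: (in_LpD (@whole_seminormed R X) (bi_measurable bI) hw).
split; first exact: strongly_measurable_app.
apply: le_lt_trans fu; apply: le_Lp_of => //; apply: nearW => t _.
by rewrite /= normr_ge0 lerDr normr_ge0.
Qed.

Lemma icoE S : ico t0 S%:E = `[t0, t0 + S[%classic.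
Proof.
apply/seteqP; split => t; rewrite /ico/= in_itv/= -EFinD lte_fin.
  by move=> [-> ->].
by move=> /andP[].
Qed.

Lemma bi_ico S : bounded_interval t0 (t0 + S) (ico t0 S%:E).
Proof.
rewrite icoE; split; first exact: measurable_itv.
- by move=> t; rewrite /= !in_itv/= => /andP[/ltW -> ->].
- by move=> t; rewrite /= !in_itv/= => /andP[-> /ltW ->].
Qed.

Lemma bi_itvcc a b : bounded_interval a b `[a, b]%classic.
Proof.
split; [exact: measurable_itv| |by []].
by move=> t; rewrite /= !in_itv/= => /andP[/ltW -> /ltW ->].
Qed.

Lemma ico_sub S S' : S <= S' -> ico t0 S%:E `<=` ico t0 S'%:E.
Proof.
move=> SS'; rewrite !icoE => t; rewrite /= !in_itv/= => /andP[-> h].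
by rewrite (lt_le_trans h)// lerD2l.
Qed.

Lemma ico_start S : 0 < S -> ico t0 S%:E t0.
Proof. by move=> S0; rewrite icoE/= in_itv/= lexx ltrDl. Qed.

Lemma in_MR_Xp S u t : in_MR A p (ico t0 S%:E) u -> ico t0 S%:E t -> Xp A p (u t).
Proof.
move=> hu It; have tS : t < t0 + S by move: It; rewrite icoE/= in_itv/= => /andP[].
have d0 : 0 < (t0 + S - t) / 2 by rewrite divr_gt0// subr_gt0.
have [C [C0 hC]] := trace_le A p1 d0.
have tb : t + (t0 + S - t) / 2 < t0 + S by lra.
apply: (le_lt_trans (hC _ _ _ _ _ (bi_ico S) hu It tb)).
have h := le_lt_trans (Lp_MR_density p1 (bi_ico S) hu) (MR_norm_fin hu).
by rewrite lte_mul_pinfty// lee_fin ltW.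
Qed.

Lemma strongly_measurable_extend I J h : measurable J -> J `<=` I ->
  strongly_measurable W J h -> strongly_measurable W I (fun t => (\1_J t : R) *: h t).
Proof.
move=> mJ JI [s [hs e]]; exists (fun k => restrict_simple J (s k)); split.
  by move=> k; exact: is_simple_restrict.
apply: (aeS e) => t h1 It; split => //=.
have [Jt|nJt] := pselect (J t); last first.
  rewrite indicE memNset// scale0r.
  under eq_fun do rewrite simple_fun_restrict indicE memNset// scale0r subrr normr0.
  exact: cvg_cst.
have [_] := h1 Jt.
have e2 k : simple_fun (restrict_simple J (s k)) t - (\1_J t : R) *: h t =
    simple_fun (s k) t - h t.
  by rewrite simple_fun_restrict indicE mem_set// !scale1r.
by under [in X in _ -> X]eq_fun do rewrite e2.
Qed.

Lemma Lp_of_indic I J h : J `<=` I ->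
  Lp_of p I (fun t => `|(\1_J t : R) *: h t|) = Lp_of p J (fun t => `|h t|).
Proof.
move=> JI; rewrite /Lp_of (integral_sub0 JI); last first.
  by move=> t _ nJt; rewrite indicE memNset// scale0r normr0 powR0// gt_eqF.
apply: (congr1 (fun z => (z `^ p^-1)%E)).
by apply: eq_integral => t Jt; rewrite indicE Jt scale1r.
Qed.

Section MaximalRegularity.
Hypothesis hMR : maximal_regularity A p t0.

Lemma mr_solution_unique S h u v : 0 < S -> mr_solution (ico t0 S%:E) h u ->
  mr_solution (ico t0 S%:E) h v -> u t0 = v t0 ->
  forall t, ico t0 S%:E t -> u t = v t.
Proof.
move=> S0 hu hv uv0 t It; have [C [C0 hC]] := hMR S0.
have hh := mr_solution_rhs (bi_ico S) hu.
have [w [_ hw _]] := hC h (u t0) hh (in_MR_Xp (mrs_in hu) (ico_start S0)).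
have -> : u t = w t by apply: (hw u _ t It); case: hu.
by symmetry; apply: (hw v _ t It); case: hv.
Qed.

Lemma mr_solution_exists S : 0 < S -> exists C : R, 0 < C /\
  forall h x, in_Lp W p (ico t0 S%:E) h -> Xp A p x ->
  exists u, [/\ mr_solution (ico t0 S%:E) h u, u t0 = x &
    (MR_norm A p (ico t0 S%:E) u <=
     C%:E * (Xp_norm A p x + Lp_norm W p (ico t0 S%:E) h))%E].
Proof.
move=> S0; have [C [C0 hC]] := hMR S0; exists C; split => // h x hh hx.
by have [u [[h1 h2 h3] _ h4]] := hC h x hh hx; exists u; split.
Qed.

(** By causality the value at [t] is that of the solution whose right-hand side
    is cut off after [t]; solving on a longer interval leaves room for the
    trace estimate to the right of [t]. *)
Lemma mr_solution_trace S : 0 < S -> exists C : R, 0 < C /\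
  forall h u t, mr_solution (ico t0 S%:E) h u -> ico t0 S%:E t ->
    (Xp_norm A p (u t) <=
     C%:E * (Xp_norm A p (u t0) + Lp_of p `[t0, t] (fun s => `|h s|%R)))%E.
Proof.
move=> S0; have S20 : 0 < 2 * S by rewrite mulr_gt0.
have [C1 [C10 hC1]] := mr_solution_exists S20.
have [C2 [C20 hC2]] := trace_le A p1 (divr_gt0 S0 (ltr0n R 2)).
exists (C2 * C1); split; first exact: mulr_gt0.
move=> h u t hu It.
have tE := It; rewrite icoE/= in_itv/= in tE; have /andP[t0t tS] := tE.
have JS : `[t0, t] `<=` ico t0 S%:E.
  by rewrite icoE => s; rewrite /= !in_itv/= => /andP[-> h2]; rewrite (le_lt_trans h2).
have SS : ico t0 S%:E `<=` ico t0 (2 * S)%:E by apply: ico_sub; lra.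
have J2S : `[t0, t] `<=` ico t0 (2 * S)%:E by apply: subset_trans SS.
have mJ : measurable (`[t0, t]%classic : set R) by exact: measurable_itv.
have [mh fh] := in_Lp_sub JS (mr_solution_rhs (bi_ico S) hu).
pose h' s := (\1_`[t0, t] s : R) *: h s.
have hh' : in_Lp W p (ico t0 (2 * S)%:E) h'.
  split; first exact: strongly_measurable_extend.
  by rewrite Lp_normE Lp_of_indic.
have [v [hv v0 vn]] := hC1 h' (u t0) hh' (in_MR_Xp (mrs_in hu) (ico_start S0)).
have uv : u t = v t.
  have [<-//|tt0] := eqVneq t0 t; have {}tt0 : t0 < t by rewrite lt_neqAle tt0.
  have uvs s : ico t0 (t - t0)%:E s -> u s = v s.
    have sb : ico t0 (t - t0)%:E `<=` ico t0 S%:E by apply: ico_sub; lra.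
    have d0 : 0 < t - t0 by rewrite subr_gt0.
    move: s; apply: (mr_solution_unique d0 (h := h)); last by rewrite v0.
      exact: mr_solution_sub (bi_ico S) (bi_ico _) sb hu.
    apply: (@mr_solution_ae _ h'); last first.
      by apply: mr_solution_sub (bi_ico (2 * S)) (bi_ico _) _ hv; exact: subset_trans SS.
    apply: nearW => r; rewrite icoE/= in_itv/= => /andP[r1 r2].
    rewrite /h' indicE mem_set ?scale1r//= in_itv/= r1/= ltW//.
    by move: r2; rewrite addrC subrK.
  have cu : {for t, continuous u}.
    by apply: (bi_continuous (bi_ico S) (mrs_in hu)); rewrite /= in_itv/= tt0.
  have cv : {for t, continuous v}.
    apply: (bi_continuous (bi_ico (2 * S)) (mrs_in hv)); rewrite /= in_itv/= tt0/=.
    by apply: (lt_trans tS); lra.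
  apply: (@cvg_unique _ _ (u @ t^'-)); first exact: norm_hausdorff.
    exact: cvg_at_left_filter.
  have cv' : v @ t^'- --> v t by exact: cvg_at_left_filter.
  apply: cvg_trans cv'; apply: near_eq_cvg; near=> s.
  symmetry; apply: uvs; rewrite icoE/= in_itv/= addrC subrK; apply/andP; split.
    by near: s; apply: nbhs_left_ge.
  by near: s; exact: nbhs_left_lt.
rewrite uv; have It2 := SS _ It.
apply: (le_trans (hC2 _ _ _ _ _ (bi_ico (2 * S)) (mrs_in hv) It2 _)); first by lra.
rewrite [in leRHS]EFinM -muleA; apply: lee_wpmul2l; first by rewrite lee_fin ltW.
apply: (le_trans (Lp_MR_density p1 (bi_ico (2 * S)) (mrs_in hv))).
by move: vn; rewrite Lp_normE (Lp_of_indic h J2S).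
Unshelve. all: by end_near. Qed.

Lemma mr_solution_norm S : 0 < S -> exists C : R, 0 < C /\
  forall h u, mr_solution (ico t0 S%:E) h u ->
    (MR_norm A p (ico t0 S%:E) u <=
     C%:E * (Xp_norm A p (u t0) + Lp_of p (ico t0 S%:E) (fun s => `|h s|%R)))%E.
Proof.
move=> S0; have [C [C0 hC]] := mr_solution_exists S0; exists C; split => // h u hu.
have hh := mr_solution_rhs (bi_ico S) hu.
have [v [hv v0 vn]] := hC h (u t0) hh (in_MR_Xp (mrs_in hu) (ico_start S0)).
by rewrite (@MR_norm_ext _ u v)//; apply: mr_solution_unique hu hv _.
Qed.

End MaximalRegularity.

End LinearSolutions.

(** * Extended norms *)

Section ExtendedNorm.
Context (R : realType) (X : completeNormedModType R).
Implicit Types (x y : X) (r c : R).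

(** The semilinear theory below only sees the interpolation space through
    these properties of its norm. *)
Record extended_norm (N : X -> \bar R) : Prop := ExtendedNorm {
  en_ge0 : forall x, (0 <= N x)%E;
  en_D : forall x y, (N (x + y)%R <= N x + N y)%E;
  en_Z : forall c x, (N (c *: x)%R <= `|c|%:E * N x)%E;
  en_norm : forall x, (`|x|%:E <= 2%:E * N x)%E;
  en_lsc : forall (u : nat -> X) x (M : R), u @ \oo --> x ->
    (forall n, (N (u n) <= M%:E)%E) -> (N x <= M%:E)%E }.

Variable N : X -> \bar R.
Hypothesis HN : extended_norm N.

Definition finN x := (N x < +oo)%E.

Definition Xn x : R := fine (N x).

Lemma Xn_ge0 x : 0 <= Xn x.
Proof. by rewrite fine_ge0// en_ge0. Qed.

Lemma XnE x : finN x -> N x = (Xn x)%:E.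
Proof. by move=> h; rewrite fineK// ge0_fin_numE// en_ge0. Qed.

Lemma le_Xn x r : (N x <= r%:E)%E -> finN x /\ Xn x <= r.
Proof.
move=> h; have hx : finN x by apply: le_lt_trans h _; exact: ltry.
by split => //; rewrite -lee_fin -XnE.
Qed.

Lemma N0 : N 0 = 0%E.
Proof.
apply/eqP; rewrite eq_le en_ge0// andbT -(scale0r (0 : X)).
by apply: (le_trans (en_Z HN _ _)); rewrite normr0 mul0e.
Qed.

Lemma fin0 : finN 0.
Proof. by rewrite /finN N0 ltry. Qed.

Lemma finD x y : finN x -> finN y -> finN (x + y).
Proof.
by move=> hx hy; apply: le_lt_trans (en_D HN x y) _; rewrite !XnE// -EFinD ltry.
Qed.

Lemma finZ c x : finN x -> finN (c *: x).
Proof.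
by move=> hx; apply: le_lt_trans (en_Z HN c x) _; rewrite XnE// -EFinM ltry.
Qed.

Lemma finB x y : finN x -> finN y -> finN (x - y).
Proof. by move=> hx hy; rewrite -scaleN1r; apply: finD => //; exact: finZ. Qed.

Lemma N_BC x y : N (x - y) = N (y - x).
Proof.
have le z : (N (- z)%R <= N z)%E.
  by rewrite -scaleN1r; apply: (le_trans (en_Z HN _ _)); rewrite normrN1 mul1e.
by apply/eqP; rewrite eq_le -{1}opprB le -opprB le.
Qed.

Lemma N_B x y : (N (x - y)%R <= N x + N y)%E.
Proof.
by apply: (le_trans (en_D HN _ _)); rewrite -[(- y)%R]sub0r N_BC subr0.
Qed.

Lemma XnD x y : finN x -> finN y -> Xn (x + y) <= Xn x + Xn y.
Proof.
move=> hx hy; rewrite -lee_fin EFinD -(XnE hx) -(XnE hy) -(XnE (finD hx hy)).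
exact: en_D.
Qed.

Lemma XnZ c x : finN x -> Xn (c *: x) <= `|c| * Xn x.
Proof.
move=> hx; rewrite -lee_fin EFinM -(XnE hx) -(XnE (finZ c hx)).
exact: en_Z.
Qed.

Lemma XnBC x y : Xn (x - y) = Xn (y - x).
Proof. by rewrite /Xn N_BC. Qed.

Lemma N_le_dist x y : (N y <= N x + N (x - y)%R)%E.
Proof. by rewrite N_BC -{1}(subrK x y) addrC en_D. Qed.

Lemma Xn_le_dist x y : finN x -> finN y -> Xn y <= Xn x + Xn (x - y).
Proof.
move=> hx hy; rewrite -lee_fin EFinD -(XnE hx) -(XnE hy) -(XnE (finB hx hy)).
exact: N_le_dist.
Qed.

Lemma N_eq0 x y : N (x - y) = 0%E -> x = y.
Proof.
move=> e; apply/eqP; rewrite -subr_eq0 -normr_le0 -lee_fin.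
by apply: (le_trans (en_norm HN _)); rewrite e mule0.
Qed.

(** The radial retraction onto the ball of radius [r]. *)
Definition radial r x : X := if Xn x <= r then x else (r / Xn x) *: x.

Lemma radial_fin r x : finN x -> finN (radial r x).
Proof. by move=> hx; rewrite /radial; case: ifP => // _; exact: finZ. Qed.

Lemma radial_id r x : Xn x <= r -> radial r x = x.
Proof. by rewrite /radial => ->. Qed.

Lemma radial_le r x : 0 < r -> finN x -> (N (radial r x) <= r%:E)%E.
Proof.
move=> r0 hx; rewrite (XnE (radial_fin r hx)) lee_fin /radial.
case: ifPn => //; rewrite -ltNge => h; have n0 := lt_trans r0 h.
apply: le_trans (XnZ _ hx) _; rewrite ger0_norm ?divr_ge0 ?(ltW r0) ?(ltW n0)//.
by rewrite divfK// gt_eqF.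
Qed.

Lemma radial_lipschitz r x y : 0 < r -> finN x -> finN y ->
  Xn (radial r x - radial r y) <= 2 * Xn (x - y).
Proof.
move=> r0.
wlog xy : x y / Xn x <= Xn y.
  move=> h; have [xy|/ltW yx] := leP (Xn x) (Xn y); first exact: h.
  by move=> hx hy; rewrite XnBC (XnBC x); exact: h.
move=> hx hy; have d0 := Xn_ge0 (x - y); have hxy := finB hx hy.
have dist := Xn_le_dist hx hy.
rewrite /radial; case: ifPn => hxr; case: ifPn => hyr.
- by rewrite ler_peMl// ler1n.
- move: hyr; rewrite -ltNge => hyr; have ny0 := lt_trans r0 hyr.
  have -> : x - (r / Xn y) *: y = (x - y) + (1 - r / Xn y) *: y.
    by rewrite scalerBl scale1r addrA subrK.
  apply: (le_trans (XnD hxy (finZ _ hy))).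
  have q1 : r / Xn y <= 1 by rewrite ler_pdivrMr// mul1r ltW.
  have := XnZ (1 - r / Xn y) hy; rewrite ger0_norm ?subr_ge0// mulrBl mul1r divfK ?gt_eqF//.
  by move=> h; lra.
- by move: hxr; rewrite (le_trans xy).
move: hxr; rewrite -ltNge => hxr; have nx0 := lt_trans r0 hxr.
have ny0 := lt_le_trans nx0 xy.
have -> : (r / Xn x) *: x - (r / Xn y) *: y =
    (r / Xn x) *: (x - y) + (r / Xn x - r / Xn y) *: y.
  by rewrite scalerBr scalerBl addrA subrK.
apply: (le_trans (XnD (finZ _ hxy) (finZ _ hy))).
have q1 : r / Xn x <= 1 by rewrite ler_pdivrMr// mul1r ltW.
have q0 : 0 <= r / Xn x by rewrite divr_ge0// ltW.
have h1 := XnZ (r / Xn x) hxy; rewrite ger0_norm// in h1.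
have h2 := XnZ (r / Xn x - r / Xn y) hy.
rewrite ger0_norm in h2; last first.
  by rewrite subr_ge0 ler_wpM2l ?(ltW r0)// lef_pV2.
have e : (r / Xn x - r / Xn y) * Xn y = (r / Xn x) * (Xn y - Xn x).
  by field; rewrite !gt_eqF.
rewrite e in h2.
have h3 : r / Xn x * (Xn y - Xn x) <= Xn y - Xn x by rewrite ler_piMl// subr_ge0.
have h4 : r / Xn x * Xn (x - y) <= Xn (x - y) by rewrite ler_piMl.
by lra.
Qed.

End ExtendedNorm.

(** * Exponential weights *)

Section Weights.
Context (R : realType) (p t0 : R).
Hypothesis p1 : 1 < p.
Local Notation mu := (@lebesgue_measure R).
Implicit Types (I J : set R) (L d : R -> R).

Let p0 : 0 < p. Proof. exact: lt_trans p1. Qed.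

Definition weight (l s : R) : R := expR (l * (s - t0)).

Lemma weight_ge1 l s : 0 <= l -> t0 <= s -> 1 <= weight l s.
Proof. by move=> l0 ts; rewrite -expR0 ler_expR mulr_ge0// subr_ge0. Qed.

Lemma weight_le l s t : 0 <= l -> s <= t -> weight l s <= weight l t.
Proof. by move=> l0 st; rewrite ler_expR ler_wpM2l// lerD2r. Qed.

Lemma continuous_weight l : continuous (weight l).
Proof.
move=> x; apply: continuous_comp; last exact: continuous_expR.
by apply: cvgMl_tmp; apply: cvgB; [exact: cvg_id|exact: cvg_cst].
Qed.

Lemma measurable_weight l : measurable_fun setT (weight l).
Proof. by apply: continuous_measurable_fun; exact: continuous_weight. Qed.

Lemma is_derive_weight l x :
  is_derive x (1 : R) (fun s => l^-1 * weight l s) (l^-1 * (l * weight l x)).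
Proof.
have hw : is_derive x (1 : R) (weight l) (l * weight l x).
  rewrite (_ : weight l = fun z => expR (l * z + - (l * t0))); last first.
    by apply/funext => z; rewrite /weight mulrBr.
  have := is_derive_comp_affine (is_derive_expR (l * x + - (l * t0))).
  by rewrite (mulrC l (expR _)).
exact: is_deriveZ.
Qed.

Lemma integral_weight l t : 0 < l -> t0 <= t ->
  (\int[mu]_(s in `[t0, t]) (weight l s)%:E <= (weight l t / l)%:E)%E.
Proof.
move=> l0; rewrite le_eqVlt => /predU1P[<-|t0t].
  by rewrite set_itv1 integral_set1// lee_fin divr_ge0 ?expR_ge0// ltW.
have der x : derivable (fun s => l^-1 * weight l s) x 1 by have [] := is_derive_weight l x.
have cw : continuous (fun s => l^-1 * weight l s).
  by move=> x; apply: cvgMl_tmp; exact: continuous_weight.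
rewrite (@continuous_FTC2 _ _ (fun s => l^-1 * weight l s)); last 4 first.
- by [].
- by apply: continuous_subspaceT; exact: continuous_weight.
- split; first by move=> x _; exact: der.
  + by apply: cvg_at_right_filter; exact: cw.
  + by apply: cvg_at_left_filter; exact: cw.
- move=> x _; rewrite derive1E; have [_ ->] := is_derive_weight l x.
  by rewrite mulrA mulVf ?mul1r// gt_eqF.
by rewrite -EFinB lee_fin mulrC gerBl mulr_ge0 ?expR_ge0// invr_ge0 ltW.
Qed.

(** [L] is bounded up to a part that is small in [L^p]; on the bounded part a
    large [l] makes the factor small. *)
Lemma Lp_of_weight I (L : R -> R) (c : R) : measurable I -> ae_measurable I L ->
  (forall s, 0 <= L s) -> (Lp_of p I L < +oo)%E -> 0 < c ->
  exists l : R, 0 < l /\ forall t J, t0 <= t -> measurable J -> J `<=` I ->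
    J `<=` `[t0, t] ->
    (Lp_of p J (fun s => L s * weight l s)%R <= (c * weight l t)%:E)%E.
Proof.
move=> mI aL L0 fL c0; have c20 : 0 < c / 2 by rewrite divr_gt0.
set e := (c / 2) `^ p; have e0 : 0 < e by rewrite powR_gt0.
have aG : ae_measurable I (fun s => L s `^ p).
  exact: (@ae_measurable_comp _ _ _ (fun z : R => z `^ p)) (measurable_powR _) aL.
have fG : (\int[mu]_(s in I) (L s `^ p)%:E < +oo)%E.
  rewrite ltey; apply/eqP => eq; move: fL; rewrite /Lp_of eq.
  by rewrite poweRyr ?ltxx// gt_eqF// invr_gt0.
have [M [M0 hM]] := integral_tail mI aG (fun s => powR_ge0 _ _) fG e0.
(* [M] is the bound of [L `^ p] on the bounded part, and [M / (p * l) = e] *)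
pose l := M / (p * e); have l0 : 0 < l by rewrite divr_gt0// mulr_gt0.
exists l; split => // t J t0t mJ JI Jt.
pose L1 s := if M < L s `^ p then L s else 0.
have L10 s : 0 <= L1 s by rewrite /L1; case: ifP.
have aL1 : ae_measurable J L1.
  apply: (@ae_measurable_comp _ _ _ (fun z : R => if M < z `^ p then z else 0)).
    apply: measurable_fun_ifT => //; apply: measurable_fun_ltr => //.
  exact: ae_measurable_sub JI aL.
pose m := M `^ p^-1; have m0 : 0 <= m by rewrite powR_ge0.
have mp : m `^ p = M by rewrite /m -powRrM mulVf ?gt_eqF// powRr1// ltW.
have LL1 s : L s <= L1 s + m.
  rewrite /L1; case: ltP => h; first by rewrite lerDl.
  rewrite add0r -[leLHS](_ : (L s `^ p) `^ p^-1 = _).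
    by rewrite /m; apply: ge0_ler_powR; rewrite ?invr_ge0 ?(ltW p0)// nnegrE ?powR_ge0// ltW.
  by rewrite -powRrM divff ?gt_eqF// powRr1.
have w0 s : 0 <= weight l s by exact: expR_ge0.
apply: (@le_trans _ _ (Lp_of p J (fun s => weight l t * L1 s)%R +
    Lp_of p J (fun s => m * weight l s)%R)%E).
  apply: Lp_of_D; rewrite ?(ltW p1)//.
  - by apply: ae_measurableM => //; exact: ae_measurable_fun_eq.
  - apply: ae_measurable_fun_eq; apply: measurable_funM => //; exact: measurable_weight.
  - by move=> s; rewrite mulr_ge0.
  - by move=> s; rewrite mulr_ge0.
  - apply: nearW => s Js; rewrite mulr_ge0//=.
    apply: (le_trans (ler_wpM2r (w0 s) (LL1 s))); rewrite mulrDl lerD2r mulrC.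
    rewrite ler_wpM2r//; apply: weight_le; first exact: ltW.
    by have := Jt _ Js; rewrite /= in_itv/= => /andP[].
have -> : (c * weight l t)%:E = ((weight l t)%:E * (c / 2)%:E + (c / 2 * weight l t)%:E)%E.
  by rewrite -EFinM -EFinD; congr (_%:E); field.
apply: leeD.
  rewrite Lp_of_Z//; apply: lee_wpmul2l; first by rewrite lee_fin.
  apply: (Lp_of_le_powR p0); first exact: ltW.
  apply: le_trans hM; apply: (@le_trans _ _ (\int[mu]_(s in I) (L1 s `^ p)%:E)%E).
    by apply: le_integral_set => // s _; rewrite lee_fin powR_ge0.
  apply: ge0_ae_le_integralW.
  - by move=> s _; rewrite lee_fin powR_ge0.
  - by move=> s _; rewrite lee_fin; case: ifP => // _; exact: powR_ge0.
  - by apply: nearW => s _; rewrite lee_fin /L1; case: ifP => // _; rewrite powR0// gt_eqF.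
apply: (Lp_of_le_powR p0); first by rewrite mulr_ge0// ltW.
have pw s : weight l s `^ p = weight (p * l) s.
  by rewrite /weight -expRM; congr expR; ring.
apply: (@le_trans _ _ (\int[mu]_(s in J) (M%:E * (weight (p * l) s)%:E))%E).
  by under eq_integral do rewrite powRM// mp pw EFinM.
rewrite ge0_integralZl_EFin ?(ltW M0)//; last first.
- by apply/measurable_EFinP; apply: measurable_funTS; exact: measurable_weight.
- by move=> s _; rewrite lee_fin expR_ge0.
have pl0 : 0 < p * l by rewrite mulr_gt0.
have le1 : (\int[mu]_(s in J) (weight (p * l) s)%:E <= (weight (p * l) t / (p * l))%:E)%E.
  apply: (le_trans _ (integral_weight pl0 t0t)); apply: le_integral_set => // s _.
  by rewrite lee_fin expR_ge0.
apply: (le_trans (lee_wpmul2l _ le1)); first by rewrite lee_fin ltW.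
rewrite -EFinM lee_fin powRM ?(ltW c20)// pw -/e.
suff -> : M * (weight (p * l) t / (p * l)) = e * weight (p * l) t by [].
by rewrite /l; field; rewrite !gt_eqF.
Qed.

End Weights.

(** * Causal solution operators with a Lipschitz right-hand side *)

Section Picard.
Context (R : realType) (X : completeNormedModType R) (p t0 S : R).
Hypotheses (p1 : 1 < p) (S0 : 0 < S).
Local Notation mu := (@lebesgue_measure R).
Local Notation W := (whole X).
Local Notation I := (`[t0, (t0 + S)%R[%classic : set R).
Local Notation wgt := (weight t0).
Implicit Types (x y : X) (c t s r : R) (u v w h : R -> X) (L : R -> R).

Variable N : X -> \bar R.
Hypothesis HN : extended_norm N.
Local Notation n := (Xn N).
Local Notation fin := (finN N).

Let p0 : 0 < p. Proof. exact: lt_trans p1. Qed.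

Lemma mem_I t : I t <-> t0 <= t /\ t < t0 + S.
Proof. by rewrite /= in_itv/=; split => [/andP[]|[-> ->]]. Qed.

Lemma measurable_I : measurable I. Proof. exact: measurable_itv. Qed.

Lemma mu_I : (mu I = S%:E)%E.
Proof.
by rewrite lebesgue_measure_itv/= lte_fin ltrDl S0 -EFinB addrAC subrr add0r.
Qed.

(** The properties that curves of the interpolation space inherit from the
    trace theorem. *)
Record regular w : Prop := Regular {
  reg_bounded : exists M : R, forall t, I t -> (N (w t) <= M%:E)%E;
  reg_cont : forall t (e : R), I t -> 0 < e ->
    exists eta : R, 0 < eta /\ forall t', I t' -> `|t' - t| < eta ->
      (N (w t' - w t)%R <= e%:E)%E }.

Lemma regular_fin w t : regular w -> I t -> fin (w t).
Proof. by move=> [[M hM] _] It; have [] := le_Xn HN (hM t It). Qed.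

Lemma regular_cst x : fin x -> regular (fun=> x).
Proof.
move=> hx; split; first by exists (n x) => t _; rewrite (XnE HN hx).
move=> t e It e0; exists 1; split => // t' _ _.
by rewrite subrr (N0 HN) lee_fin ltW.
Qed.

(** An abstract linear problem: [Sol h u] stands for [u] being a solution with
    right-hand side [h], and [Mn] for the maximal regularity norm. Causality is
    in [so_trace], which only sees [h] before [t]. *)
Record solution_operator (Sol : (R -> X) -> (R -> X) -> Prop)
    (Mn : (R -> X) -> \bar R) (C : R) : Prop := SolutionOperator {
  so_exists : forall h x, in_Lp W p I h -> fin x -> exists u, Sol h u /\ u t0 = x;
  so_sub : forall h k u v, Sol h u -> Sol k v ->
    Sol (fun t => h t - k t) (fun t => u t - v t);
  so_ae : forall h k u, {ae mu, forall t, I t -> h t = k t} -> Sol h u -> Sol k u;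
  so_rhs : forall h u, Sol h u -> in_Lp W p I h;
  so_trace : forall h u t, Sol h u -> I t ->
    (N (u t) <= C%:E * (N (u t0) + Lp_of p `[t0, t] (fun s => `|h s|%R)))%E;
  so_norm : forall h u, Sol h u ->
    (Mn u <= C%:E * (N (u t0) + Lp_of p I (fun s => `|h s|%R)))%E;
  so_regular : forall h u, Sol h u -> regular u }.

(** Fields along which a curve is composed; the Lipschitz constant is only
    [p]-integrable in time. *)
Record lipschitz_field (F : R -> X -> X) L : Prop := LipschitzField {
  lf_meas : forall x, fin x -> strongly_measurable W I (fun t => F t x);
  lf_zero : in_Lp W p I (fun t => F t 0);
  lf_ge0 : forall t, 0 <= L t;
  lf_ae : ae_measurable I L;
  lf_fin : (Lp_of p I L < +oo)%E;
  lf_lip : forall t x y, I t -> fin x -> fin y ->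
    `|F t x - F t y| <= L t * n (x - y) }.

Section Composition.
Variables (F : R -> X -> X) (L : R -> R) (w : R -> X).
Hypotheses (HF : lipschitz_field F L) (Hw : regular w).

Let node (k : nat) (i : nat) : R := t0 + i%:R / k.+1%:R.

Let r (k : nat) t : R := node k (Num.truncn ((t - t0) * k.+1%:R)).

Let r_prop (k : nat) t : I t -> [/\ t0 <= r k t, r k t <= t & t < r k t + k.+1%:R^-1].
Proof.
move=> /mem_I[t1 t2]; have k0 : 0 < k.+1%:R :> R by [].
have := truncn_itv (_ : 0 <= (t - t0) * k.+1%:R).
rewrite mulr_ge0 ?subr_ge0// => /(_ isT) /andP[h1 h2]; rewrite /r /node.
set j := Num.truncn _ in h1 h2 *; split.
- by rewrite lerDl divr_ge0.
- by rewrite -lerBrDl ler_pdivrMr.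
- by rewrite -addrA -[X in _ + (_ + X)]mul1r -mulrDl natr1 -ltrBlDl ltr_pdivlMr.
Qed.

Lemma strongly_measurable_sum (f : nat -> R -> X) m :
  (forall i, strongly_measurable W I (f i)) ->
  strongly_measurable W I (fun t => \sum_(i < m) f i t).
Proof.
move=> hf; elim: m => [|m ih].
  rewrite (_ : (fun t => _) = fun=> 0); last by apply/funext => t; rewrite big_ord0.
  by apply: strongly_measurable_cst => //; [exact: whole_seminormed|rewrite mu_I ltry].
rewrite (_ : (fun t => _) = fun t => \sum_(i < m) f i t + f m t); last first.
  by apply/funext => t; rewrite big_ord_recr.
exact: (strongly_measurableD (@whole_seminormed R X) ih (hf m)).
Qed.

(** Sampling [w] at the points of a grid turns the composition into a finite
    sum of measurable pieces. *)
Lemma strongly_measurable_sample (k : nat) : strongly_measurable W I (fun t => F t (w (r k t))).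
Proof.
pose m := (Num.truncn (S * k.+1%:R)).+1.
pose w' t := if t \in I then w t else 0.
have w'fin t : fin (w' t).
  rewrite /w'; case: ifPn => [|_]; last exact: fin0.
  by rewrite inE => It; exact: regular_fin.
pose J i : set R := `[node k i, node k i.+1[%classic.
apply: strongly_measurable_ae (_ : strongly_measurable W I
   (fun t => \sum_(i < m) (\1_(J i) t : R) *: F t (w' (node k i)))); last first.
  apply: (@strongly_measurable_sum (fun i t => (\1_(J i) t : R) *: F t (w' (node k i)))).
  move=> i; apply: strongly_measurable_indic.
  - exact: whole_seminormed.
  - exact: measurable_itv.
  - exact: (lf_meas HF).
apply: nearW => t It; have [r1 r2 _] := r_prop k It.
have /mem_I[t1 t2] := It.
have k0 : 0 < k.+1%:R :> R by [].
have a0 : 0 <= (t - t0) * k.+1%:R by rewrite mulr_ge0// subr_ge0.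
have im : (Num.truncn ((t - t0) * k.+1%:R) < m)%N.
  rewrite ltnS; apply: le_truncn; rewrite ler_wpM2r// lerBlDl ltW//.
have Ji i : J i t <-> i = Num.truncn ((t - t0) * k.+1%:R).
  rewrite /J/= in_itv/= /node -lerBrDl -ltrBlDl ler_pdivrMr// ltr_pdivlMr//.
  by rewrite -(truncn_eq _ a0); split => [/eqP<-//|->].
rewrite (bigD1 (Ordinal im))//= big1 ?addr0; last first.
  move=> i /eqP ne; rewrite indicE memNset ?scale0r// => /Ji ii; apply: ne.
  by apply: val_inj.
rewrite indicE mem_set; last by apply/Ji.
rewrite scale1r -/(r k t) /w' mem_set//; apply/mem_I.
by split => //; exact: le_lt_trans t2.
Qed.

Lemma strongly_measurable_field : strongly_measurable W I (fun t => F t (w t)).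
Proof.
apply: strongly_measurable_lim (strongly_measurable_sample) _.
- exact: whole_seminormed.
- exact: measurable_I.
- by rewrite mu_I ltry.
apply: nearW => t It; split => //=.
have cv : (fun k : nat => n (w (r k t) - w t)) @ \oo --> (0 : R).
  apply/cvgr0Pnorm_le => e e0; have [eta [eta0 heta]] := reg_cont Hw It e0.
  near=> k; have [r1 r2 r3] := r_prop k It; have /mem_I[t1 t2] := It.
  have Ir : I (r k t) by apply/mem_I; split => //; exact: le_lt_trans t2.
  have close : `|r k t - t| < eta; last first.
    by have [_ le] := le_Xn HN (heta _ Ir close); rewrite ger0_norm ?(Xn_ge0 HN).
  rewrite distrC ger0_norm ?subr_ge0// ltrBlDl; apply: (lt_le_trans r3).
  rewrite lerD2l ltW//; near: k; exact: near_infty_natSinv_lt (PosNum eta0).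
apply: (@squeeze_cvg0 _ _ (fun k : nat => L t * n (w (r k t) - w t))).
  move=> k; rewrite normr_ge0/=; apply: (lf_lip HF) => //; apply: regular_fin => //.
  have [r1 r2 r3] := r_prop k It; have /mem_I[t1 t2] := It.
  by apply/mem_I; split => //; exact: le_lt_trans t2.
by rewrite -(mulr0 (L t)); apply: cvgMl_tmp.
Unshelve. all: by end_near. Qed.

Lemma in_Lp_field : in_Lp W p I (fun t => F t (w t)).
Proof.
split; first exact: strongly_measurable_field.
have [mz fz] := lf_zero HF; have [[M hM] _] := Hw.
have M0 : 0 <= M.
  have It0 : I t0 by apply/mem_I; rewrite ltrDl.
  by rewrite -lee_fin; apply: le_trans (hM _ It0); exact: (en_ge0 HN).
apply: (@le_lt_trans _ _ (Lp_of p I (fun t => `|F t 0|%R) + Lp_of p I (fun t => M * L t)%R)%E).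
  rewrite Lp_normE; apply: Lp_of_D; rewrite ?(ltW p1)//.
  - exact: ae_measurable_norm.
  - by apply: ae_measurableM (lf_ae HF); exact: ae_measurable_fun_eq.
  - by move=> t; rewrite mulr_ge0// (lf_ge0 HF).
  - apply: nearW => t It; rewrite normr_ge0/=.
    rewrite -{1}(subrK (F t 0) (F t (w t))) addrC; apply: (le_trans (ler_normD _ _)).
    rewrite lerD2l; have [hw1 hw2] := le_Xn HN (hM t It).
    apply: (le_trans (lf_lip HF It hw1 (fin0 HN))); rewrite subr0 mulrC.
    by rewrite ler_wpM2r// (lf_ge0 HF).
apply: lte_add_pinfty; first exact: fz.
rewrite Lp_of_Z//; [|exact: (lf_ae HF)|exact: (lf_ge0 HF)].
by apply: lte_mul_pinfty; [rewrite lee_fin|by []|exact: (lf_fin HF)].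
Qed.

End Composition.

(** The factor [1 / 2] makes the estimate self-improving. *)
Lemma weighted_bootstrap (E d : R -> R) (a M : R) : 0 <= a ->
  (forall t, I t -> 1 <= E t) -> (forall t, I t -> 0 <= d t <= M) ->
  (forall m, 0 <= m -> (forall s, I s -> d s <= m * E s) ->
     forall t, I t -> d t <= a + m / 2 * E t) ->
  forall t, I t -> d t <= 2 * a * E t.
Proof.
move=> a0 E1 hd step.
have E0 t : I t -> 0 < E t by move=> /E1; exact: lt_le_trans.
pose Q := [set d t / E t | t in I].
have hQ : has_sup Q.
  split; first by exists (d t0 / E t0), t0 => //; apply/mem_I; rewrite ltrDl.
  exists M => _ [t It <-]; have /andP[d0 dM] := hd t It.
  rewrite ler_pdivrMr ?E0//; apply: (le_trans dM).
  by rewrite ler_peMr ?E1// (le_trans d0).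
pose m := sup Q.
have dm t : I t -> d t <= m * E t.
  by move=> It; rewrite -ler_pdivrMr ?E0//; apply: ub_le_sup; [exact: hQ.2|exists t].
have It0 : I t0 by apply/mem_I; rewrite ltrDl.
have m0 : 0 <= m.
  have /andP[d0 _] := hd _ It0.
  by have := le_trans d0 (dm _ It0); rewrite pmulr_lge0// E0.
have m2a : m <= 2 * a.
  suff : m <= a + m / 2 by move=> h; lra.
  apply: ge_sup; first exact: hQ.1.
  move=> _ [t It <-]; rewrite ler_pdivrMr ?E0//; apply: (le_trans (step m m0 dm t It)).
  by rewrite mulrDl lerD2r ler_peMr// E1.
by move=> t It; apply: (le_trans (dm t It)); rewrite ler_wpM2r// ltW// E0.
Qed.

Section Operator.
Variables (Sol : (R -> X) -> (R -> X) -> Prop) (Mn : (R -> X) -> \bar R) (C : R).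
Hypotheses (C0 : 0 < C) (HS : solution_operator Sol Mn C).

(** [C * (a + e * S `^ p^-1)] comes from the data, and half of the weighted
    distance [m] that enters on the right comes back on the left. *)
Lemma so_contraction L : ae_measurable I L -> (forall t, 0 <= L t) ->
  (Lp_of p I L < +oo)%E -> exists l : R, 0 < l /\
  forall h k u v (a e m : R), Sol h u -> Sol k v -> 0 <= e -> 0 <= m ->
    (N (u t0 - v t0)%R <= a%:E)%E ->
    {ae mu, forall s, I s -> `|h s - k s| <= e + L s * (m * wgt l s)} ->
    (forall t, I t ->
       (N (u t - v t)%R <= (C * (a + e * S `^ p^-1) + m / 2 * wgt l t)%:E)%E) /\
    (Mn (fun t => u t - v t)%R <=
       (C * (a + e * S `^ p^-1) + m / 2 * wgt l (t0 + S))%:E)%E.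
Proof.
move=> aL L0 fL; have c0 : 0 < (2 * C)^-1 by rewrite invr_gt0 mulr_gt0.
have [l [l0 hl]] := Lp_of_weight t0 p1 measurable_I aL L0 fL c0.
exists l; split => // h k u v a e m hu hv e0 m0 ha hhk.
have huv := so_sub HS hu hv.
have w0 s : 0 <= wgt l s by exact: expR_ge0.
have [mh _] := so_rhs HS huv.
have key t J : t0 <= t -> measurable J -> J `<=` I -> J `<=` `[t0, t] ->
    (C%:E * (N (u t0 - v t0)%R + Lp_of p J (fun s => `|h s - k s|%R)) <=
     (C * (a + e * S `^ p^-1) + m / 2 * wgt l t)%:E)%E.
  move=> t0t mJ JI Jt.
  have -> : C * (a + e * S `^ p^-1) + m / 2 * wgt l t =
      C * (a + (e * S `^ p^-1 + m * ((2 * C)^-1 * wgt l t))).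
    by field; exact: lt0r_neq0.
  rewrite [in leRHS]EFinM; apply: lee_wpmul2l; first by rewrite lee_fin ltW.
  rewrite EFinD; apply: leeD => //.
  apply: (@le_trans _ _ (Lp_of p J (fun=> e) + Lp_of p J (fun s => m * (L s * wgt l s))%R)%E).
    apply: Lp_of_D; rewrite ?(ltW p1)//.
    - exact: ae_measurable_fun_eq.
    - apply: ae_measurableM; first exact: ae_measurable_fun_eq.
      apply: ae_measurableM; first exact: ae_measurable_sub JI aL.
      by apply: ae_measurable_fun_eq; exact: measurable_weight.
    - by move=> s; rewrite !mulr_ge0.
    - apply: (aeS hhk) => s hs Js; rewrite normr_ge0/=; apply: (le_trans (hs (JI _ Js))).
      by rewrite mulrCA.
  rewrite EFinD; apply: leeD.
    apply: (le_trans (le_Lp_of_set _ p0 JI)); rewrite Lp_of_cst//.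
    by rewrite mu_I poweR_EFin -EFinM.
  rewrite Lp_of_Z//; last 2 first.
  - apply: ae_measurableM; first exact: ae_measurable_sub JI aL.
    by apply: ae_measurable_fun_eq; exact: measurable_weight.
  - by move=> s; rewrite mulr_ge0.
  rewrite EFinM; apply: lee_wpmul2l; first by rewrite lee_fin.
  exact: hl.
split.
  move=> t It; have /mem_I[t1 t2] := It.
  apply: (le_trans (so_trace HS huv It)); apply: key => //.
  by move=> s; rewrite /= !in_itv/= => /andP[-> s2]; exact: le_lt_trans t2.
apply: (le_trans (so_norm HS huv)); apply: key => //.
- by rewrite lerDl ltW.
- by move=> s; rewrite /= !in_itv/= => /andP[-> /ltW].
Qed.

Lemma cvg_half (c : R) : (fun k : nat => c * 2^-1 ^+ k) @ \oo --> (0 : R).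
Proof. by apply: cvg_geometric; rewrite ger0_norm ?invr_ge0// invf_lt1// ltr1n. Qed.

Lemma exists_half (c e : R) : 0 < e -> exists k : nat, c * 2^-1 ^+ k < e.
Proof.
move=> e0; have /cvgr0Pnorm_lt /(_ _ e0) [k _ /(_ k (leqnn k))] := cvg_half c.
by move=> h; exists k; apply: le_lt_trans h; exact: ler_norm.
Qed.

(** The limit exists in the Banach space; lower semicontinuity of [N] makes it
    a limit for [N]. *)
Lemma N_cauchy (u : nat -> X) (D : R) : 0 <= D ->
  (forall k, (N (u k.+1 - u k)%R <= (D * 2^-1 ^+ k)%:E)%E) ->
  exists y, u @ \oo --> y /\ forall k, (N (y - u k)%R <= (2 * D * 2^-1 ^+ k)%:E)%E.
Proof.
move=> D0 hu; have q0 k : 0 <= 2^-1 ^+ k :> R by rewrite exprn_ge0// invr_ge0.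
have dist k j : (N (u (k + j)%N - u k)%R <= (2 * D * (2^-1 ^+ k - 2^-1 ^+ (k + j)%N))%:E)%E.
  elim: j => [|j ih]; first by rewrite addn0 !subrr mulr0 (N0 HN).
  rewrite addnS -(subrK (u (k + j)%N) (u (k + j).+1)) -addrA.
  apply: (le_trans (en_D HN _ _)); apply: (le_trans (leeD (hu _) ih)).
  rewrite -EFinD lee_fin exprS le_eqVlt; apply/orP; left; apply/eqP.
  by field.
have dist2 k j : (N (u (k + j)%N - u k)%R <= (2 * D * 2^-1 ^+ k)%:E)%E.
  apply: (le_trans (dist k j)); rewrite lee_fin ler_wpM2l ?mulr_ge0// gerBl.
  exact: q0.
have cu : cvg (u @ \oo).
  apply/cauchy_cvgP/cauchy_exP => e e0.
  have [k hk] := exists_half (2 * (2 * D)) e0.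
  exists (u k); exists k => // m /= km; rewrite -ball_normE/=.
  rewrite distrC; apply: le_lt_trans hk.
  rewrite -lee_fin; apply: (le_trans (en_norm HN _)).
  rewrite -mulrA EFinM; apply: lee_wpmul2l => //.
  by rewrite -(subnKC km); exact: dist2.
exists (limn u); split => // k.
apply: (@en_lsc _ _ _ HN (fun j => u (j + k)%N - u k)); last first.
  by move=> j; rewrite addnC; exact: dist2.
by apply: cvgB; [rewrite cvg_shiftn|exact: cvg_cst].
Qed.

(** Successive approximations converge in the weighted sup norm; the limit of
    the iterates is only known to be a curve of the interpolation space, and is
    recognized as a solution by solving once more with it on the right. *)
Lemma so_semilinear (F : R -> X -> X) L x : lipschitz_field F L -> fin x ->
  exists u, Sol (fun t => F t (u t)) u /\ u t0 = x.
Proof.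
move=> HF hx.
have [l [l0 hl]] := so_contraction (lf_ae HF) (lf_ge0 HF) (lf_fin HF).
have [Phi hPhi] : exists Phi : (R -> X) -> (R -> X), forall w, regular w ->
    Sol (fun t => F t (w t)) (Phi w) /\ Phi w t0 = x.
  suff /choice[Phi hPhi] : forall w, exists u, regular w ->
      Sol (fun t => F t (w t)) u /\ u t0 = x by exists Phi.
  move=> w; have [hw|hw] := pselect (regular w); last by exists w.
  by have [u hu] := so_exists HS (in_Lp_field HF hw) hx; exists u.
pose u (k : nat) := iter k Phi (fun=> x).
have uS k : u k.+1 = Phi (u k) by [].
have ureg k : regular (u k).
  elim: k => [|k ih]; first exact: regular_cst.
  by rewrite uS; exact: (so_regular HS (hPhi _ ih).1).
have w1 t : I t -> 1 <= wgt l t by move=> /mem_I[t1 _]; apply: weight_ge1 => //; exact: ltW.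
have wS t : I t -> wgt l t <= wgt l (t0 + S).
  by move=> /mem_I[_ t2]; apply: weight_le; exact: ltW.
have It0 : I t0 by apply/mem_I; rewrite ltrDl.
have field_le v w (m : R) t : regular v -> regular w -> I t ->
    (N (v t - w t)%R <= m%:E)%E -> `|F t (v t) - F t (w t)| <= 0 + L t * m.
  move=> hv hw It hm; rewrite add0r.
  apply: (le_trans (lf_lip HF It (regular_fin hv It) (regular_fin hw It))).
  by apply: ler_wpM2l; [exact: (lf_ge0 HF)|have [] := le_Xn HN hm].
(* one step of the iteration: no contribution from the initial values *)
have step v w (m : R) : regular v -> regular w -> 0 <= m ->
    (forall t, I t -> (N (v t - w t)%R <= (m * wgt l t)%:E)%E) ->
    forall t, I t -> (N (Phi v t - Phi w t)%R <= (m / 2 * wgt l t)%:E)%E.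
  move=> hv hw m0 hm t It; have [h1 h2] := hPhi v hv; have [k1 k2] := hPhi w hw.
  have [] := hl _ _ _ _ 0 0 m h1 k1 (lexx 0) m0.
  - by rewrite h2 k2 subrr (N0 HN).
  - by apply: nearW => s Is; apply: field_le => //; exact: hm.
  by move=> /(_ t It); rewrite mul0r addr0 mulr0 add0r.
have [D [D0 hD]] : exists D : R, 0 <= D /\
    forall t, I t -> (N (u 1%N t - u 0%N t)%R <= D%:E)%E.
  have [[M1 h1] _] := ureg 1%N; have [[M2 h2] _] := ureg 0%N.
  exists (M1 + M2); split.
    rewrite -lee_fin; apply: le_trans (leeD (h1 _ It0) (h2 _ It0)).
    by apply: adde_ge0; exact: (en_ge0 HN).
  move=> t It; apply: (le_trans (N_B HN _ _)); rewrite EFinD.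
  by apply: leeD; [exact: h1|exact: h2].
pose B := D * wgt l (t0 + S).
have B0 : 0 <= B by rewrite mulr_ge0// expR_ge0.
have iterate k t : I t -> (N (u k.+1 t - u k t)%R <= (D * 2^-1 ^+ k * wgt l t)%:E)%E.
  elim: k t => [|k ih] t It.
    apply: (le_trans (hD t It)); rewrite lee_fin expr0 mulr1.
    by rewrite ler_peMr// w1.
  rewrite exprSr mulrA; apply: (step _ _ _ (ureg k.+1) (ureg k) _ ih) => //.
  by rewrite mulr_ge0// exprn_ge0// invr_ge0.
have [w hw] : exists w : R -> X, forall t, I t -> (u^~ t @ \oo --> w t) /\
    forall k, (N (w t - u k t)%R <= (2 * B * 2^-1 ^+ k)%:E)%E.
  suff /choice[w hw] : forall t, exists y, I t -> (u^~ t @ \oo --> y) /\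
    forall k, (N (y - u k t)%R <= (2 * B * 2^-1 ^+ k)%:E)%E by exists w.
  move=> t; have [It|nIt] := pselect (I t); last by exists 0.
  have [//|y hy] := @N_cauchy (u^~ t) B B0.
    move=> k; apply: (le_trans (iterate k t It)); rewrite lee_fin /B mulrAC.
    by rewrite ler_wpM2r ?exprn_ge0 ?invr_ge0// ler_wpM2l// wS.
  by exists y.
have wreg : regular w.
  split.
    have [[M hM] _] := ureg 0%N; exists (2 * B + M) => t It.
    rewrite -(subrK (u 0%N t) (w t)); apply: (le_trans (en_D HN _ _)).
    rewrite EFinD; apply: leeD; last exact: hM.
    by have [_ /(_ 0%N)] := hw t It; rewrite expr0 mulr1.
  move=> t e It e0; have e3 : 0 < e / 3 by rewrite divr_gt0.
  have [k hk] := exists_half (2 * B) e3.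
  have [eta [eta0 heta]] := reg_cont (ureg k) It e3; exists eta; split => // t' It' tt'.
  have -> : w t' - w t = (w t' - u k t') + ((u k t' - u k t) - (w t - u k t)).
    by rewrite opprB [X in _ = _ + X]addrA subrK addrA subrK.
  have -> : e%:E = ((e / 3)%:E + ((e / 3)%:E + (e / 3)%:E))%E.
    by rewrite -!EFinD; congr (_%:E); field.
  apply: (le_trans (en_D HN _ _)); apply: leeD.
    by apply: (le_trans ((hw t' It').2 k)); rewrite lee_fin ltW.
  apply: (le_trans (en_D HN _ _)); apply: leeD; first exact: heta.
  rewrite -sub0r (N_BC HN) subr0.
  by apply: (le_trans ((hw t It).2 k)); rewrite lee_fin ltW.
have [h1 h2] := hPhi w wreg.
suff wE t : I t -> Phi w t = w t.
  exists (Phi w); split => //; apply: (so_ae HS) h1.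
  by apply: nearW => t It; rewrite wE.
move=> It; apply: (N_eq0 HN); apply/eqP; rewrite eq_le (en_ge0 HN) andbT.
apply/lee_addgt0Pr => e e0; rewrite add0e.
have [k hk] := exists_half (B * wgt l t + 2 * B) e0.
rewrite -(subrK (u k.+1 t) (Phi w t)) -addrA; apply: (le_trans (en_D HN _ _)).
apply: (@le_trans _ _ ((B * 2^-1 ^+ k * wgt l t)%:E + (2 * B * 2^-1 ^+ k)%:E)%E); last first.
  by rewrite -EFinD lee_fin mulrAC -mulrDl; exact: ltW.
have q0 : 0 <= 2^-1 ^+ k :> R by rewrite exprn_ge0// invr_ge0.
apply: leeD; last first.
  rewrite (N_BC HN); apply: (le_trans ((hw t It).2 k.+1)); rewrite lee_fin exprS.
  by apply: ler_wpM2l; [exact: mulr_ge0|apply: ler_piMl => //; rewrite invf_le1// ler1n].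
have m0 : 0 <= 2 * B * 2^-1 ^+ k by apply: mulr_ge0 => //; exact: mulr_ge0.
have -> : B * 2^-1 ^+ k = 2 * B * 2^-1 ^+ k / 2 by field.
apply: (step _ _ _ wreg (ureg k) m0) => // s Is.
apply: (le_trans ((hw s Is).2 k)); rewrite lee_fin.
by apply: ler_peMr => //; exact: w1.
Qed.

(** The weighted distance of [u] and [v] bounds itself through the Lipschitz
    constant, and by the factor [1 / 2] it is bounded by the data. *)
Lemma so_stability (F : R -> X -> X) L : lipschitz_field F L ->
  exists K : R, 0 < K /\ forall h u v (a e : R), Sol h u -> Sol (fun t => F t (v t)) v ->
    0 <= a -> 0 <= e -> (N (u t0 - v t0)%R <= a%:E)%E ->
    {ae mu, forall s, I s -> `|h s - F s (u s)| <= e} ->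
    (forall t, I t -> (N (u t - v t)%R <= (K * (a + e))%:E)%E) /\
    (Mn (fun t => u t - v t)%R <= (K * (a + e))%:E)%E.
Proof.
move=> HF; have [l [l0 hl]] := so_contraction (lf_ae HF) (lf_ge0 HF) (lf_fin HF).
have w1 t : t0 <= t -> 1 <= wgt l t by apply: weight_ge1; exact: ltW.
have t0S : t0 <= t0 + S by rewrite lerDl ltW.
pose S' := S `^ p^-1; have S'0 : 0 <= S' by exact: powR_ge0.
pose K := 2 * C * (1 + S') * wgt l (t0 + S).
have wS0 : 0 < wgt l (t0 + S) by exact: expR_gt0.
exists K; split.
  by apply: mulr_gt0 => //; apply: mulr_gt0; [exact: mulr_gt0|exact: ltr_pwDl].
move=> h u v a e hu hv a0 e0 ha hh.
have ru := so_regular HS hu; have rv := so_regular HS hv.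
have finuv t : I t -> fin (u t - v t).
  by move=> It; apply: (finB HN); exact: regular_fin.
have step m : 0 <= m -> (forall s, I s -> n (u s - v s) <= m * wgt l s) ->
    (forall t, I t ->
       (N (u t - v t)%R <= (C * (a + e * S') + m / 2 * wgt l t)%:E)%E) /\
    (Mn (fun t => u t - v t)%R <= (C * (a + e * S') + m / 2 * wgt l (t0 + S))%:E)%E.
  move=> m0 hm; apply: (hl _ _ _ _ a e m hu hv e0 m0 ha).
  apply: (aeS hh) => s hs Is.
  rewrite -(subrK (F s (u s)) (h s)) -addrA; apply: (le_trans (ler_normD _ _)).
  apply: lerD; first exact: hs.
  apply: (le_trans (lf_lip HF Is (regular_fin ru Is) (regular_fin rv Is))).
  by apply: ler_wpM2l; [exact: (lf_ge0 HF)|exact: hm].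
pose a' := C * (a + e * S').
have a'0 : 0 <= a' by rewrite mulr_ge0 ?(ltW C0)// addr_ge0// mulr_ge0.
have [[M1 hM1] _] := ru; have [[M2 hM2] _] := rv.
have dle t : I t -> n (u t - v t) <= 2 * a' * wgt l t.
  apply: (@weighted_bootstrap (wgt l) (fun t => n (u t - v t)) a' (M1 + M2) a'0).
  - by move=> s /mem_I[s1 _]; exact: w1.
  - move=> s Is; rewrite (Xn_ge0 HN)/=.
    have [] // := le_Xn HN (_ : (N (u s - v s)%R <= (M1 + M2)%:E)%E).
    apply: (le_trans (N_B HN _ _)); rewrite EFinD.
    by apply: leeD; [exact: hM1|exact: hM2].
  - move=> m m0 hm s Is; have [h1 _] := step m m0 hm.
    by have [] := le_Xn HN (h1 s Is).
have [h1 h2] := step (2 * a') (mulr_ge0 (ler0n _ 2) a'0) dle.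
have a'K (z : R) : 0 <= z -> z <= wgt l (t0 + S) ->
    C * (a + e * S') + 2 * a' / 2 * z <= K * (a + e).
  move=> z0 zS; rewrite -/a'; have -> : a' + 2 * a' / 2 * z = a' * (1 + z) by field.
  have le1 : a' <= C * (1 + S') * (a + e).
    rewrite /a' -mulrA; apply: ler_wpM2l; first exact: ltW.
    have S'a := mulr_ge0 S'0 a0; have S'e := mulr_ge0 S'0 e0; by nra.
  have le2 : 1 + z <= 2 * wgt l (t0 + S).
    by rewrite mulr_natl mulr2n; apply: lerD => //; exact: w1.
  have -> : K * (a + e) = C * (1 + S') * (a + e) * (2 * wgt l (t0 + S)).
    by rewrite /K; ring.
  by apply: ler_pM => //; rewrite addr_ge0.
split; last by apply: (le_trans h2); rewrite lee_fin a'K// ltW.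
move=> t It; apply: (le_trans (h1 t It)); rewrite lee_fin a'K ?expR_ge0//.
by apply: weight_le; [exact: ltW|move: It => /mem_I[_ /ltW]].
Qed.

End Operator.

End Picard.

(** * Limits of extended reals *)

Section ExtendedLimits.
Context (R : realType).
Implicit Types (u : nat -> \bar R) (x : \bar R) (e : R).

Lemma nbhs_le_ereal e : 0 < e -> nbhs (0 : \bar R) [set y : \bar R | (y <= e%:E)%E].
Proof.
move=> e0; have := @nbhs_open_ereal_lt R 0 (fun=> e) e0.
by apply: filterS => y /ltW.
Qed.

Lemma cvge0_le u : (forall n, (0 <= u n)%E) ->
  (forall e, 0 < e -> \forall n \near \oo, (u n <= e%:E)%E) -> u @ \oo --> (0 : \bar R).
Proof.
move=> u0 hu.
have finu : \forall n \near \oo, u n \is a fin_num.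
  apply: filterS (hu 1 ltr01) => n h; rewrite ge0_fin_numE//.
  by apply: le_lt_trans h _; exact: ltry.
apply/fine_cvgP; split => //; apply/cvgr0Pnorm_le => e e0.
apply: filterS2 finu (hu e e0) => n fn h.
by rewrite /= ger0_norm ?fine_ge0// -lee_fin fineK.
Qed.

Lemma limn_esup_ge u x : (\forall n \near \oo, (x <= u n)%E) -> (x <= limn_esup u)%E.
Proof.
move=> [m _ hm]; rewrite limn_esup_lim (cvg_lim _ (@cvg_esups_inf R u))//.
apply/ereal_infP => _ [n _ <-]; apply: (le_trans (hm (maxn n m) (leq_maxr _ _))).
by apply: ereal_sup_ubound; exists (maxn n m) => //=; exact: leq_maxl.
Qed.

Lemma exists_between e x : (e%:E < x)%E -> exists e', e < e' /\ (e'%:E < x)%E.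
Proof.
case: x => [c| |]//; last by move=> _; exists (e + 1); rewrite ltry ltrDl.
rewrite lte_fin => ec; exists ((e + c) / 2); rewrite lte_fin; split; lra.
Qed.

End ExtendedLimits.

(** * The semilinear problem *)

Section Semilinear.
Context (R : realType) (X : completeNormedModType R) (A : linear_operator X) (p t0 : R).
Hypotheses (p1 : 1 < p) (t00 : 0 <= t0) (hMR : maximal_regularity A p t0).
Local Notation mu := (@lebesgue_measure R).
Local Notation W := (whole X).
Local Notation N := (Xp_norm A p).
Implicit Types (x y : X) (f : R -> X -> X) (u v h psi phi : R -> X).

Let p0 : 0 < p. Proof. exact: lt_trans p1. Qed.

Lemma Xp_extended_norm : extended_norm N.
Proof.
split.
- exact: (Xp_norm_ge0 A p1).
- exact: (Xp_normD A p1).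
- exact: (Xp_normZ A p1).
- exact: (norm_le_Xp A p1).
- by move=> u x M; exact: (Xp_norm_lsc p1).
Qed.

Let HN := Xp_extended_norm.

Lemma mr_solution_regular (S : R) h u : 0 < S -> mr_solution A p (ico t0 S%:E) h u ->
  regular t0 S N u.
Proof.
move=> S0 hu; have [C [C0 hC]] := mr_solution_trace p1 hMR S0.
have fx : finN N (u t0) := in_MR_Xp p1 (mrs_in hu) (ico_start t0 S0).
have [_ fh] := mr_solution_rhs p1 (bi_ico t0 S) hu.
have B0 := Lp_of_ge0 p (ico t0 S%:E) (fun s => `|h s|).
have finB : Lp_of p (ico t0 S%:E) (fun s => `|h s|) \is a fin_num.
  by rewrite ge0_fin_numE.
split.
  exists (C * (Xn N (u t0) + fine (Lp_of p (ico t0 S%:E) (fun s => `|h s|)))).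
  move=> t It; have It' : ico t0 S%:E t by rewrite icoE.
  apply: (le_trans (hC h u t hu It')); rewrite EFinM; apply: lee_wpmul2l.
    by rewrite lee_fin ltW.
  rewrite EFinD (XnE HN fx); apply: leeD; first exact: lexx.
  rewrite fineK//; apply: le_Lp_of_set p0 _ => s.
  by move: It; rewrite icoE /= !in_itv/= => /andP[_ t2] /andP[-> s2]; exact: le_lt_trans t2.
move=> t e It e0; have [_ tS] := (mem_I _ _ _).1 It.
have It' : ico t0 S%:E t by rewrite icoE.
have [eta [eta0 heta]] := trace_continuous p1 (bi_ico t0 S) (mrs_in hu) It' tS e0.
by exists eta; split => // t' Jt'; apply: heta; rewrite icoE.
Qed.

Lemma mr_solution_operator (S : R) : 0 < S -> exists C : R, 0 < C /\
  solution_operator p t0 S N (mr_solution A p (ico t0 S%:E))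
    (MR_norm A p (ico t0 S%:E)) C.
Proof.
move=> S0; have [C1 [C10 h1]] := mr_solution_trace p1 hMR S0.
have [C2 [C20 h2]] := mr_solution_norm p1 hMR S0.
have [C3 [C30 h3]] := mr_solution_exists hMR S0.
exists (C1 + C2); split; first exact: addr_gt0.
have enlarge (c : R) (x : \bar R) : 0 <= c -> c <= C1 + C2 -> (0 <= x)%E ->
    (c%:E * x <= (C1 + C2)%:E * x)%E.
  by move=> c0 cC x0; apply: lee_wpmul2r => //; rewrite lee_fin.
split.
- move=> h x; rewrite -icoE => hh hx.
  by have [u [k1 k2 _]] := h3 h x hh hx; exists u; split; [exact: k1|exact: k2].
- by move=> h k u v; exact: (mr_solutionB p1 (bi_ico t0 S)).
- by move=> h k u; rewrite -icoE => e; exact: mr_solution_ae.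
- by move=> h u hu; rewrite -icoE; exact: (mr_solution_rhs p1 (bi_ico t0 S) hu).
- move=> h u t hu; rewrite -icoE => It; apply: (le_trans (h1 h u t hu It)).
  apply: enlarge; [exact: ltW|by rewrite lerDl ltW|].
  by apply: adde_ge0; [exact: (en_ge0 HN)|exact: Lp_of_ge0].
- move=> h u hu; apply: (le_trans (h2 h u hu)); rewrite icoE.
  apply: enlarge; [exact: ltW|by rewrite lerDr ltW|].
  by apply: adde_ge0; [exact: (en_ge0 HN)|exact: Lp_of_ge0].
- by move=> h u; exact: mr_solution_regular.
Qed.

(** The hypotheses on one right-hand side of the theorem. *)
Record admissible f : Prop := Admissible {
  adm_meas : forall x, Xp A p x -> strongly_measurable W `[0, +oo[ (fun t => f t x);
  adm_zero : in_Lp_loc W p `[0, +oo[ (fun t => f t 0);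
  adm_lip : forall r : R, 0 < r -> exists Psi : R -> R,
    in_Lp_loc (whole (R^o : normedModType R)) p `[0, +oo[ Psi /\
    forall (t : R) x y, 0 <= t -> (N x <= r%:E)%E -> (N y <= r%:E)%E ->
      (`|f t x - f t y|%:E <= (Psi t)%:E * N (x - y)%R)%E }.

Definition truncated f (r : R) t x : X := f t (radial N r x).

Lemma truncated_id f (r t : R) x : (N x <= r%:E)%E -> truncated f r t x = f t x.
Proof. by move=> h; rewrite /truncated radial_id//; have [] := le_Xn HN h. Qed.

(** The retraction is Lipschitz with constant [2], and the ball of radius [r]
    only sees one of the Lipschitz constants [Psi]. *)
Lemma truncated_lipschitz f (r S : R) : admissible f -> 0 < r -> 0 < S ->
  exists L, lipschitz_field p t0 S N (truncated f r) L.
Proof.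
move=> hf r0 S0; have [Psi [hPsi lip]] := adm_lip hf r0.
have sub0 : `[t0, t0 + S] `<=` `[0, +oo[.
  by move=> t; rewrite /= !in_itv/= andbT => /andP[h _]; exact: le_trans h.
have subI : `[t0, t0 + S[ `<=` `[t0, t0 + S].
  by move=> t; rewrite /= !in_itv/= => /andP[-> /ltW].
have sub1 := subset_trans subI sub0.
have [mPsi fPsi] := hPsi _ _ sub0.
have aPsi : ae_measurable `[t0, (t0 + S)%R[ (fun t => `|Psi t|).
  apply: ae_measurable_sub subI _.
  exact: (strongly_measurable_snorm (whole_seminormed _) mPsi).
exists (fun t => 2 * `|Psi t|); split.
- move=> x hx; apply: (strongly_measurable_sub sub1).
  by apply: (adm_meas hf); exact: (radial_fin HN).
- have e : (fun t => truncated f r t 0) = (fun t => f t 0).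
    apply/funext => t; apply: truncated_id.
    by rewrite (N0 HN) lee_fin ltW.
  by rewrite e; exact: (in_Lp_sub p1 subI (adm_zero hf sub0)).
- by move=> t; exact: mulr_ge0.
- by apply: ae_measurableM => //; exact: ae_measurable_fun_eq.
- rewrite Lp_of_Z//.
  apply: lte_mul_pinfty; [by rewrite lee_fin|by []|].
  by apply: le_lt_trans fPsi; exact: le_Lp_of_set.
move=> t x y It hx hy; have [t1 _] := (mem_I _ _ _).1 It.
have hrx := radial_fin HN r hx; have hry := radial_fin HN r hy.
have := lip t _ _ (le_trans t00 t1) (radial_le HN r0 hx) (radial_le HN r0 hy).
rewrite (XnE HN (finB HN hrx hry)) -EFinM lee_fin => le1.
apply: (le_trans le1); apply: (@le_trans _ _ (`|Psi t| * Xn N (radial N r x - radial N r y))).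
  by apply: ler_wpM2r; [exact: (Xn_ge0 HN)|exact: ler_norm].
rewrite [2 * _]mulrC -mulrA; apply: ler_wpM2l; first exact: normr_ge0.
exact: (radial_lipschitz HN r0 hx hy).
Qed.

Lemma truncated_solution f (r S : R) x : admissible f -> 0 < r -> 0 < S -> Xp A p x ->
  exists u, mr_solution A p (ico t0 S%:E) (fun t => truncated f r t (u t)) u /\ u t0 = x.
Proof.
move=> hf r0 S0 hx; have [L HL] := truncated_lipschitz hf r0 S0.
have [C [C0 HS]] := mr_solution_operator S0.
exact: (so_semilinear p1 S0 HN C0 HS HL hx).
Qed.

Lemma mr_solution_bound (S : R) h u : 0 < S -> mr_solution A p (ico t0 S%:E) h u ->
  exists M : R, 0 <= M /\ forall t, ico t0 S%:E t -> (N (u t) <= M%:E)%E.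
Proof.
move=> S0 hu; have [[M hM] _] := mr_solution_regular S0 hu.
rewrite -icoE in hM; exists M; split => //.
by rewrite -lee_fin; apply: le_trans (hM _ (ico_start t0 S0)); exact: (en_ge0 HN).
Qed.

(** Both solutions are bounded in the interpolation space, so that they solve
    the same problem truncated at a large radius. *)
Lemma semilinear_unique f (S : R) u v : admissible f -> 0 < S ->
  mr_solution A p (ico t0 S%:E) (fun t => f t (u t)) u ->
  mr_solution A p (ico t0 S%:E) (fun t => f t (v t)) v ->
  u t0 = v t0 -> forall t, ico t0 S%:E t -> u t = v t.
Proof.
move=> hf S0 hu hv uv0 t It.
have [M1 [M10 hM1]] := mr_solution_bound S0 hu.
have [M2 [M20 hM2]] := mr_solution_bound S0 hv.
pose r := M1 + M2 + 1.
have r0 : 0 < r by rewrite ltr_pwDr// addr_ge0.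
have [L HL] := truncated_lipschitz hf r0 S0.
have [C [C0 HS]] := mr_solution_operator S0.
have [K [K0 hK]] := so_stability p1 S0 HN C0 HS HL.
have M1r : M1 <= r by rewrite /r -addrA lerDl addr_ge0.
have M2r : M2 <= r by rewrite /r addrAC lerDr addr_ge0.
have tu s : ico t0 S%:E s -> truncated f r s (u s) = f s (u s).
  by move=> Is; apply: truncated_id; apply: (le_trans (hM1 s Is)); rewrite lee_fin.
have tv s : ico t0 S%:E s -> truncated f r s (v s) = f s (v s).
  by move=> Is; apply: truncated_id; apply: (le_trans (hM2 s Is)); rewrite lee_fin.
have hv' : mr_solution A p (ico t0 S%:E) (fun s => truncated f r s (v s)) v.
  by apply: mr_solution_ae hv; apply: nearW => s Is; rewrite tv.
have uv00 : (N (u t0 - v t0)%R <= 0%:E)%E by rewrite uv0 subrr (N0 HN).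
have err : {ae mu, forall s, `[t0, t0 + S[%classic s ->
    `|f s (u s) - truncated f r s (u s)| <= 0}.
  by apply: nearW => s; rewrite -icoE => Is; rewrite tu// subrr normr0.
have [h1 _] := hK _ u v 0 0 hu hv' (lexx 0) (lexx 0) uv00 err.
apply: (N_eq0 HN); apply/eqP; rewrite eq_le (en_ge0 HN) andbT.
have It' : `[t0, t0 + S[%classic t by rewrite -icoE.
by apply: (le_trans (h1 t It')); rewrite addr0 mulr0.
Qed.

Lemma is_solution_mr f (S : R) x (T : \bar R) phi : 0 < S -> (S%:E < T)%E ->
  is_solution A p t0 f x T phi ->
  mr_solution A p (ico t0 S%:E) (fun t => f t (phi t)) phi.
Proof.
move=> S0 ST [_ hs]; have [h1 h2] := hs S S0 ST.
apply: (mr_solution_sub p1 (bi_itvcc t0 (t0 + S)) (bi_ico t0 S)); last by split.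
by rewrite icoE => t; rewrite /= !in_itv/= => /andP[-> /ltW].
Qed.

Lemma mr_is_solution f (S : R) x phi : phi t0 = x ->
  mr_solution A p (ico t0 S%:E) (fun t => f t (phi t)) phi ->
  is_solution A p t0 f x S%:E phi.
Proof.
move=> h0 hs; split => // T' T'0; rewrite lte_fin => T'S J.
have JS : J `<=` ico t0 S%:E.
  rewrite icoE => t; rewrite /J/= !in_itv/= => /andP[-> h].
  by rewrite (le_lt_trans h)// ltrD2l.
by have [h1 h2] := mr_solution_sub p1 (bi_ico t0 S) (bi_itvcc t0 (t0 + T')) JS hs.
Qed.

(** By continuity in the interpolation space, the solution of the problem
    truncated at radius [|x|_Xp + 1] stays in the ball for a short time; for
    [T = 0] it would be a proper extension. *)
Lemma maximal_pos f x (T : \bar R) phi : admissible f -> Xp A p x ->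
  is_maximal_solution A p t0 f x T phi -> (0 < T)%E.
Proof.
move=> hf hx [T0 hs hmax]; rewrite lt_neqAle T0 andbT; apply/eqP => e0.
have fx : finN N x := hx.
pose r := Xn N x + 1; have r0 : 0 < r by rewrite ltr_pwDr// (Xn_ge0 HN).
have [psi [hpsi psi0]] := truncated_solution hf r0 (@ltr01 R) hx.
have rpsi := mr_solution_regular ltr01 hpsi.
have It0 : `[t0, t0 + 1[%classic t0 by rewrite -icoE; exact: ico_start.
have [eta [eta0 heta]] := reg_cont rpsi It0 ltr01.
pose S := Num.min eta 1; have S0 : 0 < S by rewrite lt_min eta0 ltr01.
have S1 : S <= 1 by rewrite ge_min lexx orbT.
have Seta : S <= eta by rewrite ge_min lexx.
have SS := @ico_sub R t0 _ _ S1.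
have hpsi' : mr_solution A p (ico t0 S%:E) (fun t => f t (psi t)) psi.
  apply: (@mr_solution_ae _ _ _ _ _ (fun t => truncated f r t (psi t))); last first.
    exact: (mr_solution_sub p1 (bi_ico t0 1) (bi_ico t0 S) SS hpsi).
  apply: nearW => t It; apply: truncated_id.
  rewrite -(subrK x (psi t)) addrC; apply: (le_trans (en_D HN _ _)).
  rewrite /r EFinD; apply: leeD; first by rewrite (XnE HN fx).
  rewrite -psi0; apply: heta; first by rewrite -icoE; exact: SS.
  move: It; rewrite icoE/= in_itv/= => /andP[t1 t2].
  by rewrite ger0_norm ?subr_ge0// ltrBlDl (lt_le_trans t2)// lerD2l.
apply: (hmax S%:E psi).
- by rewrite -e0 lte_fin.
- exact: (mr_is_solution psi0 hpsi').
- by move=> t; rewrite -e0 icoE/= in_itv/= addr0 => /andP[h1 h2]; have := le_lt_trans h1 h2; rewrite ltxx.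
Qed.

(** A solution living on [[t0, t0 + S)] is a restriction of the maximal one. *)
Lemma maximal_ge f x (T : \bar R) phi psi (S : R) : admissible f -> 0 < S ->
  is_maximal_solution A p t0 f x T phi -> psi t0 = x ->
  mr_solution A p (ico t0 S%:E) (fun t => f t (psi t)) psi ->
  (S%:E <= T)%E /\ forall t, ico t0 S%:E t -> phi t = psi t.
Proof.
move=> hf S0 [T0 hs hmax] psi0 hpsi.
have agree t : t0 <= t -> t < t0 + S -> (t%:E < t0%:E + T)%E -> phi t = psi t.
  move=> t1 t2 tT; have tt0 : (((t - t0)%R)%:E < T)%E.
    by move: tT; case: (T) => [c| |]//; rewrite ?ltry// -EFinD !lte_fin ltrBlDl.
  have [S' [S'0 tS' S'S S'T]] : exists S' : R,
      [/\ 0 < S', t < t0 + S', S' <= S & (S'%:E < T)%E].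
    have tS : t - t0 < S by rewrite ltrBlDl.
    have t10 : 0 <= t - t0 by rewrite subr_ge0.
    move: tt0; case: (T) => [c| |]//.
      rewrite lte_fin => tc; pose m := Num.min S c.
      have tm : t - t0 < m by rewrite lt_min tS tc.
      have mS : m <= S by rewrite ge_min lexx.
      have mc : m <= c by rewrite ge_min lexx orbT.
      move: m tm mS mc => m tm mS mc.
      exists ((t - t0 + m) / 2); rewrite lte_fin; split; lra.
    move=> _; exists ((t - t0 + S) / 2); rewrite ltry; split => //; lra.
  apply: (semilinear_unique hf S'0 (u := phi) (v := psi)).
  - exact: (is_solution_mr S'0 S'T hs).
  - exact: (mr_solution_sub p1 (bi_ico t0 S) (bi_ico t0 S') (@ico_sub R t0 _ _ S'S) hpsi).
  - by rewrite psi0; case: hs.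
  - by rewrite icoE/= in_itv/= t1.
have ST : (S%:E <= T)%E.
  rewrite leNgt; apply/negP => TS; apply: (hmax S%:E psi TS).
    exact: (mr_is_solution psi0 hpsi).
  move=> t [t1 t2]; symmetry; apply: agree => //.
  by rewrite -lte_fin EFinD; apply: (lt_le_trans t2); apply: leeD => //; exact: ltW.
split => // t; rewrite icoE/= in_itv/= => /andP[t1 t2]; apply: agree => //.
apply: (@lt_le_trans _ _ (t0%:E + S%:E)%E); first by rewrite -EFinD lte_fin.
exact: leeD.
Qed.

Section Convergence.
Variables (f : nat -> R -> X -> X) (x0 : nat -> X) (T : nat -> \bar R) (phi : nat -> R -> X).
Hypotheses (hf : forall n, admissible (f n)) (hx0 : forall n, Xp A p (x0 n)).
Hypothesis hf0 : forall (eps a b eta : R), 0 < eps -> 0 <= a -> a <= b -> 0 < eta ->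
  exists m : nat, (1 <= m)%N /\ forall n : nat, (m <= n)%N ->
    (ereal_sup [set ereal_sup [set `|f n t u - f 0%N t u|%:E
                              | u in [set u | (N u <= eta%:E)%E]]
               | t in `[a, b]] < eps%:E)%E.
Hypothesis x0cvg : (fun n => N (x0 n - x0 0%N)) @ \oo --> (0 : \bar R).
Hypothesis hphi : forall n, is_maximal_solution A p t0 (f n) (x0 n) (T n) (phi n).

(** The truncated solutions stay within distance [1] of [phi 0] for large [n],
    hence below the truncation radius: they solve the original equations. *)
Lemma solutions_converge (S e : R) : 0 < S -> (S%:E < T 0%N)%E -> 0 < e ->
  \forall n \near \oo, [/\ (S%:E <= T n)%E,
    forall t, ico t0 S%:E t -> (N (phi n t - phi 0%N t)%R <= e%:E)%E &
    (MR_norm A p (ico t0 S%:E) (fun t => phi n t - phi 0%N t)%R <= e%:E)%E].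
Proof.
move=> S0 ST e0; have [_ hs0 _] := hphi 0.
have hphi0 := is_solution_mr S0 ST hs0.
have [M [M0 hM]] := mr_solution_bound S0 hphi0.
pose r := M + 1; have r0 : 0 < r by rewrite ltr_pwDr.
have [L HL] := truncated_lipschitz (hf 0) r0 S0.
have [C [C0 HS]] := mr_solution_operator S0.
have [K [K0 hK]] := so_stability p1 S0 HN C0 HS HL.
pose e1 := Num.min e 1; have e10 : 0 < e1 by rewrite lt_min e0 ltr01.
have e1e : e1 <= e by rewrite ge_min lexx.
have e11 : e1 <= 1 by rewrite ge_min lexx orbT.
pose d := e1 / (2 * K); have d0 : 0 < d by rewrite divr_gt0// mulr_gt0.
have KdE : K * (d + d) = e1 by rewrite /d; field; exact: lt0r_neq0.
have t0S : t0 <= t0 + S by rewrite lerDl ltW.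
have [m [_ hm]] := hf0 d0 t00 t0S r0.
have hphi0r : mr_solution A p (ico t0 S%:E)
    (fun t => truncated (f 0%N) r t (phi 0%N t)) (phi 0%N).
  apply: mr_solution_ae hphi0; apply: nearW => t It; rewrite truncated_id//.
  by apply: (le_trans (hM t It)); rewrite lee_fin /r lerDl.
have near_x0 : \forall n \near \oo, (N (x0 n - x0 0%N)%R <= d%:E)%E.
  exact: (x0cvg (nbhs_le_ereal d0)).
apply: filterS2 near_x0 (nbhs_infty_ge m) => n hxn mn.
have [psi [hpsi psi0]] := truncated_solution (hf n) r0 S0 (hx0 n).
have rpsi := mr_solution_regular S0 hpsi.
have start : (N (psi t0 - phi 0%N t0)%R <= d%:E)%E.
  by rewrite psi0; case: hs0 => -> _; exact: hxn.
have err : {ae mu, forall s, `[t0, t0 + S[%classic s ->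
    `|truncated (f n) r s (psi s) - truncated (f 0%N) r s (psi s)| <= d}.
  apply: nearW => s Is; rewrite -lee_fin; apply/ltW; apply: le_lt_trans (hm n mn).
  have [s1 s2] := (mem_I _ _ _).1 Is.
  apply: (@le_trans _ _ (ereal_sup [set `|f n s u - f 0%N s u|%:E
      | u in [set u | (N u <= r%:E)%E]])).
    apply: ereal_sup_ubound; exists (radial N r (psi s)) => //.
    exact: (radial_le HN r0 (regular_fin HN rpsi Is)).
  apply: ereal_sup_ubound; exists s => //.
  by rewrite /= in_itv/= s1 ltW.
have [h1 h2] := hK _ psi (phi 0%N) d d hpsi hphi0r (ltW d0) (ltW d0) start err.
rewrite KdE -icoE in h1 h2.
have hpsi' : mr_solution A p (ico t0 S%:E) (fun t => f n t (psi t)) psi.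
  apply: mr_solution_ae hpsi; apply: nearW => t It; apply: truncated_id.
  rewrite -(subrK (phi 0%N t) (psi t)) addrC; apply: (le_trans (en_D HN _ _)).
  rewrite /r EFinD; apply: leeD; first exact: hM.
  by apply: (le_trans (h1 t It)); rewrite lee_fin.
have [hT agree] := maximal_ge (hf n) S0 (hphi n) psi0 hpsi'.
split; first exact: hT.
  by move=> t It; rewrite agree//; apply: (le_trans (h1 t It)); rewrite lee_fin.
rewrite (@MR_norm_ext _ _ A p p1 _ _ (fun t => psi t - phi 0%N t)); last first.
  by move=> t It; rewrite agree.
by apply: (le_trans h2); rewrite lee_fin.
Qed.

End Convergence.

End Semilinear.

Theorem theorem3p1 (R : realType) (p : R) (hp : 1 < p)
  (X : completeNormedModType R) (A : linear_operator X)
  (hAclosed : closed_operator A) (hAdense : densely_defined A)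
  (t0 : R) (ht0 : 0 <= t0)
  (hMR : maximal_regularity A p t0)
  (f : nat -> R -> X -> X)
  (* implicit in the statement: without it the theorem is false *)
  (hmeas : forall (n : nat) (u : X), Xp A p u ->
     strongly_measurable (whole X) `[0, +oo[ (fun t => f n t u))
  (hIa : forall n : nat,
     in_Lp_loc (whole X) p `[0, +oo[ (fun t => f n t 0))
  (hIb : forall (n : nat) (r : R), 0 < r ->
     exists Psi : R -> R,
       in_Lp_loc (whole (R^o : normedModType R)) p `[0, +oo[ Psi /\
       forall (t : R) (u1 u2 : X), 0 <= t ->
         (Xp_norm A p u1 <= r%:E)%E -> (Xp_norm A p u2 <= r%:E)%E ->
         (`|f n t u1 - f n t u2|%:E <= (Psi t)%:E * Xp_norm A p (u1 - u2)%R)%E)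
  (hIIa : forall (eps a b eta : R), 0 < eps -> 0 <= a -> a <= b -> 0 < eta ->
     exists N : nat, (1 <= N)%N /\ forall n : nat, (N <= n)%N ->
       (ereal_sup [set ereal_sup [set `|f n t u - f 0%N t u|%:E
                                 | u in [set u | (Xp_norm A p u <= eta%:E)%E]]
                  | t in `[a, b]] < eps%:E)%E)
  (u0 : nat -> X) (hu0 : forall n : nat, Xp A p (u0 n))
  (hIIIa : (fun n => Xp_norm A p (u0 n - u0 0%N)) @ \oo --> (0 : \bar R))
  (T : nat -> \bar R) (phi : nat -> R -> X)
  (hphi : forall n : nat,
     is_maximal_solution A p t0 (f n) (u0 n) (T n) (phi n)) :
  [/\ forall n : nat, (0 < T n)%E,
      (T 0%N <= limn_esup T)%E
    & forall a b : R, a <= b -> `[a, b] `<=` ico t0 (T 0%N) ->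
      [/\ \forall n \near \oo, `[a, b] `<=` ico t0 (T n),
          (fun n => ereal_sup [set Xp_norm A p (phi n t - phi 0%N t)
                              | t in `[a, b]]) @ \oo --> (0 : \bar R)
        & (fun n => MR_norm A p `[a, b] (fun t => phi n t - phi 0%N t))
            @ \oo --> (0 : \bar R)]].
Proof.
have hf n : admissible A p (f n) by split; [exact: hmeas|exact: hIa|exact: hIb].
have p0 : 0 < p by exact: lt_trans hp.
have HN := Xp_extended_norm A hp.
have Tpos n : (0 < T n)%E := maximal_pos hp ht0 hMR (hf n) (hu0 n) (hphi n).
have conv := solutions_converge hp ht0 hMR hf hu0 hIIa hIIIa hphi.
split; first exact: Tpos.
  rewrite leNgt; apply/negP => lt0.
  have L0 : (0 <= limn_esup T)%E by apply: limn_esup_ge; apply: nearW => n; exact: ltW.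
  have Lfin : limn_esup T \is a fin_num.
    by rewrite ge0_fin_numE//; apply: lt_le_trans lt0 _; exact: leey.
  rewrite -(fineK Lfin) in lt0; have [S [LS ST]] := exists_between lt0.
  have S0 : 0 < S by apply: le_lt_trans LS; exact: fine_ge0.
  have : (S%:E <= limn_esup T)%E.
    apply: limn_esup_ge; apply: filterS (conv S 1 S0 ST ltr01) => n [hT _ _].
    exact: hT.
  by rewrite -(fineK Lfin) lee_fin leNgt LS.
move=> a b ab sub.
have bin : ico t0 (T 0%N) b by apply: sub; rewrite /= in_itv/= ab lexx.
have ain : ico t0 (T 0%N) a by apply: sub; rewrite /= in_itv/= ab lexx.
have [t0b bT] := bin; have [t0a _] := ain.
have bT' : ((b - t0)%:E < T 0%N)%E.
  by move: bT; case: (T 0%N) => [c| |]//; rewrite ?ltry// -EFinD !lte_fin ltrBlDl.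
have [S [bS ST]] := exists_between bT'.
have S0 : 0 < S by apply: le_lt_trans bS; rewrite subr_ge0.
have abS : `[a, b] `<=` ico t0 S%:E.
  rewrite icoE => t; rewrite /= !in_itv/= => /andP[h1 h2].
  by rewrite (le_trans t0a h1)/= (le_lt_trans h2)// -ltrBlDl.
have icoT n : (S%:E <= T n)%E -> ico t0 S%:E `<=` ico t0 (T n).
  move=> hT t [h1 h2]; split => //; apply: (lt_le_trans h2); exact: leeD.
split.
- apply: filterS (conv S 1 S0 ST ltr01) => n [hT _ _].
  exact: subset_trans abS (icoT n hT).
- apply: cvge0_le => [n|e e0].
    apply: (@le_trans _ _ (Xp_norm A p (phi n a - phi 0%N a)%R)).
      exact: (en_ge0 HN).
    by apply: ereal_sup_ubound; exists a => //; rewrite /= in_itv/= lexx.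
  apply: filterS (conv S e S0 ST e0) => n [_ h _].
  by apply: ge_ereal_sup => _ [t tab <-]; apply: h; exact: abS.
- apply: cvge0_le => [n|e e0].
    by apply: adde_ge0; [exact: Lp_of_ge0|apply: adde_ge0; exact: Lp_of_ge0].
  have [S' [SS' S'T]] := exists_between ST.
  have S'0 : 0 < S' by exact: lt_trans SS'.
  (* on a slightly longer interval [phi n] exists, so that it belongs to the
     maximal regularity class up to [S] *)
  apply: filterS2 (conv S e S0 ST e0) (conv S' 1 S'0 S'T ltr01) => n [_ _ h] [hT _ _].
  have STn : (S%:E < T n)%E by apply: lt_le_trans hT; rewrite lte_fin.
  have [_ hs0 _] := hphi 0%N; have [_ hsn _] := hphi n.
  have [dMR _] := in_MRB hp (bi_ico t0 S) (mrs_in (is_solution_mr hp S0 STn hsn))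
    (mrs_in (is_solution_mr hp S0 ST hs0)).
  apply: le_trans h.
  exact: (MR_norm_sub hp (bi_ico t0 S) (bi_itvcc a b) abS dMR).
Qed.
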